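(* Fix $s,r\in\mathbb{Z}_{\ge1}$ and let $d=2r$. Let $G$ be a random $d$-regular Schreier graph depicting the action of $r$ independent uniformly random permutations $\sigma_1,\ldots,\sigma_r\in S_N$ on $s$-tuples of distinct elements from $[N]=\{1,\ldots,N\}$. Then asymptotically almost surely (i.e., with probability tending to $1$) as $N\to\infty$, $$\mu(G)<2\sqrt{d-1}\cdot\exp\left(\frac{2s^2}{e^2(d-1)}\right).$$ For fixed $s$ and growing $d$, this bound is $$\mu(G)<2\sqrt{d-1}+\frac{4s^2}{e^2\sqrt{d-1}}+O\left(\frac{s^4}{(d-1)^{3/2}}\right).$$ In particular, for every fixed $s$ and every $\varepsilon>0$, if $d$ is large enough, then asymptotically almost surely as $N\to\infty$, $\mu(G)<2\sqrt{d-1}+\varepsilon$.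
   Context: Given an action of a group on a set $X$ and a tuple $g_1,\ldots,g_r$ of group elements, the corresponding Schreier graph is the $2r$-regular graph with vertex set $X$ and an edge $x\sim g_i(x)$ for every $x\in X$ and $i\in\{1,\ldots,r\}$; multiple edges and loops are allowed (each loop $x\sim g_i(x)=x$ contributes $2$ to the degree). Here $X$ is the set of $s$-tuples of distinct elements of $[N]$, with the coordinatewise action of $S_N$, so the graph has $N(N-1)\cdots(N-s+1)$ vertices. For a $d$-regular graph $G$ on $n$ vertices with adjacency eigenvalues $d=\mu_1\ge\mu_2\ge\ldots\ge\mu_n\ge-d$, set $\mu(G)=\max(\mu_2,-\mu_n)$. *)

(* Defs.v *)
From mathcomp Require Import all_boot all_order all_algebra all_fingroup.
From mathcomp Require Import primitive_action polyrcf.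
From mathcomp Require Import all_classical all_reals all_analysis.

Set Implicit Arguments.
Unset Strict Implicit.
Unset Printing Implicit Defensive.

Import Order.TTheory GRing.Theory Num.Theory.
Import numFieldNormedType.Exports.

Local Open Scope ring_scope.

(* Adjacency matrix of the Schreier graph of the action [to] on the vertex set
   X, which is meant to be stable under the action.  The (x, y) entry is the
   number of k with g_k(x) = y plus the number of k with g_k(y) = x, so that
   multiple edges are counted and each loop contributes 2 to the diagonal. *)
Definition schreier_adj (R : realType) (gT : finGroupType) (T : finType)
    (to : {action gT &-> T}) (X : {set T}) (r : nat) (g : {ffun 'I_r -> gT}) :
    'M[R]_#|X| :=
  \matrix_(i, j)
    (#|[set k | to (enum_val i) (g k) == enum_val j]%SET|
     + #|[set k | to (enum_val j) (g k) == enum_val i]%SET|)%:R.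

(* The real eigenvalues of A in nonincreasing order, each repeated according
   to its multiplicity in the characteristic polynomial; for a symmetric A
   these are all the n eigenvalues. *)
Definition eigenvalues (R : realType) (n : nat) (A : 'M[R]_n) : seq R :=
  sort >=%R (flatten [seq nseq (mup x (char_poly A)) x
                     | x <- rootsR (char_poly A)]).

(* max(mu_2, - mu_n), where eigenvalues are numbered from 1.  It is only
   meaningful for n >= 2. *)
Definition mu (R : realType) (n : nat) (A : 'M[R]_n) : R :=
  Num.max (nth 0 (eigenvalues A) 1) (- last 0 (eigenvalues A)).

(* mu of the Schreier graph of sigma acting coordinatewise on the s-tuples of
   distinct elements of 'I_N. *)
Definition mu_tuples (R : realType) (s r N : nat)
    (sigma : {ffun 'I_r -> 'S_N}) : R :=
  mu (schreier_adj R ('P * s)%act (s.-dtuple([set: 'I_N]))%SET sigma).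

(* Probability of an event under the uniform distribution.  The uniform
   distribution on {ffun 'I_r -> 'S_N} is the law of r independent uniformly
   random permutations. *)
Definition unif_prob (R : realType) (T : finType) (E : pred T) : R :=
  #|[set x | E x]%SET|%:R / #|T|%:R.

Definition aas (R : realType) (r : nat)
    (E : forall N : nat, pred {ffun 'I_r -> 'S_N}) : Prop :=
  ((fun N : nat => unif_prob R (E N)) @ \oo --> (1 : R))%classic.

Definition schreier_bound (R : realType) (s d : nat) : R :=
  2 * Num.sqrt (d%:R - 1)
  * expR (2 * s%:R ^+ 2 / (expR 1 ^+ 2 * (d%:R - 1))).

(* Main.v *)
(* The proof is the polynomial method.  Put q = d - 1 and rho = 2 sqrt q, and let
   theta > rho.  Expanding a test function F in the Chebyshev polynomials
   T_j(x / rho) turns the trace of F(A) into a sum, over cyclically reduced words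
   w, of the number of s-tuples fixed by w(sigma_1, ..., sigma_r).  The expected
   number of fixed tuples is, up to the factor prod_(i < M) (1 - i/N)^r, a
   polynomial in 1/N: it is a sum over the ways of identifying the points of s
   closed walks, a pattern with v vertices and e edges contributing N^(v - e).
   Since w is cyclically reduced every vertex of a pattern has degree at least 2,
   so e >= v, and e = v only for disjoint unions of cycles.  Hence the constant
   term is exactly 1 unless w has a nontrivial cyclic period, and there are only
   O(j q^(j/2)) such words of length j, which is what the normalisation of T_j
   absorbs.  A polynomial in 1/N bounded by N^s at all large integers N stays close
   to its constant term once N exceeds a power of its degree (interpolation
   replaces the Markov brothers' inequality).  Taking F = h^(2k) with
   k ~ log_2 N, where h is tiny in the Wiener norm of the Chebyshev basis of
   [-rho, rho], at most 1 on [-d, d] and at least 7/8 where |x| >= theta, the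
   expected contribution of the nontrivial eigenvalues to tr F(A) is
   O(polylog(N) / N), while an eigenvalue beyond theta contributes (7/8)^(2k).
   So mu < theta asymptotically almost surely for every fixed theta > rho. *)

Require Import Defs.
From mathcomp Require Import all_boot all_order all_algebra all_fingroup.
From mathcomp Require Import primitive_action alt polyrcf spectral complex.
From mathcomp Require Import all_classical all_reals all_analysis.
From mathcomp Require Import ring lra zify.
(* Last, because classical_sets shadows lemma names of fintype and finset. *)
From mathcomp Require Import fintype finset.

Import Order.TTheory GRing.Theory Num.Theory.
Import numFieldNormedType.Exports.

Set Implicit Arguments.
Unset Strict Implicit.
Unset Printing Implicit Defensive.

Local Open Scope ring_scope.

(** * Interpolation at reciprocals of integers *)

(** The shape of the proof is dictated by scale. A single bad eigenvalue among up to N^s must be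
    visible in an expected trace, so the exponent 2k has to grow like log N. Take 2^k <= N <
    2^(k+1). The term proportional to the dimension is at most N^s eta^(2k), with eta the Wiener
    norm of h; the choice eta = 2^-(s+2) makes it O(2^-k). What remains is O(1/N), hence O(2^-k), up
    to powers of k. It has to be beaten by the contribution (7/8)^(2k) of a bad eigenvalue, which
    works because (7/8)^2 > 1/2; the quotient is (32/49)^k up to powers of k. The test function has
    degree only O(log N), so every loss that is polynomial in the degree is harmless: crude
    interpolation and a crude count of patterns are enough. A function h of tiny norm can be close
    to 1 outside [-rho, rho] because T_j(x / rho) has Wiener norm 1 for every j but is unbounded in
    j when |x| > rho. The even power makes every eigenvalue contribute a nonnegative amount, so that
    Markov's inequality applies. *)

Section Interpolation.
Variable F : realFieldType.

Lemma bernoulli_le (x : F) n : 0 <= x <= 1 -> 1 - n%:R * x <= (1 - x) ^+ n.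
Proof.
case/andP=> x0 x1; elim: n => [|n IHn]; first by rewrite mul0r subr0 expr0.
rewrite exprS; have y0: 0 <= 1 - x by rewrite subr_ge0.
apply: le_trans (ler_wpM2l y0 IHn).
rewrite -natr1; have: (0 : F) <= n%:R by [].
move=> ?; nra.
Qed.

Lemma prod_sqr_diff (i j : nat) : (j < i)%N ->
  (\prod_(1 <= k < j.+1) ((i%:R : F) ^+ 2 - k%:R ^+ 2))
    * ((i.-1 - j)`!%:R * i`!%:R) = i.-1`!%:R * (i + j)`!%:R.
Proof.
elim: j => [|j IHj] ji; first by rewrite big_geq // mul1r subn0 addn0.
rewrite big_nat_recr //= -mulrA.
have -> : ((i%:R : F) ^+ 2 - j.+1%:R ^+ 2) = (i.-1 - j)%:R * (i + j.+1)%:R.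
  by rewrite (_ : (i.-1 - j) = (i - j.+1))%N ?natrB ?natrD //; [ring|lia|lia].
have -> : (i.-1 - j)%:R * (i + j.+1)%:R * ((i.-1 - j.+1)`!%:R * i`!%:R)
   = ((i.-1 - j)`!%:R * i`!%:R) * (i + j.+1)%:R :> F.
  rewrite (_ : (i.-1 - j) = (i.-1 - j.+1).+1)%N ?factS ?natrM; [ring|lia].
by rewrite mulrA IHj ?addnS ?factS ?natrM; [ring|lia].
Qed.

Lemma prod_sqr (j : nat) : \prod_(1 <= k < j.+1) (k%:R : F) ^+ 2 = j`!%:R ^+ 2.
Proof.
elim: j => [|j IHj]; first by rewrite big_geq // expr1n.
by rewrite big_nat_recr //= IHj factS natrM exprMn mulrC.
Qed.

(** For nodes proportional to k^2, the product is the absolute value at 0 of a Lagrange basis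
    polynomial. It equals 2 C(2m, m - i) / C(2m, m), hence is at most 2 because the central binomial
    coefficient is the largest. *)
Lemma node_prodE (m i : nat) : (0 < i <= m)%N ->
  (\prod_(1 <= k < m.+1 | k != i) ((k%:R : F) ^+ 2 / `|k%:R ^+ 2 - i%:R ^+ 2|))
  * ((m - i)`!%:R * (m + i)`!%:R) = 2 * m`!%:R ^+ 2.
Proof.
case/andP=> i0; elim: m => [|m IHm]; first by lia.
rewrite leq_eqVlt => /orP[/eqP im|]; last first.
  rewrite ltnS => im; rewrite big_mkcond big_nat_recr //= -big_mkcond ifT; last by lia.
  have nE : ((m.+1%:R : F) ^+ 2 - i%:R ^+ 2) = (m.+1 - i)%:R * (m.+1 + i)%:R.
    by rewrite natrB ?natrD; [ring|lia].
  rewrite nE ger0_norm ?mulr_ge0 //.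
  have := IHm im; rewrite subSn // addSn !factS !natrM exprMn.
  set P := \prod_(_ <= _ < _ | _) _ => IH.
  have a0 : ((m - i).+1%:R : F) != 0 by rewrite pnatr_eq0.
  have b0 : ((m + i).+1%:R : F) != 0 by rewrite pnatr_eq0.
  transitivity (m.+1%:R ^+ 2 * (2 * m`!%:R ^+ 2) : F); last by ring.
  rewrite -IH; move: (m - i).+1%:R (m + i).+1%:R a0 b0 => a b a0 b0.
  by field; rewrite a0 b0.
subst i; rewrite big_mkcond big_nat_recr //= -big_mkcond eqxx /= mulr1 subnn fact0 mul1r.
rewrite [X in X * _](_ : _ =
   (\prod_(1 <= k < m.+1) (k%:R ^+ 2)) / \prod_(1 <= k < m.+1) ((m.+1%:R : F) ^+ 2 - k%:R ^+ 2)).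
  rewrite prod_sqr; have := @prod_sqr_diff m.+1 m (ltnSn m).
  rewrite /= subnn fact0 mul1r => E.
  set P := \prod_(_ <= _ < _) _ in E *.
  have f0 n : (n`!%:R : F) != 0 by rewrite pnatr_eq0 -lt0n fact_gt0.
  have -> : P = m`!%:R * (m.+1 + m)`!%:R / m.+1`!%:R by rewrite -E mulfK.
  have : (m.+1%:R : F) != 0 by rewrite pnatr_eq0.
  rewrite addnS; have : (m.+1 + m).+1%:R = 2 * m.+1%:R :> F.
    by rewrite -natrM; congr _%:R; lia.
  rewrite (factS m) natrM; move: (m.+1 + m)%N (m.+1%:R : F) => N M NM.
  rewrite (factS N) !natrM NM.
  move: (m`!%:R : F) (N`!%:R : F) (f0 m) (f0 N) => b c b0 c0 M0.
  by field; rewrite ?M0 ?b0 ?c0.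
transitivity (\prod_(1 <= k < m.+1) ((k%:R : F) ^+ 2 / (m.+1%:R ^+ 2 - k%:R ^+ 2))).
  rewrite big_mkcond [LHS]big_nat_cond [RHS]big_nat_cond.
  apply: eq_bigr => k; rewrite andbT => /andP[k1 km]; rewrite ifT; last by lia.
  rewrite distrC ger0_norm // subr_ge0 ler_pXn2r ?nnegrE // ler_nat; lia.
by rewrite prodf_div.
Qed.

Lemma fact_sqr_le (m i : nat) : (i <= m)%N -> (m`! ^ 2 <= (m - i)`! * (m + i)`!)%N.
Proof.
elim: i => [|i IHi] im; first by rewrite subn0 addn0 mulnn.
apply: leq_trans (IHi (ltnW im)) _.
rewrite (_ : (m - i) = (m - i.+1).+1)%N; last by lia.
rewrite addnS !factS; set a := (_ - _)%N.
have: (a.+1 <= (m + i).+1)%N by rewrite /a; lia.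
by move=> h; rewrite [leqRHS]mulnCA -mulnA leq_mul2r h orbT.
Qed.

Lemma node_prod_le2 (m i : nat) : (0 < i <= m)%N ->
  \prod_(1 <= k < m.+1 | k != i) ((k%:R : F) ^+ 2 / `|k%:R ^+ 2 - i%:R ^+ 2|) <= 2.
Proof.
move=> im; have := node_prodE im; set P := \prod_(_ <= _ < _ | _) _ => E.
have := fact_sqr_le (proj2 (andP im)); rewrite -(ler_nat F) natrX natrM.
set c := (_%:R * _%:R) in E *; have c0 : 0 < c.
  by rewrite /c mulr_gt0 // ltr0n fact_gt0.
move=> h; rewrite -(ler_pM2r c0) E; lra.
Qed.

Lemma lagrange_eval (m : nat) (x : 'I_m -> F) (p : {poly F}) (z : F) :
  injective x -> (size p <= m)%N ->
  p.[z] = \sum_i p.[x i] * \prod_(k | k != i) ((z - x k) / (x i - x k)).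
Proof.
move=> xI sp.
pose l i := \prod_(k | k != i) ((x i - x k)^-1 *: ('X - (x k)%:P)).
have lE i y : (l i).[y] = \prod_(k | k != i) ((y - x k) / (x i - x k)).
  by rewrite horner_prod; apply: eq_bigr => k _; rewrite hornerZ hornerXsubC mulrC.
have l_node i j : (l i).[x j] = (i == j)%:R.
  rewrite lE; case: eqVneq => [<-|ij].
    rewrite big1 // => k ki; rewrite divff // subr_eq0.
    by apply: contra ki => /eqP /xI ->.
  by rewrite (bigD1 j) 1?eq_sym //= subrr !mul0r.
have size_l i : (size (l i) <= m)%N.
  apply: leq_trans (size_prod_leq _ _) _.
  have -> : #|[pred k | k != i]| = m.-1 by rewrite cardC1 card_ord.
  have: (\sum_(k | k != i) size ((x i - x k)^-1 *: ('X - (x k)%:P)) <=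
     \sum_(k | k != i) 2)%N.
    by apply: leq_sum => k _; apply: leq_trans (size_scale_leq _ _) _; rewrite size_XsubC.
  rewrite sum_nat_const cardC1 card_ord; have := ltn_ord i; lia.
pose q := p - \sum_i p.[x i] *: l i.
suff: q = 0.
  move/eqP; rewrite subr_eq0 => /eqP {1}->; rewrite horner_sum.
  by apply: eq_bigr => i _; rewrite hornerZ lE.
apply: (@roots_geq_poly_eq0 _ q (codom x)).
- apply/allP => _ /codomP[j ->]; rewrite rootE /q hornerD hornerN horner_sum.
  rewrite (bigD1 j) //= hornerZ l_node eqxx mulr1 big1 ?addr0 ?subrr //.
  by move=> i ij; rewrite hornerZ l_node (negPf ij) mulr0.
- by rewrite map_inj_uniq ?enum_uniq.
- rewrite size_codom card_ord; apply: leq_trans (size_polyD _ _) _.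
  rewrite geq_max sp size_polyN; apply: leq_trans (size_sum _ _ _) _.
  by apply/bigmax_leqP => i _; apply: leq_trans (size_scale_leq _ _) _.
Qed.

Lemma node_ratio (b I J M : F) (u v : F) :
  0 < I -> 0 < J -> 0 < M -> I * J * M <= b * `|J - I| ->
  0 <= u -> u * I <= b -> b - I <= u * I -> v * J <= b -> b - J <= v * J ->
  u * `|J - I| * (1 - M^-1) <= J * `|u - v|.
Proof.
move=> I0 J0 M0 hM u0 uI uI' vJ vJ'.
have h1 : b * `|J - I| - I * J <= I * J * `|u - v|.
  have [JI|JI] := leP I J.
    rewrite (ger0_norm (_ : 0 <= J - I)) ?subr_ge0 //.
    have := ler_norm (u - v); have := mulr_gt0 I0 J0 => ? ?; nra.
  rewrite (ltr0_norm (_ : J - I < 0)) ?subr_lt0 //.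
  have := ler_norm (v - u); rewrite distrC; have := mulr_gt0 I0 J0 => ? ?; nra.
have h2 : b * `|J - I| * (1 - M^-1) <= I * J * `|u - v|.
  apply: le_trans h1; rewrite mulrBr mulr1 lerD2l lerN2.
  by rewrite ler_pdivlMr.
have [M1|M1] := leP M 1.
  have: 1 - M^-1 <= 0 by rewrite subr_le0 -[leLHS]invr1 lef_pV2 ?posrE.
  move=> h; apply: (@le_trans _ _ 0); last by rewrite mulr_ge0 // ltW.
  by rewrite mulr_ge0_le0 // mulr_ge0.
have M' : 0 <= 1 - M^-1 by rewrite subr_ge0 invf_le1 // ltW.
rewrite -(ler_pM2l I0); apply: le_trans (_ : b * `|J - I| * (1 - M^-1) <= _).
  by rewrite !mulrA ler_wpM2r // ler_wpM2r // mulrC.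
by rewrite mulrA.
Qed.

(* The nodes are 1/N_k with N_k = floor(m^6 / k^2), so that the reciprocals are
   nearly proportional to k^2: for exactly proportional nodes the Lagrange basis
   polynomials are bounded by 2 at 0. *)
Lemma interp_bound (p : {poly F}) (m a : nat) (K : F) :
  (1 < m)%N -> (size p <= m)%N -> 0 <= K ->
  (forall N, (m <= N)%N -> `|p.[N%:R^-1]| <= K * N%:R ^+ a) ->
  forall N, (m ^ 6 <= N)%N -> `|p.[N%:R^-1]| <= (4 * m)%:R * K * (m ^ 6)%:R ^+ a.
Proof.
move=> m1 sp K0 hp N hN.
pose nd k := (m ^ 6 %/ k ^ 2)%N.
have nd_le k : (nd k * k ^ 2 <= m ^ 6)%N by exact: leq_divM.
have nd_gt k : (0 < k)%N -> (m ^ 6 < nd k * k ^ 2 + k ^ 2)%N.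
  by move=> k0; rewrite addnC -mulSn; apply: ltn_ceil; rewrite expn_gt0 k0.
have nd_le6 k : (nd k <= m ^ 6)%N by exact: leq_div.
have nd_ge k : (0 < k <= m)%N -> (m <= nd k)%N.
  case/andP=> k0 km; rewrite /nd leq_divRL ?expn_gt0 ?k0 //.
  apply: leq_trans (_ : m * m ^ 2 <= _)%N; first by rewrite leq_mul2l leq_exp2r // km orbT.
  by rewrite -expnS leq_exp2l.
have B0 : (0 : F) < (m ^ 6)%:R by rewrite ltr0n expn_gt0; lia.
pose x (i : 'I_m) : F := (nd i.+1)%:R^-1.
have key (i k : 'I_m) : k != i -> (nd i.+1)%:R * `|k.+1%:R ^+ 2 - i.+1%:R ^+ 2| * (1 - (m%:R ^+ 2)^-1)
     <= k.+1%:R ^+ 2 * `|(nd i.+1)%:R - (nd k.+1)%:R : F|.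
  move=> ki.
  have d1 : 1 <= `|k.+1%:R ^+ 2 - i.+1%:R ^+ 2 : F|.
    have : ((k.+1)%:Z ^+ 2 - (i.+1)%:Z ^+ 2) != 0.
      by rewrite subr_eq0 eqrXn2 //; apply: contra ki; rewrite eqz_nat.
    by rewrite -normr_gt0 gtz0_ge1 -(ler_int F) intr_norm rmorphB /= !rmorphXn.
  (* Origin of the exponent 6: three factors of size at most m^2 against a difference of distinct
     squares, which is at least 1. *)
  have hB : i.+1%:R ^+ 2 * k.+1%:R ^+ 2 * m%:R ^+ 2 <= (m ^ 6)%:R * `|k.+1%:R ^+ 2 - i.+1%:R ^+ 2 : F|.
    apply: le_trans (_ : (m ^ 6)%:R * 1 <= _); last by rewrite ler_wpM2l // ltW.
    rewrite mulr1 -!natrX -!natrM ler_nat (_ : m ^ 6 = m ^ 2 * m ^ 2 * m ^ 2)%N; last by rewrite -!expnD.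
    by rewrite leq_mul // leq_mul // leq_exp2r.
  apply: (@node_ratio (m ^ 6)%:R) => //; rewrite ?exprn_gt0 ?ltr0n //.
  - by lia.
  - by rewrite -natrX -natrM ler_nat nd_le.
  - by rewrite lerBlDr -natrX -natrM -natrD ler_nat ltnW // nd_gt.
  - by rewrite -natrX -natrM ler_nat nd_le.
  - by rewrite lerBlDr -natrX -natrM -natrD ler_nat ltnW // nd_gt.
have m0 : (0 : F) < m%:R by rewrite ltr0n ltnW.
have m20 : (0 : F) < m%:R ^+ 2 by rewrite exprn_gt0.
have m21 : (1 : F) < m%:R ^+ 2 by rewrite exprn_egt1 // ltr1n.
have M1 : 0 < 1 - (m%:R ^+ 2)^-1 :> F by rewrite subr_gt0 invf_lt1.
have d0 (i k : 'I_m) : k != i -> 0 < `|k.+1%:R ^+ 2 - i.+1%:R ^+ 2 : F|.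
  move=> ki; rewrite normr_gt0 subr_eq0 eqrXn2 // eqr_nat eqSS.
  exact: ki.
have nd0 (k : 'I_m) : 0 < (nd k.+1)%:R :> F.
  by rewrite ltr0n; apply: leq_trans (nd_ge _ _); rewrite ?ltn_ord //; lia.
have dn0 (i k : 'I_m) : k != i -> 0 < `|(nd i.+1)%:R - (nd k.+1)%:R : F|.
  move=> ki; have := key i k ki; have := d0 i k ki; have := nd0 i => h1 h2 h3.
  rewrite lt_neqAle normr_ge0 andbT; apply/eqP => h0; move: h3; rewrite -h0 mulr0.
  by rewrite leNgt mulr_gt0 // mulr_gt0.
have xI : injective x.
  move=> i k xik; apply/eqP; apply: contraT => ki; have := dn0 k i ki.
  have -> : (nd k.+1)%:R = (nd i.+1)%:R :> F by apply: invr_inj.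
  by rewrite subrr normr0 ltxx.
rewrite (lagrange_eval _ xI sp) (le_trans (ler_norm_sum _ _ _)) //.
have N0 : (0 : F) < N%:R by rewrite (lt_le_trans B0) // ler_nat.
have bnd i : `|p.[x i] * \prod_(k < m | k != i) ((N%:R^-1 - x k) / (x i - x k))|
   <= 4 * K * (m ^ 6)%:R ^+ a.
  rewrite normrM -mulrA [4 * _]mulrC; apply: ler_pM => //.
    apply: le_trans (hp _ _) _; first by apply: nd_ge; rewrite ltn_ord.
    by rewrite ler_wpM2l // lerXn2r ?nnegrE ?ler0n // ler_nat nd_le6.
  rewrite normr_prod.
  (* Ideal nodes give a factor at most 2. Rounding costs (1 - m^-2)^-1 for each of the m - 1 other
     nodes, another factor at most 2 by Bernoulli; hence the constant 4. *)
  apply: le_trans (_ : \prod_(k < m | k != i)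
     (((k.+1%:R ^+ 2 / `|k.+1%:R ^+ 2 - i.+1%:R ^+ 2|)) * (1 - (m%:R ^+ 2)^-1)^-1) <= _).
    apply: ler_prod => k ki; rewrite normr_ge0 /= normrM normfV.
    have -> : `|x i - x k| = `|(nd i.+1)%:R - (nd k.+1)%:R| / ((nd i.+1)%:R * (nd k.+1)%:R).
      have -> : x i - x k = ((nd k.+1)%:R - (nd i.+1)%:R) / ((nd i.+1)%:R * (nd k.+1)%:R).
        rewrite /x; move: (nd0 i) (nd0 k) => /lt0r_neq0 ? /lt0r_neq0 ?.
        by field; apply/andP.
      by rewrite normrM normfV distrC [`|_ * _|]ger0_norm // mulr_ge0.
    (* All nodes lie to the right of 1/N >= 0, so |1/N - x k| <= x k: evaluating at 1/N costs no
       more than evaluating at 0. *)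
    apply: le_trans (_ : x k / (`|(nd i.+1)%:R - (nd k.+1)%:R| / ((nd i.+1)%:R * (nd k.+1)%:R)) <= _).
      rewrite ler_wpM2r // ?invr_ge0 ?mulr_ge0 ?invr_ge0 ?mulr_ge0 //.
      rewrite ler_norml; have: N%:R^-1 <= x k.
        by rewrite lef_pV2 ?posrE // ler_nat (leq_trans (nd_le6 _)).
      have: 0 <= N%:R^-1 :> F by rewrite invr_ge0 ltW.
      move=> *; lra.
    have -> : x k / (`|(nd i.+1)%:R - (nd k.+1)%:R| / ((nd i.+1)%:R * (nd k.+1)%:R))
      = (nd i.+1)%:R / `|(nd i.+1)%:R - (nd k.+1)%:R|.
      rewrite /x; move: (nd0 i) (nd0 k) (dn0 i k ki) => /lt0r_neq0 ? /lt0r_neq0 ? /lt0r_neq0 ?.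
      by field; apply/and3P.
    rewrite -mulrA -invfM ler_pdivlMr ?mulr_gt0 ?d0 //.
    by rewrite mulrAC ler_pdivrMr ?dn0 // mulrA key.
  rewrite big_split /= prodr_const.
  rewrite (_ : 4 = 2 * 2); last by ring.
  apply: ler_pM.
  - by apply: prodr_ge0 => k _; rewrite mulr_ge0 ?exprn_ge0 ?invr_ge0.
  - by rewrite exprn_ge0 // invr_ge0 ltW.
  - have := @node_prod_le2 m i.+1; rewrite ltn_ord => /(_ isT).
    by rewrite big_add1 /= big_mkord.
  rewrite exprVn -[leRHS]invrK lef_pV2 ?posrE ?exprn_gt0 ?invr_gt0 //.
  rewrite cardC1 card_ord; apply: le_trans (bernoulli_le _ _); last first.
    by rewrite invr_ge0 exprn_ge0 //= invf_le1 // ltW.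
  have : m.-1%:R / m%:R ^+ 2 <= 2^-1 :> F; last lra.
  rewrite ler_pdivrMr ?exprn_gt0 // ler_pdivlMl // -natrX -natrM ler_nat; nia.
apply: le_trans (ler_sum _ (fun i _ => bnd i)) _.
rewrite sumr_const card_ord -[X in X <= _]mulr_natl natrM.
move: ((m ^ 6)%:R ^+ a) => z; rewrite le_eqVlt; apply/orP; left; apply/eqP; ring.
Qed.

End Interpolation.

(** * Chebyshev expansions and the test function *)

Section Chebyshev.
Variable F : realFieldType.
Implicit Types (x y : F) (f g : F -> F).

Fixpoint chebT j x : F :=
  match j with
  | 0 => 1
  | j1.+1 => match j1 with 0 => x | j2.+1 => 2 * x * chebT j1 x - chebT j2 x end
  end.

Lemma chebTSS j x : chebT j.+2 x = 2 * x * chebT j.+1 x - chebT j x.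
Proof. by []. Qed.

Lemma chebT_mul i j x : (i <= j)%N ->
  2 * (chebT i x * chebT j x) = chebT (i + j) x + chebT (j - i) x.
Proof.
elim/ltn_ind: i j => -[|[|i]] IH j ij.
- by rewrite subn0 add0n /= ; ring.
- by case: j ij => // j _; rewrite add1n subSS subn0 chebTSS /=; ring.
have h0 : 2 * (chebT i x * chebT j x) = chebT (i + j) x + chebT (j - i) x.
  by apply: IH; lia.
have h1 : 2 * (chebT i.+1 x * chebT j x) = chebT (i.+1 + j) x + chebT (j - i.+1) x.
  by apply: IH; lia.
have h2 : chebT (i.+2 + j) x = 2 * x * chebT (i.+1 + j) x - chebT (i + j) x by [].
have h3 : chebT (j - i) x = 2 * x * chebT (j - i.+1) x - chebT (j - i.+2) x.
  have [-> ->] : (j - i = (j - i.+2).+2 /\ j - i.+1 = (j - i.+2).+1)%N by lia.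
  by [].
rewrite chebTSS h2; have -> : chebT (j - i.+2) x = 2 * x * chebT (j - i.+1) x - chebT (j - i) x.
  by rewrite h3; ring.
transitivity (2 * x * (2 * (chebT i.+1 x * chebT j x)) - 2 * (chebT i x * chebT j x)).
  by ring.
by rewrite h0 h1; ring.
Qed.

Lemma chebT_mulE i j x :
  chebT i x * chebT j x = 2^-1 * chebT (i + j) x + 2^-1 * chebT (maxn i j - minn i j) x.
Proof.
wlog ij : i j / (i <= j)%N => [W|].
  case/orP: (leq_total i j) => [ij|ji]; first exact: W.
  by rewrite mulrC addnC maxnC minnC W.
by rewrite (maxn_idPr ij) (minn_idPl ij) -mulrDr -chebT_mul // mulKf ?pnatr_eq0.
Qed.

Lemma chebT_double i x : chebT (i + i) x = 2 * chebT i x ^+ 2 - 1.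
Proof. by rewrite expr2 chebT_mul // subnn /= addrK. Qed.

(* The Wiener algebra of the Chebyshev basis: its norm, the sum of the absolute
   values of the coefficients, is submultiplicative. *)
Definition cheb_bounded (J : nat) (K : F) f :=
  exists b : nat -> F, (forall x, f x = \sum_(j < J.+1) b j * chebT j x) /\
    \sum_(j < J.+1) `|b j| <= K.

Lemma cheb_bounded_ext J K f g : f =1 g -> cheb_bounded J K f -> cheb_bounded J K g.
Proof. by move=> fg [b [bE bK]]; exists b; split=> // x; rewrite -fg. Qed.

Lemma cheb_bounded_le J J' K K' f :
  (J <= J')%N -> K <= K' -> cheb_bounded J K f -> cheb_bounded J' K' f.
Proof.
move=> JJ KK [b [bE bK]]; exists (fun j => if (j < J.+1)%N then b j else 0); split.
  move=> x; rewrite bE (big_ord_widen J'.+1 (fun j => b j * chebT j x)) // big_mkcond.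
  by apply: eq_bigr => j _; case: ifP => // _; rewrite mul0r.
apply: le_trans KK; apply: le_trans bK; rewrite (big_ord_widen J'.+1 (fun j => `|b j|)) // [leRHS]big_mkcond.
by apply: ler_sum => j _; case: ifP => // _; rewrite normr0.
Qed.

Lemma cheb_bounded_T j : cheb_bounded j 1 (chebT j).
Proof.
exists (fun i => (i == j)%:R); split=> [x|].
  rewrite big_ord_recr /= eqxx mul1r big1 ?add0r // => i _.
  by rewrite (_ : _ == _ = false) ?mul0r //; have := ltn_ord i; lia.
rewrite big_ord_recr /= eqxx normr1 big1 ?add0r // => i _.
by rewrite (_ : _ == _ = false) ?normr0 //; have := ltn_ord i; lia.
Qed.

Lemma cheb_boundedD J K K' f g : cheb_bounded J K f -> cheb_bounded J K' g ->
  cheb_bounded J (K + K') (fun x => f x + g x).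
Proof.
move=> [b [bE bK]] [c [cE cK]]; exists (fun j => b j + c j); split=> [x|].
  by rewrite bE cE -big_split; apply: eq_bigr => j _; rewrite mulrDl.
apply: le_trans (lerD bK cK); rewrite -big_split; apply: ler_sum => j _.
exact: ler_normD.
Qed.

Lemma cheb_boundedZ J K f (a : F) : cheb_bounded J K f ->
  cheb_bounded J (`|a| * K) (fun x => a * f x).
Proof.
move=> [b [bE bK]]; exists (fun j => a * b j); split=> [x|].
  by rewrite bE mulr_sumr; apply: eq_bigr => j _; rewrite mulrA.
apply: le_trans (ler_wpM2l (normr_ge0 a) bK); rewrite mulr_sumr.
by apply: ler_sum => j _; rewrite normrM.
Qed.

Lemma cheb_bounded_sum J (n : nat) (K : nat -> F) (f : nat -> F -> F) :
  (forall i, (i < n)%N -> cheb_bounded J (K i) (f i)) ->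
  cheb_bounded J (\sum_(i < n) K i) (fun x => \sum_(i < n) f i x).
Proof.
elim: n => [|n IHn] H.
  exists (fun=> 0); split=> [x|]; rewrite !big_ord0 big1 // => i _.
    by rewrite mul0r.
  by rewrite normr0.
rewrite big_ord_recr /=.
apply: cheb_bounded_ext (cheb_boundedD (IHn (fun i h => H i (ltnW h))) (H n (ltnSn n))).
by move=> x; rewrite big_ord_recr.
Qed.

Lemma cheb_bounded_ge0 J K f : cheb_bounded J K f -> 0 <= K.
Proof. by move=> [b [_ bK]]; apply: le_trans bK; apply: sumr_ge0. Qed.

(** Source of submultiplicativity: T_i T_j is the mean of two basis elements, so multiplying by T_i
    does not increase the norm. *)
Lemma cheb_boundedTM J K f i : cheb_bounded J K f ->
  cheb_bounded (i + J) K (fun x => chebT i x * f x).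
Proof.
move=> [b [bE bK]].
apply: (@cheb_bounded_le (i + J) _ (\sum_(j < J.+1) `|b j| * 1)) => //.
  by apply: le_trans bK; apply: ler_sum => j _; rewrite mulr1.
apply: (@cheb_bounded_ext _ _ (fun x => \sum_(j < J.+1) b j * (chebT i x * chebT j x))).
  by move=> x; rewrite bE mulr_sumr; apply: eq_bigr => j _; rewrite mulrCA.
apply: (@cheb_bounded_sum _ _ (fun j => `|b j| * 1)
   (fun j x => b j * (chebT i x * chebT j x))) => j jJ; apply: cheb_boundedZ.
apply: (@cheb_bounded_ext _ _ (fun x => 2^-1 * chebT (i + j) x
   + 2^-1 * chebT (maxn i j - minn i j) x)); first by move=> x; rewrite chebT_mulE.
have h2 : 1 = `|2^-1| * 1 + `|2^-1| * 1 :> F by rewrite ger0_norm ?invr_ge0 //; lra.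
rewrite [X in cheb_bounded _ X]h2.
by apply: cheb_boundedD; apply: cheb_boundedZ; apply: cheb_bounded_le (cheb_bounded_T _) => //; lia.
Qed.

Lemma cheb_boundedM J J' K K' f g : cheb_bounded J K f -> cheb_bounded J' K' g ->
  cheb_bounded (J + J') (K * K') (fun x => f x * g x).
Proof.
move=> [b [bE bK]] gK; have K'0 := cheb_bounded_ge0 gK.
apply: (@cheb_bounded_le (J + J') _ (\sum_(j < J.+1) `|b j| * K')) => //.
  by rewrite -mulr_suml; apply: ler_wpM2r.
apply: (@cheb_bounded_ext _ _ (fun x => \sum_(j < J.+1) b j * (chebT j x * g x))).
  by move=> x; rewrite bE mulr_suml; apply: eq_bigr => j _; rewrite mulrA.
apply: (@cheb_bounded_sum _ _ (fun j => `|b j| * K') (fun j x => b j * (chebT j x * g x))).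
move=> j jJ; apply: cheb_boundedZ.
by apply: cheb_bounded_le (cheb_boundedTM j gK) => //; lia.
Qed.

Lemma cheb_boundedX J K f n : cheb_bounded J K f ->
  cheb_bounded (n * J) (K ^+ n) (fun x => f x ^+ n).
Proof.
move=> fK; elim: n => [|n IHn]; first exact: (cheb_bounded_T 0).
rewrite mulSn exprS; apply: cheb_bounded_ext (cheb_boundedM fK IHn) => x.
by rewrite exprS.
Qed.

(** Subtracting the constant 1 is what makes the norm small: it is of order n K when n K is small,
    whereas that of (1 - f)^n is only bounded near 1. *)
Lemma cheb_bounded_expB J K f n : cheb_bounded J K f ->
  cheb_bounded (n * J) ((1 + K) ^+ n - 1) (fun x => (1 - f x) ^+ n - 1).
Proof.
move=> fK; elim: n => [|n IHn].
  by exists (fun=> 0); split=> [x|]; rewrite subrr big1 // => i _; rewrite ?mul0r ?normr0.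
have K0 := cheb_bounded_ge0 fK.
have h1 : cheb_bounded J (1 + `|-1| * K) (fun x => 1 + (-1) * f x).
  by apply: cheb_boundedD (cheb_boundedZ _ fK); apply: cheb_bounded_le (cheb_bounded_T 0).
have h2 : cheb_bounded (n.+1 * J) (`|-1| * K) (fun x => (-1) * f x).
  by apply: cheb_bounded_le (cheb_boundedZ _ fK) => //; nia.
have := cheb_boundedD (cheb_bounded_le _ (lexx _) (cheb_boundedM IHn h1)) h2.
move/(_ ltac:(nia)); rewrite normrN normr1 mul1r.
rewrite (_ : _ * _ + _ = (1 + K) ^+ n.+1 - 1); last by rewrite exprS; ring.
by apply: cheb_bounded_ext => x; rewrite exprS; ring.
Qed.

End Chebyshev.

Section TestFunction.
Variable F : archiRealFieldType.

Lemma bernoulli_ge (u : F) n : 0 <= u -> 1 + n%:R * u <= (1 + u) ^+ n.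
Proof.
move=> u0; elim: n => [|n IHn]; first by rewrite mul0r addr0 expr0.
rewrite exprS; apply: le_trans (ler_wpM2l _ IHn); last by lra.
have: (0 : F) <= n%:R by []. rewrite -natr1 => ?; nra.
Qed.

Lemma expr_sub1_le (v : F) n : 0 <= v <= 1 -> (1 - v) ^+ n * (1 + n%:R * v) <= 1.
Proof.
case/andP=> v0 v1; apply: le_trans (_ : (1 - v) ^+ n * (1 + v) ^+ n <= _).
  by rewrite ler_wpM2l ?bernoulli_ge // exprn_ge0 // subr_ge0.
by rewrite -exprMn exprn_ile1 //; nra.
Qed.

Lemma expr_add1_le (u : F) n : 0 <= u <= 1 -> n%:R * u <= 2^-1 ->
  (1 + u) ^+ n <= 1 + 2 * (n%:R * u).
Proof.
move=> /andP[u0 u1] nu; have n0 : (0 : F) <= n%:R by [].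
have h : (1 + u) ^+ n * (1 - n%:R * u) <= 1.
  apply: le_trans (_ : (1 + u) ^+ n * (1 - u) ^+ n <= _).
    by rewrite ler_wpM2l ?bernoulli_le ?u0 // exprn_ge0 // addr_ge0.
  by rewrite -exprMn exprn_ile1 //; nra.
have w0 : 0 <= n%:R * u by rewrite mulr_ge0.
have z0 : 0 <= (1 + u) ^+ n by rewrite exprn_ge0 // addr_ge0.
move: ((1 + u) ^+ n) (n%:R * u) z0 w0 nu h => z w *; nra.
Qed.

Let psi (y : F) := 2 * y ^+ 2 - 1.

Lemma iter_psiE a (x : F) : iter a psi x = chebT (2 ^ a) x.
Proof. by elim: a => //= a IHa; rewrite IHa /psi expnS mul2n -addnn chebT_double. Qed.

Lemma iter_psi_ge1 a (y : F) : 1 <= y -> 1 <= iter a psi y.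
Proof. by move=> y1; elim: a => //= a; rewrite /psi; nra. Qed.

(** [psi y - 1 = 2 (y - 1) (y + 1)] is at least [4 (y - 1)]. Restricting to the degrees 2^a reduces
    the growth of Chebyshev polynomials beyond 1 to this one inequality. *)
Lemma iter_psi_grow a (y : F) : 1 <= y -> 1 + 4 ^+ a * (y - 1) <= iter a psi y.
Proof.
move=> y1; elim: a => [|a IHa]; first by rewrite mul1r addrC subrK.
have : 0 <= 4 ^+ a * (y - 1) by rewrite mulr_ge0 ?exprn_ge0 // subr_ge0.
rewrite exprS iterS /psi -mulrA; move: (4 ^+ a * _) (iter _ _ _) IHa => u z *; nra.
Qed.

Lemma iter_psi_le a (x X : F) : 1 <= X -> `|x| <= X -> `|iter a psi x| <= iter a psi X.
Proof.
move=> X1 xX; elim: a => //= a; have := iter_psi_ge1 a X1.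
move: (iter a psi x) (iter a psi X) => z Z Z1 zZ; rewrite /psi ler_norml.
have : z ^+ 2 <= Z ^+ 2 by rewrite -(real_normK (num_real z)) lerXn2r ?nnegrE ?normr_ge0 // (le_trans ler01).
have := sqr_ge0 z => *; apply/andP; split; nra.
Qed.

(** At least one application of [psi] is required, since its square removes the sign of x. *)
Lemma iter_psi_ge a (x Y : F) : 1 <= Y -> Y <= `|x| -> iter a.+1 psi Y <= iter a.+1 psi x.
Proof.
move=> Y1 Yx; elim: a => [|a IHa].
  rewrite /= /psi; have := real_normK (num_real x); have : 0 <= `|x| by [].
  by move: (`|x|) Yx => w *; nra.
have := iter_psi_ge1 a.+1 Y1; rewrite !iterS in IHa *.
move: (psi (iter a psi Y)) (psi (iter a psi x)) IHa => *; rewrite /psi; nra.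
Qed.

(* With y = T_(2^a)(x) very large where |x| >= theta, and at most y1 for |x| <= dd,
   take h = 1 - (1 - y / y1)^n with n about eta y1. *)
Lemma test_function (theta dd eta : F) : 1 < theta -> theta <= dd -> 0 < eta ->
  exists J h, [/\ cheb_bounded J eta h,
     forall x, `|x| <= dd -> `|h x| <= 1
   & forall x, theta <= `|x| <= dd -> 7 / 8 <= h x].
Proof.
move=> t1 tdd eta0.
(* The norm of the final function will be at most 2 c, and c <= 1/2 is the range of
   [expr_add1_le]. *)
pose c := Num.min eta 1 / 2.
have [c0 c1 ceta] : [/\ 0 < c, c <= 2^-1 & 2 * c <= eta].
  rewrite /c; case: (leP eta 1) => ?; split; lra.
(* With n about c y1, this gives n y0 / y1 >= 8 - 1 = 7, and [expr_sub1_le] then bounds (1 - y0 /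
   y1)^n by 1/8. *)
have [a ha] : exists a, 8 / c <= iter a.+1 psi theta.
  exists (Num.bound ((8 / c) / (theta - 1))).
  set b := Num.bound _; apply: le_trans (iter_psi_grow _ (ltW t1)).
  have hb : (8 / c) / (theta - 1) < b%:R.
    apply: archi_boundP; apply: divr_ge0; last by rewrite subr_ge0 ltW.
    by apply: divr_ge0 => //; exact: ltW.
  rewrite ltr_pdivrMr ?subr_gt0 // in hb.
  have : b%:R <= 4 ^+ b.+1 :> F.
    by rewrite -natrX ler_nat ltnW // (leq_trans (ltn_expl b (isT : 1 < 4)%N)) // leq_exp2l.
  move=> h; have : b%:R * (theta - 1) <= 4 ^+ b.+1 * (theta - 1) by rewrite ler_wpM2r // subr_ge0 ltW.
  lra.
set y0 := iter a.+1 psi theta in ha; set y1 := iter a.+1 psi dd.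
have y01 : y0 <= y1.
  apply: iter_psi_ge; first exact: ltW.
  by rewrite ger0_norm // (le_trans _ tdd) // (le_trans ler01) // ltW.
have y0_16 : 16 <= y0.
  apply: le_trans ha; rewrite ler_pdivlMr //; lra.
have y1_0 : 0 < y1 by lra.
pose n := Num.truncn (c * y1).
have nle : n%:R <= c * y1 by rewrite truncn_le; apply: mulr_ge0; apply: ltW.
have ngt : c * y1 < n%:R + 1 by rewrite natr1; apply: truncnS_gt.
have ny : n%:R * y1^-1 <= c by rewrite ler_pdivrMr.
exists (n * 2 ^ a.+1)%N, (fun x => 1 - (1 - y1^-1 * chebT (2 ^ a.+1) x) ^+ n).
have uy : 0 <= y1^-1 <= 1.
  by rewrite invr_ge0 ltW //= invf_le1 //; lra.
have e1 : (1 + y1^-1) ^+ n <= 1 + 2 * (n%:R * y1^-1).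
  by apply: expr_add1_le => //; lra.
have dd1 : 1 <= dd by lra.
split.
- have := cheb_boundedZ y1^-1 (cheb_bounded_T F (2 ^ a.+1)).
  rewrite ger0_norm ?mulr1; last by case/andP: uy.
  move=> /(@cheb_bounded_expB _ _ _ _ n)/(cheb_boundedZ (-1)).
  move=> /(cheb_bounded_le (leqnn _)) H.
  apply: cheb_bounded_ext (H eta _); first by move=> x; ring.
  by rewrite normrN normr1; lra.
- move=> x xd; rewrite -iter_psiE.
  (* Hence 0 <= z <= 1 + 1/y1 and z^n <= 1 + 2 c <= 2, which places 1 - z^n in [-1, 1]. *)
  have yx : -1 <= iter a.+1 psi x.
    rewrite iterS /psi; have := sqr_ge0 (iter a psi x); lra.
  have := iter_psi_le a.+1 dd1 xd; rewrite -/y1 => /ler_normlP[_ xy1].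
  set z := 1 - y1^-1 * _; have zl : 0 <= z.
    by rewrite subr_ge0 ler_pdivrMl // mulr1.
  have zu : z <= 1 + y1^-1.
    rewrite lerD2l -mulrN -[leRHS]mulr1 ler_wpM2l //; last lra.
    by case/andP: uy.
  have : z ^+ n <= (1 + y1^-1) ^+ n by rewrite lerXn2r // nnegrE ?addr_ge0 //; case/andP: uy.
  have : 0 <= z ^+ n by rewrite exprn_ge0.
  by move=> *; rewrite ler_norml; apply/andP; split; lra.
- move=> x /andP[tx xd]; rewrite -iter_psiE.
  have := iter_psi_le a.+1 dd1 xd; rewrite -/y1 => /ler_normlP[_ xy1].
  have y0x : y0 <= iter a.+1 psi x by apply: iter_psi_ge => //; exact: ltW.
  have v01 : 0 <= y1^-1 * y0 <= 1.
    by rewrite mulr_ge0 ?ler_pdivrMl ?mulr1 ?y01 //; [case/andP: uy | lra].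
  have : (1 - y1^-1 * iter a.+1 psi x) ^+ n <= (1 - y1^-1 * y0) ^+ n.
    rewrite lerXn2r ?nnegrE ?subr_ge0 ?ler_pdivrMl ?mulr1 //; last first.
      by rewrite lerD2l lerN2 ler_wpM2l //; case/andP: uy.
  have := expr_sub1_le n v01.
  have : 7 <= n%:R * (y1^-1 * y0).
    have : (c * y1 - 1) * (y1^-1 * y0) <= n%:R * (y1^-1 * y0).
      by rewrite ler_wpM2r //; [case/andP: v01|lra].
    have -> : (c * y1 - 1) * (y1^-1 * y0) = c * y0 - y1^-1 * y0.
      by field; rewrite gt_eqF.
    have : 8 <= c * y0 by rewrite -ler_pdivrMl // mulrC.
    move: v01 => /andP[_ ?] *; lra.
  have : 0 <= (1 - y1^-1 * y0) ^+ n by rewrite exprn_ge0 // subr_ge0; case/andP: v01.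
  move: ((1 - y1^-1 * y0) ^+ n) (n%:R * _) => u w *; nra.
Qed.

End TestFunction.

(** * Cyclically reduced words and traces *)

Section Words.
Variables (L : finType) (inv : L -> L) (q : nat).
Hypotheses (invK : involutive inv) (inv_neq : forall c, inv c != c).
Hypothesis cardL : #|L| = q.+1.

Definition noncancel (a b : L) := b != inv a.

Lemma noncancelC a b : noncancel a b = noncancel b a.
Proof. by rewrite /noncancel -(inj_eq (inv_inj invK)) invK eq_sym. Qed.

Lemma big_tuple_cons (V : nmodType) j (P : seq L -> bool) (G : seq L -> V) :
  \sum_(w : j.+1.-tuple L | P w) G w =
  \sum_c \sum_(w : j.-tuple L | P (c :: w)) G (c :: w).
Proof.
rewrite (partition_big (fun w : j.+1.-tuple L => thead w) xpredT) //=.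
apply: eq_bigr => c _.
rewrite (reindex_onto (fun w : j.-tuple L => cons_tuple c w) (fun w => behead_tuple w)) /=.
  apply: eq_bigl => w; rewrite theadE eqxx andbT.
  by case: (P _) => //=; apply/eqP/val_inj.
move=> w /andP[_ /eqP <-]; apply: val_inj => /=; by rewrite [in RHS](tuple_eta w).
Qed.

Lemma big_tuple0 (V : nmodType) (P : seq L -> bool) (G : seq L -> V) :
  \sum_(w : 0.-tuple L | P w) G w = if P [::] then G [::] else 0.
Proof.
rewrite big_mkcond (big_pred1 [tuple]) // => w; rewrite /=.
by apply/esym/eqP/val_inj; case: w => -[].
Qed.

Lemma big_tuple_rcons (V : nmodType) j (P : seq L -> bool) (G : seq L -> V) :
  \sum_(w : j.+1.-tuple L | P w) G w =
  \sum_(w : j.-tuple L) \sum_(d | P (rcons w d)) G (rcons w d).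
Proof.
elim: j P G => [|j IHj] P G.
  rewrite big_tuple_cons (eq_bigr (fun c => if P [:: c] then G [:: c] else 0)); last first.
    by move=> c _; rewrite (big_tuple0 (fun w => P (c :: w)) (fun w => G (c :: w))).
  by rewrite (big_tuple0 xpredT (fun w => \sum_(d | P (rcons w d)) G (rcons w d))) /= [RHS]big_mkcond.
rewrite big_tuple_cons.
rewrite (eq_bigr _ (fun c _ => IHj (fun w => P (c :: w)) (fun w => G (c :: w)))).
by rewrite [RHS](big_tuple_cons j xpredT (fun w => \sum_(d | P (rcons w d)) G (rcons w d))).
Qed.

Lemma card_noncancel a : #|[pred c | noncancel c a]| = q.
Proof.
have -> : #|[pred c | noncancel c a]| = #|predC1 (inv a)|.
  apply: eq_card => c; rewrite !inE /noncancel; congr (~~ _).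
  by apply/eqP/eqP => ->; rewrite invK.
by rewrite cardC1 cardL.
Qed.

Section TraceIdentity.
Variables (R : comNzRingType) (n : nat) (M : L -> 'M[R]_n).
Hypothesis MK : forall c, M c *m M (inv c) = 1%:M.

Definition word_mx (w : seq L) : 'M[R]_n := foldr (fun c B => M c *m B) 1%:M w.
Definition letter_mx : 'M[R]_n := \sum_c M c.
Definition reduced_mx j : 'M[R]_n :=
  \sum_(w : j.-tuple L | sorted noncancel w) word_mx w.

Lemma reduced_mx0 : reduced_mx 0 = 1%:M.
Proof.
by rewrite /reduced_mx (big_tuple0 (sorted noncancel) word_mx).
Qed.

Lemma reduced_mx1 : reduced_mx 1 = letter_mx.
Proof.
rewrite /reduced_mx big_tuple_cons; apply: eq_bigr => c _.
rewrite (big_tuple0 (fun w => sorted noncancel (c :: w)) (fun w => word_mx (c :: w))).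
by rewrite /= mulmx1.
Qed.

(** A letter put before a reduced word either keeps it reduced or cancels its first letter. In the
    second case a given remainder of length j arises from q letters, or from all q + 1 if it is
    empty. *)
Lemma letter_mx_reduced j :
  letter_mx *m reduced_mx j.+1 = reduced_mx j.+2 +
    (if j is 0 then q.+1 else q)%:R *: reduced_mx j.
Proof.
rewrite /letter_mx /reduced_mx mulmx_suml.
rewrite (eq_bigr (fun c => \sum_(w : j.+1.-tuple L | sorted noncancel w) word_mx (c :: w))); last first.
  by move=> c _; rewrite mulmx_sumr.
rewrite (big_tuple_cons j.+1) (eq_bigr (fun c =>
   \sum_(w : j.+1.-tuple L | sorted noncancel (c :: w)) word_mx (c :: w) +
   \sum_(w : j.+1.-tuple L | sorted noncancel w && ~~ sorted noncancel (c :: w)) word_mx (c :: w))); last first.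
  move=> c _; rewrite (bigID (fun w : j.+1.-tuple L => sorted noncancel (c :: w))) /=.
  congr (_ + _); apply: eq_bigl => w; case: w => -[|d w] /= _; rewrite ?andbT //.
  by rewrite andbA andbC; case: noncancel; case: path.
rewrite big_split /=; congr (_ + _).
rewrite (eq_bigr (fun c => \sum_(w : j.-tuple L | path noncancel (inv c) w) word_mx w)); last first.
  move=> c _; rewrite (big_tuple_cons j (fun w => sorted noncancel w && ~~ path noncancel c w) (fun w => word_mx (c :: w))).
  rewrite (bigD1 (inv c)) //= [X in _ + X]big1 ?addr0 => [|d dc].
    apply: eq_big => [w|w _]; first by rewrite /noncancel eqxx /= andbT.
    by rewrite mulmxA MK mul1mx.
  rewrite big_pred0 // => w; rewrite /noncancel dc /=.
  by case: path.
rewrite (reindex_inj (inv_inj invK)) /=.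
rewrite (eq_bigr (fun c => \sum_(w : j.-tuple L | path noncancel c w) word_mx w)); last first.
  by move=> c _; rewrite invK.
rewrite scaler_sumr (exchange_big_dep (fun w : j.-tuple L => sorted noncancel w)) /=; last first.
  by move=> c w _; apply: path_sorted.
apply: eq_bigr => w sw; rewrite sumr_const scaler_nat; congr (_ *+ _).
case: j w sw => [|j] w sw; first by rewrite -cardL; apply: eq_card => c; rewrite !inE tuple0.
case: w sw => -[|a w] //= _ sw; rewrite -(card_noncancel a).
by apply: eq_card => c; rewrite !inE /= sw unfold_in andbT.
Qed.

Variable A : 'M[R]_n.

(* dickson_mx j is 2 q^(j/2) T_j(A / (2 sqrt q)), without the square roots. *)
Fixpoint dickson_mx (j : nat) : 'M[R]_n :=
  match j with
  | 0 => 2%:M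
  | j1.+1 => match j1 with
             | 0 => A
             | j2.+1 => A *m dickson_mx j1 - q%:R *: dickson_mx j2
             end
  end.

Hypothesis AE : A = letter_mx.

Lemma dickson_mx2 : dickson_mx 2 = reduced_mx 2 - (q%:R - 1)%:M.
Proof.
have := letter_mx_reduced 0; rewrite reduced_mx1 reduced_mx0 -AE /= => ->.
by apply/matrixP => i k; rewrite !mxE; case: (i == k); rewrite ?mulr1n ?mulr0n; ring.
Qed.

(** Both sides satisfy the same three-term recurrence in A. The first two cases are separate because
    the coefficient q + 1 of the empty word still enters there. *)
Lemma dickson_mx_reduced j :
  dickson_mx j.+3 = dickson_mx j.+1 + reduced_mx j.+3 - q%:R *: reduced_mx j.+1.
Proof.
have AA k : A *m reduced_mx k.+2 = reduced_mx k.+3 + q%:R *: reduced_mx k.+1.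
  by rewrite AE letter_mx_reduced.
have A2 : A *m A = reduced_mx 2 + q.+1%:R%:M.
  by rewrite {2}AE -reduced_mx1 AE letter_mx_reduced reduced_mx0 scalemx1.
have R1 : reduced_mx 1 = A by rewrite reduced_mx1 AE.
have D3 : dickson_mx 3 = A *m dickson_mx 2 - q%:R *: A by [].
have D4 : dickson_mx 4 = A *m dickson_mx 3 - q%:R *: dickson_mx 2 by [].
have E0 : dickson_mx 3 = dickson_mx 1 + reduced_mx 3 - q%:R *: reduced_mx 1.
  rewrite D3 dickson_mx2 mulmxBr AA R1 mul_mx_scalar /=.
  by apply/matrixP => i k; rewrite !mxE; ring.
elim/ltn_ind: j => -[|[|j]] IH //.
  rewrite D4 E0 dickson_mx2 mulmxBr mulmxDr AA -scalemxAr R1 A2.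
  by apply/matrixP => i k; rewrite !mxE; case: (i == k); rewrite ?mulr1n ?mulr0n -?natr1; ring.
have [I1 I2] : dickson_mx j.+3 = dickson_mx j.+1 + reduced_mx j.+3 - q%:R *: reduced_mx j.+1 /\
  dickson_mx j.+4 = dickson_mx j.+2 + reduced_mx j.+4 - q%:R *: reduced_mx j.+2.
  by split; apply: IH.
have -> : dickson_mx j.+2.+3 = A *m dickson_mx j.+4 - q%:R *: dickson_mx j.+3 by [].
rewrite I2 mulmxBr mulmxDr !AA -scalemxAr AA {1}I1.
have -> : dickson_mx j.+3 = A *m dickson_mx j.+2 - q%:R *: dickson_mx j.+1 by [].
by apply/matrixP => i k; rewrite !mxE; ring.
Qed.

End TraceIdentity.

Section ConjugationInvariant.
Variables (R : comNzRingType) (G : seq L -> R).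
Hypothesis GJ : forall c w, G (c :: rcons w (inv c)) = G w.

Definition cyclic_sum j := \sum_(w : j.-tuple L | path.cycle noncancel w) G w.
Definition reduced_sum j := \sum_(w : j.-tuple L | sorted noncancel w) G w.
Definition conj_sum j :=
  \sum_(w : j.-tuple L | sorted noncancel w && ~~ path.cycle noncancel w) G w.

Lemma cycle_sorted (w : seq L) : path.cycle noncancel w -> sorted noncancel w.
Proof. by case: w => //= a w; rewrite rcons_path => /andP[]. Qed.

Lemma reduced_sum_split j : reduced_sum j = cyclic_sum j + conj_sum j.
Proof.
rewrite /reduced_sum (bigID (fun w : j.-tuple L => path.cycle noncancel w)) /=.
congr (_ + _); apply: eq_bigl => w; apply: andb_idl; exact: cycle_sorted.
Qed.

Lemma conj_sum1 : conj_sum 1 = 0.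
Proof.
rewrite /conj_sum big_pred0 // => -[[|a [|b w]] //= _].
by rewrite /noncancel andbT eq_sym inv_neq.
Qed.

Lemma conj_sum2 : conj_sum 2 = 0.
Proof.
rewrite /conj_sum big_pred0 // => -[[|a [|b [|c w]]] //= _].
by rewrite (noncancelC b); case: noncancel.
Qed.

(** A reduced word that is not cyclically reduced is c w c^-1 with w reduced. The letter c must
    avoid the inverse of the first letter of w and the last letter of w. These are two exclusions if
    w is cyclically reduced, leaving q - 1 choices, and otherwise they coincide, leaving q. *)
Lemma conj_sumSS j :
  conj_sum j.+3 = (q%:R - 1) * cyclic_sum j.+1 + q%:R * conj_sum j.+1.
Proof.
rewrite /conj_sum (big_tuple_cons _ (fun w => sorted noncancel w && ~~ path.cycle noncancel w)).
rewrite (eq_bigr (fun c => \sum_(w : j.+1.-tuple L | sorted noncancel (c :: rcons w (inv c))) G w)); last first.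
  move=> c _; rewrite (big_tuple_rcons j.+1
    (fun w => sorted noncancel (c :: w) && ~~ path.cycle noncancel (c :: w)) (fun w => G (c :: w))).
  rewrite [RHS]big_mkcond; apply: eq_bigr => w _.
  rewrite big_mkcond (bigD1 (inv c)) //= [X in _ + X]big1 ?addr0 => [|d dc].
    by rewrite !rcons_path last_rcons /noncancel invK eqxx /= andbF andbT GJ.
  rewrite !rcons_path last_rcons.
  suff -> : noncancel d c by rewrite andbT andbN.
  by rewrite /noncancel; apply: contra dc => /eqP->; rewrite invK.
rewrite (exchange_big_dep (fun w : j.+1.-tuple L => sorted noncancel w)) /=; last first.
  by move=> c w _; rewrite rcons_path => /andP[/path_sorted].
rewrite (bigID (fun w : j.+1.-tuple L => path.cycle noncancel w)) /= /cyclic_sum !mulr_sumr.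
have cnt (w : j.+1.-tuple L) : sorted noncancel w ->
  #|[pred c | path noncancel c (rcons w (inv c))]| = (q - path.cycle noncancel w)%N.
  case: w => -[|a w] //= _ sw; rewrite rcons_path sw /=.
  have -> : #|[pred c | noncancel c a && path noncancel a (rcons w (inv c))]| =
            #|[pred c | (c != inv a) && (c != last a w)]|.
    apply: eq_card => c; rewrite !inE rcons_path sw /= /noncancel.
    congr (_ && _); congr (~~ _).
      by apply/eqP/eqP => ->; rewrite invK.
    by rewrite (inj_eq (inv_inj invK)).
  have -> : noncancel (last a w) a = (last a w != inv a).
    by rewrite noncancelC.
  case: (eqVneq (last a w) (inv a)) => [e|ne] /=.
    rewrite subn0 -[RHS](_ : #|predC1 (inv a)| = q); last by rewrite cardC1 cardL.
    by apply: eq_card => c; rewrite !inE e andbb.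
  have := cardL; rewrite (cardD1 (inv a)) (cardD1 (last a w)) !inE ne /= => e.
  have -> : #|[pred c | (c != inv a) && (c != last a w)]| =
            #|[predD1 [predD1 L & inv a] & last a w]|.
    by apply: eq_card => c; rewrite !inE andbT andbC.
  by move: e; set m := #|_|; lia.
have qpos : (0 < q)%N.
  have /card_gt0P[c _] : (0 < #|L|)%N by rewrite cardL.
  have := cardL; rewrite (cardD1 c) (cardD1 (inv c)) !inE inv_neq /=; lia.
congr (_ + _).
  rewrite (eq_bigl (fun w : j.+1.-tuple L => path.cycle noncancel w)); last first.
    by move=> w; apply: andb_idl; apply: cycle_sorted.
  apply: eq_bigr => w cw; rewrite sumr_const cnt ?cycle_sorted // cw.
  by rewrite -[LHS]mulr_natl natrB.
apply: eq_bigr => w /andP[sw /negPf cw].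
by rewrite sumr_const cnt // cw subn0 mulr_natl.
Qed.

End ConjugationInvariant.

Section Trace.
Variables (R : comNzRingType) (n : nat) (M : L -> 'M[R]_n).
Hypothesis MK : forall c, M c *m M (inv c) = 1%:M.

Lemma word_mx_cat u v : word_mx M (u ++ v) = word_mx M u *m word_mx M v.
Proof. by elim: u => [|c u IHu] /=; rewrite ?mul1mx // IHu mulmxA. Qed.

Lemma tr_word_mxJ c w : \tr (word_mx M (c :: rcons w (inv c))) = \tr (word_mx M w).
Proof.
by rewrite /= -cats1 word_mx_cat /= mulmx1 mxtrace_mulC -mulmxA -{2}(invK c) MK mulmx1.
Qed.

(** A trace form of the Ihara-Bass formula. By [conj_sumSS], the trace of R_(j+3) - q R_(j+1) is the
    difference of the two cyclic sums, so the recurrence of [dickson_mx_reduced] telescopes. The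
    correction, present for even lengths only, comes from the scalar in [dickson_mx2]. *)
Lemma trace_dickson_mx j : \tr (dickson_mx (letter_mx M) j.+1) =
  \sum_(w : j.+1.-tuple L | path.cycle noncancel w) \tr (word_mx M w)
   - (odd j)%:R * ((q%:R - 1) * n%:R).
Proof.
pose G w := \tr (word_mx M w); have GJ := tr_word_mxJ.
have P k : \tr (reduced_mx M k) = cyclic_sum G k + conj_sum G k.
  by rewrite -reduced_sum_split /reduced_mx raddf_sum.
elim/ltn_ind: j => -[|[|j]] IH.
- by rewrite /= mul0r subr0 -reduced_mx1 P conj_sum1 addr0.
- rewrite (dickson_mx2 MK) // mul1r raddfB /= mxtrace_scalar P conj_sum2 addr0.
  by rewrite mulr_natr.
have trB (X Y : 'M[R]_n) : \tr (X - Y) = \tr X - \tr Y by rewrite raddfB.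
rewrite (dickson_mx_reduced MK) // trB mxtraceD mxtraceZ IH // !P.
rewrite (conj_sumSS GJ) -!/(cyclic_sum G _) /=; case: (odd j) => /=; ring.
Qed.

End Trace.
End Words.

(** * Eigenvalues of symmetric matrices *)

Section Dickson.
Variables (R : comNzRingType) (q : nat).

Fixpoint dickson (x : R) (j : nat) : R :=
  match j with
  | 0 => 2
  | j1.+1 => match j1 with
             | 0 => x
             | j2.+1 => x * dickson x j1 - q%:R * dickson x j2
             end
  end.

End Dickson.

Section Spectrum.
Variable R : rcfType.

Lemma dickson_mx_conj (C : fieldType) n q (P D A : 'M[C]_n) j : P \in unitmx ->
  A = invmx P *m D *m P -> dickson_mx q A j = invmx P *m dickson_mx q D j *m P.
Proof.
move=> uP AE; elim/ltn_ind: j => -[|[|j]] IH //.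
  by rewrite mul_mx_scalar -scalemxAl mulVmx // scalemx1.
have E (B : 'M[C]_n) : dickson_mx q B j.+2 =
  B *m dickson_mx q B j.+1 - q%:R *: dickson_mx q B j by [].
rewrite !E !IH // mulmxBr mulmxBl -scalemxAr -scalemxAl {1}AE !mulmxA.
by rewrite (mulmxK uP).
Qed.

Lemma dickson_mx_diag (C : fieldType) n q (v : 'rV[C]_n) j :
  dickson_mx q (diag_mx v) j = diag_mx (\row_i dickson q (v 0 i) j).
Proof.
elim/ltn_ind: j => -[|[|j]] IH.
- by apply/matrixP => i k; rewrite !mxE.
- by congr diag_mx; apply/rowP => i; rewrite mxE.
have -> : dickson_mx q (diag_mx v) j.+2 =
  diag_mx v *m dickson_mx q (diag_mx v) j.+1 - q%:R *: dickson_mx q (diag_mx v) j by [].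
rewrite !IH // mulmx_diag -linearZ -raddfB; congr diag_mx.
by apply/rowP => i; rewrite !mxE.
Qed.

Lemma map_dickson_mx (C : fieldType) (f : {rmorphism R -> C}) n q (A : 'M[R]_n) j :
  map_mx f (dickson_mx q A j) = dickson_mx q (map_mx f A) j.
Proof.
elim/ltn_ind: j => -[|[|j]] IH //; first by rewrite map_scalar_mx rmorph_nat.
have E (K : fieldType) (B : 'M[K]_n) : dickson_mx q B j.+2 =
  B *m dickson_mx q B j.+1 - q%:R *: dickson_mx q B j by [].
by rewrite !E map_mxB map_mxM map_mxZ !IH // rmorph_nat.
Qed.

Lemma map_dickson (C : fieldType) (f : {rmorphism R -> C}) q (x : R) j :
  f (dickson q x j) = dickson q (f x) j.
Proof.
elim/ltn_ind: j => -[|[|j]] IH //; first by rewrite rmorph_nat.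
have E (K : fieldType) (y : K) : dickson q y j.+2 =
  y * dickson q y j.+1 - q%:R * dickson q y j by [].
by rewrite !E rmorphB !rmorphM !IH // rmorph_nat.
Qed.

(** The spectral theorem is applied to A over the complex numbers, where A is hermitian, so its
    eigenvalues come back to R. One list has to serve both the characteristic polynomial and the
    traces. *)
Lemma symmetric_spectrum n (A : 'M[R]_n) : A^T = A ->
  exists l : n.-tuple R, char_poly A = \prod_(x <- l) ('X - x%:P) /\
    forall q j, \tr (dickson_mx q A j) = \sum_(x <- l) dickson q x j.
Proof.
move=> symA; pose f := real_complex R; pose B := map_mx f A.
have hB : B \is hermsymmx.
  apply: realsym_hermsym.
    by apply/is_hermitianmxP; rewrite expr0 scale1r map_mx_id // map_trmx symA.
  by apply/mxOverP => i k; rewrite mxE; apply/complex_realP; exists (A i k).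
have /orthomx_spectralP := hermitian_normalmx hB.
set P := spectralmx B; set D := spectral_diag B => BE.
have uP : P \in unitmx by apply: spectral_unit.
have /mxOverP Dreal := hermitian_spectral_diag_real hB.
pose l := [tuple complex.Re (D 0 i) | i < n].
have DE i : D 0 i = f (tnth l i) by rewrite tnth_mktuple /f /= RRe_real.
exists l; split.
  apply: (@map_poly_inj _ _ f); rewrite map_char_poly -/B.
  have -> : char_poly B = char_poly (diag_mx D).
    have PE : map_mx polyC (invmx P) *m map_mx polyC P = 1%:M.
      by rewrite -map_mxM mulVmx // map_mx1.
    rewrite /char_poly [in LHS]BE.
    have -> : char_poly_mx (invmx P *m diag_mx D *m P) =
       map_mx polyC (invmx P) *m char_poly_mx (diag_mx D) *m map_mx polyC P.
      rewrite /char_poly_mx mulmxBr mulmxBl !map_mxM; congr (_ - _).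
      by rewrite mul_mx_scalar -scalemxAl PE scalemx1.
    by rewrite !det_mulmx mulrAC -det_mulmx PE det1 mul1r.
  rewrite char_poly_trig ?diag_mx_is_trig // rmorph_prod big_tuple; apply: eq_bigr => i _.
  by rewrite mxE eqxx mulr1n DE rmorphB /= map_polyX map_polyC.
move=> q j; apply: (fmorph_inj f).
rewrite -trace_map_mx map_dickson_mx -/B (dickson_mx_conj q j uP BE).
rewrite mxtrace_mulC mulmxA mulmxV // mul1mx dickson_mx_diag mxtrace_diag.
rewrite rmorph_sum big_tuple; apply: eq_bigr => i _.
by rewrite mxE DE map_dickson.
Qed.

Lemma regular_eigenvalue_le n (A : 'M[R]_n) (d x : R) :
  (forall i j, 0 <= A i j) -> (forall j, \sum_i A i j = d) ->
  root (char_poly A) x -> `|x| <= d.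
Proof.
move=> A0 Ad; rewrite -eigenvalue_root_char => /eigenvalueP[v vA v0].
have [i0 vi0] : exists i, v 0 i != 0.
  apply/existsP; apply: contraT; rewrite negb_exists => /forallP h.
  by case/eqP: v0; apply/rowP => i; rewrite mxE; apply/eqP; rewrite -[_ == _]negbK.
pose i := [arg max_(i > i0) `|v 0 i|]%O.
have im k : `|v 0 k| <= `|v 0 i| by rewrite /i; case: arg_maxP => // m _; apply.
have vi : 0 < `|v 0 i| by apply: lt_le_trans (im i0); rewrite normr_gt0.
rewrite -(ler_pM2r vi) -normrM.
have -> : x * v 0 i = \sum_k v 0 k * A k i.
  by have /rowP/(_ i) := vA; rewrite !mxE => <-.
apply: le_trans (ler_norm_sum _ _ _) _; rewrite -(Ad i) mulr_suml.
by apply: ler_sum => k _; rewrite normrM (ger0_norm (A0 k i)) mulrC ler_wpM2l.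
Qed.

Lemma regular_eigenvalue n (A : 'M[R]_n) (d : R) : (0 < n)%N ->
  (forall j, \sum_i A i j = d) -> root (char_poly A) d.
Proof.
move=> n0 Ad; rewrite -eigenvalue_root_char; apply/eigenvalueP.
exists (const_mx 1).
  apply/rowP => j; rewrite !mxE mulr1 -(Ad j).
  by apply: eq_bigr => i _; rewrite mxE mul1r.
apply/eqP => /rowP/(_ (Ordinal n0)); rewrite !mxE => /eqP; by rewrite oner_eq0.
Qed.

End Spectrum.

Section Eigenvalues.
Variable R : realType.

Lemma perm_eigenvalues n (A : 'M[R]_n) (l : seq R) :
  char_poly A = \prod_(x <- l) ('X - x%:P) -> perm_eq (eigenvalues A) l.
Proof.
move=> cE; rewrite /eigenvalues perm_sort.
have c0 : char_poly A != 0 by rewrite -size_poly_gt0 size_char_poly.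
apply/allP => y _ /=.
rewrite count_flatten -map_comp sumnE big_map.
have [yr|yr] := boolP (y \in rootsR (char_poly A)); last first.
  rewrite big_seq big1 => [|x xr]; last first.
    by rewrite /= count_nseq /=; case: eqP => [xy|//]; rewrite -xy xr in yr.
  have : ~~ root (char_poly A) y by rewrite -(roots_on_rootsR c0) in yr *; exact: yr.
  by rewrite cE root_prod_XsubC => /count_memPn->.
rewrite (bigD1_seq y) //= ?uniq_roots // count_nseq /= eqxx mul1n big1 ?addn0.
  by rewrite cE mu_prod_XsubC.
by move=> x xy; rewrite count_nseq /= (negPf xy).
Qed.

(** The list of eigenvalues starts with d. Once this copy is removed, theta <= mu still leaves an
    eigenvalue y with |y| >= theta, and the other terms are nonnegative. *)
Lemma le_test_of_mu n (A : 'M[R]_n) (d theta c : R) (f : R -> R) :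
  (1 < n)%N -> A^T = A -> (forall i j, 0 <= A i j) -> (forall j, \sum_i A i j = d) ->
  (forall x, `|x| <= d -> 0 <= f x) -> (forall x, theta <= `|x| <= d -> c <= f x) ->
  theta <= mu A -> c <= \sum_(x <- eigenvalues A) f x - f d.
Proof.
move=> n1 symA A0 Ad f0 fc.
have [l [lE _]] := symmetric_spectrum symA.
have pl := perm_eigenvalues lE.
have sz : size (eigenvalues A) = n by rewrite (perm_size pl) size_tuple.
have rt x : x \in eigenvalues A -> `|x| <= d.
  by rewrite (perm_mem pl) => xl; apply: (regular_eigenvalue_le A0 Ad); rewrite lE root_prod_XsubC.
have dl : d \in eigenvalues A.
  by rewrite (perm_mem pl) -root_prod_XsubC -lE; apply: regular_eigenvalue => //; apply: ltnW.
have so : sorted >=%R (eigenvalues A) by apply: sort_sorted => x y; apply: le_total.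
case E : (eigenvalues A) sz rt dl so => [|x0 s] //= [sz] rt dl so.
have x0d : x0 = d.
  apply/eqP; rewrite eq_le; have := rt x0 (mem_head _ _) => /ler_normlP[_ ->] /=.
  move: dl; rewrite inE => /orP[/eqP->//|ds].
  by have /allP/(_ d ds) := order_path_min ge_trans so.
rewrite big_cons x0d addrC addrA addNr add0r /mu E /= => hmu.
have [y ys hy] : exists2 y, y \in s & theta <= `|y|.
  move: hmu; rewrite le_max => /orP[h|h].
    exists (nth 0 s 0); first by rewrite mem_nth // -ltnS sz.
    exact: le_trans h (ler_norm _).
  (* As n > 1, the last eigenvalue occupies another position than the removed first one. *)
  exists (last x0 s).
    by case: (s) sz => [/= e|a s' _]; [lia|rewrite /= mem_last].
  by apply: le_trans h _; rewrite -normrN ler_norm.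
have fs x : x \in s -> 0 <= f x by move=> xs; apply/f0/rt; rewrite inE xs orbT.
rewrite (big_rem y) //=; apply: le_trans (fc y _) _.
  by rewrite hy rt // inE ys orbT.
by rewrite lerDl big_seq sumr_ge0 // => x /mem_rem; apply: fs.
Qed.

End Eigenvalues.

(** * Expected numbers of fixed tuples *)

Section PermExtend.
Local Open Scope nat_scope.

(** High transitivity of the symmetric group gives one extension s0 of the partial injection E. The
    others are the t * s0 with t fixing the domain of E pointwise. *)
Lemma card_perm_extend (T : finType) (E : {set T * T}) :
  {in E &, injective fst} -> {in E &, injective snd} ->
  #|[set s : {perm T} | [forall p in E, s p.1 == p.2]]%SET| = (#|T| - #|E|)`!.
Proof.
move=> fI sI.
have szE : #|E| <= #|T|.
  by rewrite -(card_in_imset fI) max_card.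
have u1 : uniq (map fst (enum E)).
  by rewrite map_inj_in_uniq ?enum_uniq // => x y; rewrite !mem_enum; apply: fI.
have u2 : uniq (map snd (enum E)).
  by rewrite map_inj_in_uniq ?enum_uniq // => x y; rewrite !mem_enum; apply: sI.
have sz1 : size (map fst (enum E)) == #|E| by rewrite size_map -cardE.
have sz2 : size (map snd (enum E)) == #|E| by rewrite size_map -cardE.
have tr := ntransitive_weak szE (Sym_trans T).
have d1 : Tuple sz1 \in #|E|.-dtuple([set: T]).
  by rewrite inE u1; apply/fintype.subsetP => x _; rewrite inE.
have d2 : Tuple sz2 \in #|E|.-dtuple([set: T]).
  by rewrite inE u2; apply/fintype.subsetP => x _; rewrite inE.
have [s0 _ /(congr1 val) /= s0E] := atransP2 tr d1 d2.
have s0P p : p \in E -> s0 p.1 = p.2.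
  move=> pE; move: s0E; rewrite -map_comp => /eq_in_map/(_ p).
  by rewrite mem_enum => /(_ pE)/=.
have -> : [set s : {perm T} | [forall p in E, s p.1 == p.2]]%SET =
  [set (t * s0)%g | t in [set t | perm_on (~: (fst @: E)) t]]%SET.
  apply/setP => s; rewrite !inE; apply/forall_inP/imsetP => [sP|[t]].
    exists (s * s0^-1)%g; last by rewrite mulgKV.
    rewrite inE; apply/fintype.subsetP => x; rewrite !inE; apply: contra => /imsetP[p pE ->].
    by rewrite permM (eqP (sP p pE)) -(s0P p pE) permK.
  rewrite inE => tP -> p pE; rewrite permM (out_perm tP) ?s0P //.
  by rewrite !inE negbK imset_f.
rewrite card_imset; last exact: mulIg.
rewrite (_ : #|_| = #|perm_on (~: (fst @: E))|); last by apply: eq_card => t; rewrite inE.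
by rewrite card_perm cardsCs setCK (card_in_imset fI).
Qed.

End PermExtend.

(* A labelled graph whose vertices V are to be mapped to 'I_N; W is the set of
   darts (oriented edges), rev reverses a dart, and (k, true), (k, false) stand for
   the k-th permutation and its inverse. *)
Section GraphCount.
Local Open Scope nat_scope.
Variables (V W : finType) (src tgt : W -> V) (r : nat) (lab : W -> 'I_r * bool) (rev : W -> W).
Variable B : {set V}.

Let flip (c : 'I_r * bool) := (c.1, ~~ c.2).
Hypothesis src_rev : forall d, src (rev d) = tgt d.
Hypothesis tgt_rev : forall d, tgt (rev d) = src d.
Hypothesis lab_rev : forall d, lab (rev d) = flip (lab d).

Definition letter_perm N (g : {ffun 'I_r -> 'S_N}) (c : 'I_r * bool) : 'S_N :=
  if c.2 then g c.1 else (g c.1)^-1%g.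

Definition compat N (g : {ffun 'I_r -> 'S_N}) (phi : {ffun V -> 'I_N}) :=
  [forall d, letter_perm g (lab d) (phi (src d)) == phi (tgt d)].

(** Only positively labelled darts are taken, so that a dart and its reverse count as one edge of
    the quotient. *)
Definition edges (T : finType) (phi : {ffun V -> T}) (k : 'I_r) : {set T * T} :=
  [set (phi (src d), phi (tgt d)) | d in [set d | lab d == (k, true)]]%SET.

(** Folded in the sense of Stallings. As [edges_fst_inj] and [edges_snd_inj] show, each label then
    acts on the quotient as a partial injection, and so extends to a permutation. *)
Definition folded (T : finType) (phi : {ffun V -> T}) :=
  [forall d, forall d', (lab d == lab d') && (phi (src d) == phi (src d')) ==>
     (phi (tgt d) == phi (tgt d'))].

Lemma foldedP (T : finType) (phi : {ffun V -> T}) :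
  reflect (forall d d', lab d = lab d' -> phi (src d) = phi (src d') -> phi (tgt d) = phi (tgt d'))
    (folded phi).
Proof.
apply: (iffP forallP) => [H d d' e1 e2|H d]; last first.
  by apply/forallP => d'; apply/implyP => /andP[/eqP e1 /eqP e2]; apply/eqP/H.
by have /forallP/(_ d')/implyP := H d; rewrite e1 e2 !eqxx => /(_ isT)/eqP.
Qed.

Lemma edges_fst_inj (T : finType) (phi : {ffun V -> T}) k :
  folded phi -> {in edges phi k &, injective fst}.
Proof.
move=> /foldedP H p p' /imsetP[d]; rewrite inE => /eqP ld -> /imsetP[d'].
by rewrite inE => /eqP ld' -> /= e; rewrite e (H d d') // ld ld'.
Qed.

Lemma edges_snd_inj (T : finType) (phi : {ffun V -> T}) k :
  folded phi -> {in edges phi k &, injective snd}.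
Proof.
move=> /foldedP H p p' /imsetP[d]; rewrite inE => /eqP ld -> /imsetP[d'].
rewrite inE => /eqP ld' -> /= e; rewrite e; congr (_, _).
by rewrite -!tgt_rev; apply: H; rewrite ?lab_rev ?ld ?ld' // !src_rev.
Qed.

Lemma compat_edges N (g : {ffun 'I_r -> 'S_N}) (phi : {ffun V -> 'I_N}) :
  compat g phi = [forall k, forall p in edges phi k, g k p.1 == p.2].
Proof.
apply/forallP/forallP => [H k|H d].
  apply/forall_inP => p /imsetP[d]; rewrite inE => /eqP ld -> /=.
  by have := H d; rewrite /letter_perm ld.
have pos d' : (lab d').2 -> g (lab d').1 (phi (src d')) = phi (tgt d').
  move=> ld; have /forall_inP/(_ (phi (src d'), phi (tgt d'))) := H (lab d').1.
  by move=> /(_ _)/eqP -> //; apply: imset_f; rewrite inE [lab d']surjective_pairing ld.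
rewrite /letter_perm; case: ifP => ld; first by apply/eqP/pos.
apply/eqP/(perm_inj (s := g (lab d).1)); rewrite permKV.
by have := pos (rev d); rewrite lab_rev /= ld src_rev tgt_rev => ->.
Qed.

Lemma compat_folded N (g : {ffun 'I_r -> 'S_N}) (phi : {ffun V -> 'I_N}) :
  compat g phi -> folded phi.
Proof.
move=> /forallP H; apply/foldedP => d d' e1 e2.
by rewrite -(eqP (H d)) -(eqP (H d')) e1 e2.
Qed.

Lemma card_compat N (phi : {ffun V -> 'I_N}) :
  #|[set g | compat g phi]%SET| =
  if folded phi then \prod_k (N - #|edges phi k|)`! else 0%N.
Proof.
case: ifP => [fphi|nf]; last first.
  apply/eqP; rewrite cards_eq0; apply/eqP/setP => g; rewrite !inE.
  by apply/negP => /compat_folded; rewrite nf.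
have -> : [set g | compat g phi]%SET =
  [set g : {ffun 'I_r -> 'S_N} | g \in family (fun k => [set s : 'S_N | [forall p in edges phi k, s p.1 == p.2]]%SET)]%SET.
  apply/setP => g; rewrite !inE compat_edges; apply/forallP/familyP => H k.
    by rewrite inE H.
  by have := H k; rewrite inE.
rewrite cardsE card_family foldrE big_map big_enum /=; apply: eq_bigr => k _.
rewrite card_perm_extend ?card_ord //; [exact: edges_fst_inj|exact: edges_snd_inj].
Qed.

(* The partition of V into fibers of phi, encoded by a choice of representatives
   that depends only on the partition. *)
Definition kernel_rep (T : finType) (phi : {ffun V -> T}) : {ffun V -> V} :=
  [ffun v => odflt v [pick u | phi u == phi v]].

Lemma kernel_repK (T : finType) (phi : {ffun V -> T}) v : phi (kernel_rep phi v) = phi v.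
Proof. by rewrite ffunE; case: pickP => //= u /eqP. Qed.

Lemma kernel_rep_eq (T : finType) (phi : {ffun V -> T}) u v :
  (kernel_rep phi u == kernel_rep phi v) = (phi u == phi v).
Proof.
apply/eqP/eqP => [e|e].
  by rewrite -(kernel_repK phi u) e kernel_repK.
rewrite !ffunE e; case: pickP => //= H; by have := H v; rewrite eqxx.
Qed.

Lemma eq_kernel_rep (T T' : finType) (phi : {ffun V -> T}) (psi : {ffun V -> T'}) :
  (forall u v, (phi u == phi v) = (psi u == psi v)) -> kernel_rep phi = kernel_rep psi.
Proof.
move=> H; apply/ffunP => v; rewrite !ffunE.
rewrite (eq_pick (P := fun u => phi u == phi v) (Q := fun u => psi u == psi v)) //.
Qed.

Lemma kernel_rep_idem (T : finType) (phi : {ffun V -> T}) :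
  kernel_rep (kernel_rep phi) = kernel_rep phi.
Proof. by apply: eq_kernel_rep => u v; rewrite kernel_rep_eq. Qed.

Definition nverts (kappa : {ffun V -> V}) := #|[set v | kappa v == v]%SET|.

Lemma card_kernel_rep (T : finType) (kappa : {ffun V -> V}) : kernel_rep kappa = kappa ->
  #|[set phi : {ffun V -> T} | kernel_rep phi == kappa]%SET| = (#|T| ^_ nverts kappa)%N.
Proof.
move=> kK.
have kk v : kappa (kappa v) = kappa v by rewrite -{2}kK kernel_repK.
pose D : finType := {v : V | kappa v == v}.
have cD : #|D| = nverts kappa by rewrite card_sig /nverts cardsE.
rewrite -cD -card_inj_ffuns.
have kkb v : kappa (kappa v) == kappa v by rewrite kk.
pose h (psi : {ffun D -> T}) : {ffun V -> T} := [ffun v => psi (exist (fun u => kappa u == u) (kappa v) (kkb v))].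
have hv psi (x : D) : h psi (val x) = psi x.
  by rewrite ffunE; congr (psi _); apply: val_inj; rewrite /= (eqP (valP x)).
rewrite -(card_imset _ (f := h)); last first.
  by move=> psi psi' e; apply/ffunP => x; rewrite -!hv e.
apply: eq_card => phi; rewrite !inE; apply/eqP/imsetP => [e|[psi]].
  exists [ffun x : D => phi (val x)].
    rewrite inE; apply/injectiveP => x y; rewrite !ffunE => /eqP.
    by rewrite -kernel_rep_eq e (eqP (valP x)) (eqP (valP y)) => /eqP/val_inj.
  by apply/ffunP => v; rewrite !ffunE /= -e kernel_repK.
rewrite inE => /injectiveP psiI ->; rewrite -[RHS]kK; apply: eq_kernel_rep => u v.
rewrite !ffunE; apply/eqP/eqP => [/psiI/(congr1 val)//|e].
by congr (psi _); apply: val_inj.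
Qed.

Lemma card_edges_kernel_rep (T : finType) (phi : {ffun V -> T}) k :
  #|edges (kernel_rep phi) k| = #|edges phi k|.
Proof.
have -> : edges phi k = [set (phi p.1, phi p.2) | p in edges (kernel_rep phi) k]%SET.
  apply/setP => p; apply/imsetP/imsetP => [[d dk ->]|[x /imsetP[d dk ->] ->]].
    exists (kernel_rep phi (src d), kernel_rep phi (tgt d)); first exact: imset_f.
    by rewrite /= !kernel_repK.
  by exists d => //=; rewrite !kernel_repK.
rewrite [RHS]card_in_imset // => _ _ /imsetP[d _ ->] /imsetP[d' _ ->] /= [].
rewrite !kernel_repK => /eqP e1 /eqP e2; congr (_, _); apply/eqP.
  by rewrite kernel_rep_eq.
by rewrite kernel_rep_eq.
Qed.

Lemma folded_kernel_rep (T : finType) (phi : {ffun V -> T}) :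
  folded (kernel_rep phi) = folded phi.
Proof.
apply: eq_forallb => d; apply: eq_forallb => d'.
by rewrite !kernel_rep_eq.
Qed.

(** The base vertices will carry the entries of an s-tuple, which have to be distinct. *)
Definition inj_on_base (T : finType) (phi : {ffun V -> T}) :=
  [forall u in B, forall v in B, (phi u == phi v) ==> (u == v)].

Lemma inj_on_base_kernel_rep (T : finType) (phi : {ffun V -> T}) :
  inj_on_base (kernel_rep phi) = inj_on_base phi.
Proof.
apply: eq_forallb => u; congr (_ ==> _); apply: eq_forallb => v; congr (_ ==> _).
by rewrite kernel_rep_eq.
Qed.

Definition good_kernel (kappa : {ffun V -> V}) :=
  [&& kernel_rep kappa == kappa, inj_on_base kappa & folded kappa].

(** Double counting: for fixed phi the number of compatible g depends only on the kernel of phi, so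
    the maps are grouped by kernel. *)
Lemma card_compat_pairs N :
  (\sum_(g : {ffun 'I_r -> 'S_N}) #|[set phi | inj_on_base phi && compat g phi]%SET| =
  \sum_(kappa | good_kernel kappa) N ^_ (nverts kappa) * \prod_k (N - #|edges kappa k|)`!)%N.
Proof.
transitivity (\sum_(phi : {ffun V -> 'I_N} | inj_on_base phi) #|[set g | compat g phi]%SET|)%N.
  under eq_bigr do rewrite -sum1dep_card big_mkcondr.
  rewrite exchange_big; apply: eq_bigr => phi _.
  by rewrite -sum1dep_card -big_mkcond.
rewrite (eq_bigr (fun phi => if folded phi then \prod_k (N - #|edges phi k|)`! else 0)); last first.
  by move=> phi _; exact: card_compat.
rewrite -big_mkcondr /=.
rewrite (partition_big (@kernel_rep _) good_kernel) /=; last first.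
  by move=> phi /andP[b f]; rewrite /good_kernel kernel_rep_idem eqxx inj_on_base_kernel_rep folded_kernel_rep b.
apply: eq_bigr => kappa /and3P[/eqP kK bk fk].
rewrite (eq_bigr (fun=> \prod_k (N - #|edges kappa k|)`!))%N; last first.
  move=> phi /andP[_ /eqP <-]; by apply: eq_bigr => k _; rewrite card_edges_kernel_rep.
rewrite sum_nat_const; congr (_ * _)%N; rewrite -[in RHS](card_ord N) -card_kernel_rep //.
apply: eq_card => phi; rewrite inE unfold_in; apply/andP/idP => [[]//|e]; split=> //.
by rewrite -inj_on_base_kernel_rep -folded_kernel_rep (eqP e) bk.
Qed.

End GraphCount.

(** * Expected counts as polynomials in 1/N *)

Section ExpectationPolynomial.
Variable R : numFieldType.

Definition falling_poly (a b : nat) : {poly R} := \prod_(a <= i < b) (1 - i%:R *: 'X).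

Lemma horner_falling a b x : (falling_poly a b).[x] = \prod_(a <= i < b) (1 - i%:R * x).
Proof.
by rewrite /falling_poly horner_prod; apply: eq_bigr => i _; rewrite !hornerE.
Qed.

Lemma falling_poly_cat a b c : (a <= b <= c)%N ->
  falling_poly a c = falling_poly a b * falling_poly b c.
Proof. by case/andP=> ab bc; rewrite /falling_poly (big_cat_nat ab bc). Qed.

Lemma falling_poly0 a b : (falling_poly a b).[0] = 1.
Proof. by rewrite horner_falling big1 // => i _; rewrite mulr0 subr0. Qed.

Lemma size_falling_poly a b : (size (falling_poly a b) <= (b - a).+1)%N.
Proof.
rewrite /falling_poly; elim: b => [|b IHb]; first by rewrite big_geq // size_poly1.
have [ab|ba] := leqP a b; last by rewrite big_geq // size_poly1.
rewrite big_nat_recr //= subSn //; apply: leq_trans (size_polyMleq _ _) _.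
have h : (size (1%R - b%:R *: 'X : {poly R})%R <= 2)%N.
  apply: leq_trans (size_polyD _ _) _; rewrite geq_max size_poly1 size_polyN /=.
  by apply: leq_trans (size_scale_leq _ _) _; rewrite size_polyX.
by rewrite -subn1 leq_subLR (leq_trans (leq_add IHb h)) // addn2 add1n.
Qed.

Lemma ffact_falling (N n : nat) : (0 < N)%N ->
  (N ^_ n)%:R = N%:R ^+ n * (falling_poly 0 n).[N%:R^-1] :> R.
Proof.
move=> N0; rewrite horner_falling; elim: n => [|n IHn].
  by rewrite ffactn0 big_geq // mulr1.
rewrite ffactnSr natrM IHn big_nat_recr //= exprSr.
have N0' : N%:R != 0 :> R by rewrite pnatr_eq0 -lt0n.
have [nN|Nn] := leqP n N; first by rewrite natrB //; field.
have -> : (N - n = 0)%N by lia.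
rewrite mulr0 (big_cat_nat (n := N)) //=; last by lia.
have -> : \prod_(N <= i < n) (1 - i%:R / N%:R) = 0 :> R.
  by rewrite big_ltn // divff // subrr mul0r.
by rewrite mulr0 mul0r mulr0.
Qed.

Lemma falling_gt0 (N M : nat) : (M <= N)%N -> (0 < N)%N -> 0 < (falling_poly 0 M).[N%:R^-1] :> R.
Proof.
move=> MN N0; rewrite horner_falling big_nat prodr_gt0 // => i /= iM.
by rewrite subr_gt0 ltr_pdivrMr ?ltr0n // mul1r ltr_nat; lia.
Qed.

(** One factor, depending on M alone, clears the denominator of (N - e)! / N! for all e <= M at
    once; this allows different patterns and words to be added as polynomials. *)
Lemma fact_ratio_falling (N M e : nat) : (e <= M <= N)%N -> (0 < N)%N ->
  (N - e)`!%:R / N`!%:R * (falling_poly 0 M).[N%:R^-1] =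
  N%:R^-1 ^+ e * (falling_poly e M).[N%:R^-1] :> R.
Proof.
case/andP=> eM MN N0.
rewrite (falling_poly_cat (b := e)) // hornerM.
have eN := leq_trans eM MN.
rewrite -(ffact_fact eN) natrM ffact_falling //.
have := falling_gt0 eN N0; have f0 : (N - e)`!%:R != 0 :> R by rewrite pnatr_eq0 -lt0n fact_gt0.
have N0' : N%:R ^+ e != 0 :> R by rewrite expf_neq0 // pnatr_eq0 -lt0n.
rewrite exprVn; move: (_.[_]) (_.[_]) => x y /lt0r_neq0 x0.
by field; rewrite f0 N0' x0.
Qed.

Section Graph.
Variables (V W : finType) (src tgt : W -> V) (r : nat) (lab : W -> 'I_r * bool) (rev : W -> W).
Variable B : {set V}.
Hypothesis src_rev : forall d, src (rev d) = tgt d.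
Hypothesis tgt_rev : forall d, tgt (rev d) = src d.
Hypothesis lab_rev : forall d, lab (rev d) = ((lab d).1, ~~ (lab d).2).

Local Notation edges := (edges src tgt lab).
Local Notation good := (good_kernel src tgt lab B).

Lemma edges_fstE (kappa : {ffun V -> V}) k :
  [set p.1 | p in edges kappa k]%SET =
  [set x | [exists d, (lab d == (k, true)) && (kappa (src d) == x)]]%SET.
Proof.
apply/setP => x; rewrite !inE; apply/imsetP/existsP => [[p /imsetP[d]]|[d /andP[ld /eqP <-]]].
  by rewrite inE => ld -> ->; exists d; rewrite ld /=.
by exists (kappa (src d), kappa (tgt d)) => //; apply: imset_f; rewrite inE.
Qed.

Lemma edges_sndE (kappa : {ffun V -> V}) k :
  [set p.2 | p in edges kappa k]%SET =
  [set x | [exists d, (lab d == (k, false)) && (kappa (src d) == x)]]%SET.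
Proof.
apply/setP => x; rewrite !inE; apply/imsetP/existsP => [[p /imsetP[d]]|[d /andP[/eqP ld /eqP <-]]].
  by rewrite inE => /eqP ld -> ->; exists (rev d); rewrite lab_rev ld src_rev !eqxx.
exists (kappa (tgt d), kappa (src d)) => //; apply/imsetP; exists (rev d).
  by rewrite inE lab_rev ld.
by rewrite src_rev tgt_rev.
Qed.

Lemma card_edges_le (kappa : {ffun V -> V}) k :
  folded src tgt lab kappa -> (#|edges kappa k| <= #|V|)%N.
Proof. by move=> f; rewrite -(card_in_imset (edges_fst_inj (k := k) f)) max_card. Qed.

Definition darts_at (kappa : {ffun V -> V}) x :=
  [set c | [exists d, (lab d == c) && (kappa (src d) == x)]]%SET.

(** The handshake lemma for the quotient graph; folding ensures that an edge is determined by its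
    label and either end. *)
Lemma sum_card_darts (kappa : {ffun V -> V}) : folded src tgt lab kappa ->
  (\sum_x #|darts_at kappa x| = 2 * \sum_k #|edges kappa k|)%N.
Proof.
move=> f; under eq_bigr do rewrite -sum1dep_card big_mkcond /=.
rewrite exchange_big /= -(pair_bigA _ (fun k b => \sum_x
  (if [exists d, (lab d == (k, b)) && (kappa (src d) == x)] then 1 else 0)%N)) /=.
rewrite big_distrr; apply: eq_bigr => k _; rewrite big_bool /= -!big_mkcond /= !sum1dep_card.
rewrite -edges_fstE -edges_sndE.
have -> := card_in_imset (edges_fst_inj (k := k) f).
have -> := card_in_imset (edges_snd_inj src_rev tgt_rev lab_rev (k := k) f).
by rewrite mul2n addnn.
Qed.

Variables (d1 d2 : V -> W).
Hypothesis src_d1 : forall v, src (d1 v) = v.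
Hypothesis src_d2 : forall v, src (d2 v) = v.
Hypothesis lab_d12 : forall v, lab (d1 v) != lab (d2 v).

Lemma darts_at_sub (kappa : {ffun V -> V}) u :
  [set lab (d1 u); lab (d2 u)] \subset darts_at kappa (kappa u).
Proof.
apply/fintype.subsetP => c; rewrite !inE => /orP[]/eqP->; apply/existsP.
  by exists (d1 u); rewrite src_d1 !eqxx.
by exists (d2 u); rewrite src_d2 !eqxx.
Qed.

Lemma good_kernel_fix (kappa : {ffun V -> V}) v : good kappa -> kappa (kappa v) = kappa v.
Proof. by case/and3P=> /eqP kK _ _; rewrite -{2}kK kernel_repK. Qed.

(** The two darts [d1 u] and [d2 u] have different labels, so they remain distinct in the quotient
    and all degrees are at least 2. The handshake lemma gives 2 v <= 2 e, and equality leaves no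
    other dart at any vertex. *)
Lemma nverts_le_edges (kappa : {ffun V -> V}) : good kappa ->
  (nverts kappa <= \sum_k #|edges kappa k|)%N /\
  (nverts kappa = \sum_k #|edges kappa k| ->
   forall u, darts_at kappa (kappa u) = [set lab (d1 u); lab (d2 u)]%SET)%N.
Proof.
move=> g; have /and3P[_ _ f] := g.
have c2 u : #|[set lab (d1 u); lab (d2 u)]%SET| = 2%N by rewrite cards2 lab_d12.
have le2 u : (2 <= #|darts_at kappa (kappa u)|)%N.
  by rewrite -(c2 u) subset_leq_card // darts_at_sub.
have s2 : (2 * nverts kappa <= \sum_(x | kappa x == x) #|darts_at kappa x|)%N.
  rewrite mulnC /nverts -sum1dep_card big_distrl /=; apply: leq_sum => x /eqP xx.
  by rewrite mul1n -xx.
have sE := sum_card_darts f.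
have sle : (\sum_(x | kappa x == x) #|darts_at kappa x| <= \sum_x #|darts_at kappa x|)%N.
  by rewrite [leqRHS](bigID (fun x => kappa x == x)) /= leq_addr.
split; first by rewrite -(leq_pmul2l (isT : 0 < 2)%N) -sE (leq_trans s2).
move=> e u; apply/esym/eqP; rewrite eqEcard darts_at_sub c2.
have ux : kappa (kappa u) == kappa u by apply/eqP/good_kernel_fix.
have {}s2 : (2 * nverts kappa = \sum_(x | kappa x == x) #|darts_at kappa x|)%N.
  by apply/eqP; rewrite eqn_leq s2 e -sE sle.
move: s2; rewrite /nverts -sum1dep_card (bigD1 (kappa u)) //= [in RHS](bigD1 (kappa u)) //=.
have : (2 * \sum_(x | (kappa x == x) && (x != kappa u)) 1 <=
   \sum_(x | (kappa x == x) && (x != kappa u)) #|darts_at kappa x|)%N.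
  rewrite big_distrr /=; apply: leq_sum => x /andP[/eqP xx _]; by rewrite -xx.
rewrite mulnDr muln1 => h1 h2.
by rewrite -(leq_add2r (\sum_(x | (kappa x == x) && (x != kappa u)) #|darts_at kappa x|)) -h2 leq_add2l.
Qed.

(* In the variable 1/N; see expect_polyE. *)
Definition expect_poly (M : nat) : {poly R} := \sum_(kappa | good kappa)
  'X^(\sum_k #|edges kappa k| - nverts kappa) * falling_poly 0 (nverts kappa)
    * \prod_k falling_poly #|edges kappa k| M.

Lemma expect_polyE (N M : nat) : (#|V| <= M <= N)%N -> (0 < N)%N ->
  (\sum_(g : {ffun 'I_r -> 'S_N})
     #|[set phi | inj_on_base B phi && compat src tgt lab g phi]%SET|)%:R / N`!%:R ^+ r
    * (falling_poly 0 M).[N%:R^-1] ^+ r = (expect_poly M).[N%:R^-1].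
Proof.
case/andP=> VM MN N0; rewrite (card_compat_pairs B src_rev tgt_rev lab_rev).
rewrite natr_sum !mulr_suml horner_sum; apply: eq_bigr => kappa g.
have [vE _] := nverts_le_edges g.
have /and3P[_ _ f] := g.
have N0' : N%:R != 0 :> R by rewrite pnatr_eq0 -lt0n.
rewrite natrM natr_prod !hornerM hornerXn [X in _ = _ * X]horner_prod ffact_falling //.
have -> : N`!%:R ^+ r = \prod_(k < r) N`!%:R :> R by rewrite prodr_const card_ord.
have -> : (falling_poly 0 M).[N%:R^-1] ^+ r = \prod_(k < r) (falling_poly 0 M).[N%:R^-1] :> R.
  by rewrite prodr_const card_ord.
rewrite -[_ * _ * _ / _]mulrA -prodf_div -mulrA -big_split /=.
rewrite (eq_bigr (fun k => N%:R^-1 ^+ #|edges kappa k| * (falling_poly #|edges kappa k| M).[N%:R^-1])); last first.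
  by move=> k _; rewrite fact_ratio_falling // MN (leq_trans (card_edges_le k f)).
rewrite big_split /= prodrXr.
set Q := \prod_k _; set F := (_.[_]).
have -> : N%:R^-1 ^+ (\sum_k #|edges kappa k|) =
  N%:R^-1 ^+ (\sum_k #|edges kappa k| - nverts kappa) * N%:R^-1 ^+ nverts kappa :> R.
  by rewrite -exprD subnK.
rewrite [N%:R^-1 ^+ nverts _]exprVn.
have : N%:R ^+ nverts kappa != 0 :> R by rewrite expf_neq0.
by move: (N%:R ^+ nverts kappa) (N%:R^-1 ^+ _) => y z y0; field.
Qed.

Lemma size_expect_poly M : (#|V| <= M)%N -> (size (expect_poly M) <= (r * M).+1)%N.
Proof.
move=> VM; apply: leq_trans (size_sum _ _ _) _; apply/bigmax_leqP => kappa g.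
have [vE _] := nverts_le_edges g; have /and3P[_ _ f] := g.
have eM k : (#|edges kappa k| <= M)%N by apply: leq_trans (card_edges_le k f) VM.
apply: leq_trans (size_polyMleq _ _) _.
have h1 : (size ('X^(\sum_k #|edges kappa k| - nverts kappa)%N * falling_poly 0 (nverts kappa))%R
   <= (\sum_k #|edges kappa k|).+1)%N.
  apply: leq_trans (size_polyMleq _ _) _; rewrite size_polyXn.
  have := size_falling_poly 0 (nverts kappa); lia.
have h2 : (size (\prod_k falling_poly #|edges kappa k| M)%R <= (\sum_k (M - #|edges kappa k|)).+1)%N.
  elim/big_ind2: _ => [|m1 p1 m2 p2 I1 I2|k _]; first by rewrite size_poly1.
    by apply: leq_trans (size_polyMleq _ _) _; lia.
  exact: size_falling_poly.
have h3 : (\sum_k #|edges kappa k| + \sum_k (M - #|edges kappa k|) = r * M)%N.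
  rewrite -big_split /= (eq_bigr (fun=> M)) => [|k _]; last by rewrite subnKC.
  by rewrite sum_nat_const card_ord.
lia.
Qed.

Lemma expect_poly0 M : (expect_poly M).[0] =
  #|[set kappa | good kappa & nverts kappa == \sum_k #|edges kappa k|]%SET|%:R.
Proof.
rewrite -sum1dep_card big_mkcondr natr_sum horner_sum; apply: eq_bigr => kappa g.
have [vE _] := nverts_le_edges g.
rewrite !hornerM.
have -> : (\prod_k falling_poly #|edges kappa k| M).[0] = 1.
  by rewrite horner_prod big1 // => k _; apply: falling_poly0.
rewrite falling_poly0 !mulr1 hornerXn; case: eqVneq => [->|ne]; first by rewrite subnn expr0.
by rewrite expr0n subn_eq0 leqNgt ltn_neqAle ne vE.
Qed.

End Graph.
End ExpectationPolynomial.

(** * Patterns formed by s closed walks along a cyclic word *)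

Section CyclicWord.
Local Open Scope nat_scope.
Variables (r s j : nat).

Definition flip (c : 'I_r * bool) := (c.1, ~~ c.2).

Lemma flipK : involutive flip.
Proof. by case=> k b; rewrite /flip /= negbK. Qed.

Lemma flip_neq c : flip c != c.
Proof. by case: c => k b; rewrite /flip xpair_eqE eqxx /=; case: b. Qed.

Definition cyc (m : nat) : 'I_j.+1 := Ordinal (ltn_pmod m (ltn0Sn j)).

Lemma cyc_eq m n : m = n %[mod j.+1] -> cyc m = cyc n.
Proof. by move=> e; apply: val_inj. Qed.

Lemma cyc_mod (i : 'I_j.+1) m : i = m %[mod j.+1] -> cyc m = i.
Proof. by move=> e; apply: val_inj; rewrite /= -e modn_small. Qed.

Lemma cyc_id (i : 'I_j.+1) : cyc i = i.
Proof. exact: cyc_mod. Qed.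

Lemma cyc_cycD m n : cyc (cyc m + n) = cyc (m + n).
Proof. by apply: cyc_eq; rewrite /= modnDml. Qed.

Variable w : j.+1.-tuple ('I_r * bool).
Hypothesis cw : path.cycle (noncancel flip) w.

Lemma cycle_noncancel m : tnth w (cyc m.+1) != flip (tnth w (cyc m)).
Proof.
have c0 : 'I_r * bool by exact: thead w.
rewrite !(tnth_nth c0) /=.
rewrite -[m.+1]addn1 -modnDml; have := ltn_pmod m (ltn0Sn j).
move: (m %% _) => i ij; case: w cw => -[|c v] //= /eqP[sv] /(pathP c0)/(_ i).
rewrite size_rcons sv => /(_ ij); rewrite /noncancel nth_rcons sv addn1.
have [->|ij'] := eqVneq i j.
  by rewrite ltnn modnn -rcons_cons nth_rcons /= sv ltnSn.
have {}ij : i < j by rewrite ltn_neqAle ij' -ltnS.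
rewrite ij modn_small; last by rewrite ltnS.
by rewrite -rcons_cons nth_rcons /= sv ltnS ltnW.
Qed.

(** The point (a, i) is where the a-th closed walk stands just before reading the letter of index
    i. *)
Definition pos : finType := ('I_s * 'I_j.+1)%type.
Implicit Types (u v : pos) (kappa : {ffun pos -> pos}).

Definition shift m u : pos := (u.1, cyc (u.2 + m)).
Definition label u := tnth w u.2.
Definition dart_src (d : pos * bool) : pos := if d.2 then d.1 else shift 1 d.1.
Definition dart_tgt (d : pos * bool) : pos := if d.2 then shift 1 d.1 else d.1.
Definition dart_letter (d : pos * bool) := if d.2 then label d.1 else flip (label d.1).
Definition dart_rev (d : pos * bool) : pos * bool := (d.1, ~~ d.2).
Definition base : {set pos} := [set u | u.2 == ord0]%SET.

Lemma shiftD m n u : shift m (shift n u) = shift (n + m) u.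
Proof. by rewrite /shift /= cyc_cycD addnA. Qed.

Lemma shift_eq m n u : m = n %[mod j.+1] -> shift m u = shift n u.
Proof. by move=> e; congr (_, _); apply: cyc_eq; rewrite -modnDmr e modnDmr. Qed.

Lemma shift0 u : shift 0 u = u.
Proof. by case: u => a i; rewrite /shift addn0 cyc_id. Qed.

(** Modulo j + 1 the number j is -1. Throughout, multiplication by j encodes subtraction of indices
    in the naturals. *)
Lemma shiftK m : cancel (shift m) (shift (m * j)).
Proof.
move=> u; rewrite shiftD (_ : m + m * j = m * j.+1); last by rewrite mulnS.
by rewrite (@shift_eq _ 0) ?shift0 // modnMl.
Qed.

Lemma shift_inj m : injective (shift m).
Proof. exact: can_inj (shiftK m). Qed.

Lemma label_shift u : label (shift 1 u) != flip (label u).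
Proof. by have := cycle_noncancel u.2; rewrite cyc_id /label /= addn1. Qed.

Lemma dart_src_rev d : dart_src (dart_rev d) = dart_tgt d.
Proof. by case: d => u []. Qed.

Lemma dart_tgt_rev d : dart_tgt (dart_rev d) = dart_src d.
Proof. by case: d => u []. Qed.

Lemma dart_letter_rev d : dart_letter (dart_rev d) = flip (dart_letter d).
Proof. by case: d => u [] //=; rewrite /dart_letter /= flipK. Qed.

Definition out_dart u : pos * bool := (u, true).
(** The reversal of the dart arriving at u; it starts at u. *)
Definition in_dart u : pos * bool := (shift j u, false).

Lemma shift1j u : shift 1 (shift j u) = u.
Proof. by rewrite shiftD addn1 (@shift_eq _ 0) ?shift0 // modnn. Qed.

Lemma shiftj1 u : shift j (shift 1 u) = u.
Proof. by rewrite shiftD add1n (@shift_eq _ 0) ?shift0 // modnn. Qed.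

Lemma dart_src_out u : dart_src (out_dart u) = u. Proof. by []. Qed.

Lemma dart_src_in u : dart_src (in_dart u) = u.
Proof. by rewrite /dart_src /= shift1j. Qed.

(** Here cyclic reducedness, including the junction of the last and first letters, becomes the
    degree condition of [nverts_le_edges]. *)
Lemma dart_letter_out_in u : dart_letter (out_dart u) != dart_letter (in_dart u).
Proof. by rewrite /dart_letter /= -{1}(shift1j u) label_shift. Qed.

Local Notation edges := (edges dart_src dart_tgt dart_letter).
Local Notation good := (good_kernel dart_src dart_tgt dart_letter base).

(* The patterns of Euler characteristic 0, i.e. the disjoint unions of cycles. *)
Definition tight kappa := good kappa && (nverts kappa == \sum_k #|edges kappa k|).

Section Tight.
Variable kappa : {ffun pos -> pos}.
Hypothesis tk : tight kappa.

Lemma tight_folded d d' : dart_letter d = dart_letter d' ->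
  kappa (dart_src d) = kappa (dart_src d') -> kappa (dart_tgt d) = kappa (dart_tgt d').
Proof. by case/andP: tk => /and3P[_ _ /foldedP f] _; apply: f. Qed.

Lemma tight_darts u v : kappa u = kappa v ->
  [set dart_letter (out_dart u); dart_letter (in_dart u)]%SET =
  [set dart_letter (out_dart v); dart_letter (in_dart v)]%SET.
Proof.
case/andP: tk => g /eqP e uv.
have [_ H] := nverts_le_edges dart_src_rev dart_tgt_rev dart_letter_rev
  dart_src_out dart_src_in dart_letter_out_in g.
by rewrite -(H e u) -(H e v) uv.
Qed.

Lemma tight_same u v : kappa u = kappa v -> label u = label v ->
  kappa (shift 1 u) = kappa (shift 1 v).
Proof. by move=> uv l; apply: (@tight_folded (out_dart u) (out_dart v)). Qed.

(* Two passages through the same vertex in opposite directions would make the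
   cyclic word meet its own inverse, at a letter or between two letters. *)
Lemma tight_no_opposite m a b (i : 'I_j.+1) :
  kappa (a, i) = kappa (b, cyc (i + m)) -> label (a, i) = label (b, cyc (i + m)).
Proof.
elim/ltn_ind: m a b i => m IH a b i e; apply/eqP; apply: contraT => ne.
set u : pos := (a, i) in e ne.
have [v vE] : {v : pos | v = (b, cyc (i + m))} by eexists.
rewrite -vE in e ne.
have E := tight_darts e.
have : dart_letter (out_dart u) \in [set dart_letter (out_dart v); dart_letter (in_dart v)]%SET.
  by rewrite -E !inE eqxx.
rewrite !inE {1 2}/dart_letter /= (negPf ne) /= => /eqP ov.
have kS : kappa (shift 1 u) = kappa (shift j v).
  by apply: (@tight_folded (out_dart u) (in_dart v)); rewrite ?dart_src_in.
(* One step forward from u and one back from v shorten the gap by 2. Gap 0 compares a letter with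
   itself, gap 1 makes a letter its own inverse, and for a larger gap the induction hypothesis makes
   two adjacent letters cancel. *)
case: m IH vE => [|[|m]] IH vE.
- by move: ne; rewrite vE /label /= addn0 cyc_id eqxx.
- move: ov; rewrite /dart_letter /= => ov.
  have : label (shift j v) = label u.
    by rewrite vE /label /= cyc_cycD -addnA add1n -[in RHS](cyc_id i); congr tnth; apply: cyc_eq; rewrite modnDr.
  by move=> l; move: (flip_neq (label u)); rewrite {2}ov l eqxx.
have sv : shift j v = (b, cyc (cyc (i + 1) + m)).
  rewrite vE; congr (_, _); rewrite /= !cyc_cycD; apply: cyc_eq.
  by rewrite (_ : i + m.+2 + j = i + 1 + m + j.+1) ?modnDr //; lia.
have := IH m (ltnW (ltnSn _)) a b (cyc (i + 1)); rewrite -sv => /(_ kS) l {IH}.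
have su : shift 1 u = (a, cyc (i + 1)) by [].
have := label_shift u; rewrite su l.
by move: ov; rewrite /dart_letter /= => ->; rewrite flipK eqxx.
Qed.

Lemma tight_label u v : kappa u = kappa v -> label u = label v.
Proof.
case: u v => a i [b i'] e.
have ci : cyc (i + (i' + i * j)) = i'.
  by apply: cyc_mod; rewrite addnCA -mulnS -modnDmr modnMl addn0.
by have := @tight_no_opposite (i' + i * j) a b i; rewrite ci; apply.
Qed.

Lemma tight_shift m u v : kappa u = kappa v -> kappa (shift m u) = kappa (shift m v).
Proof.
move=> uv; elim: m => [|m IHm]; first by rewrite !shift0.
by rewrite -addn1 -!shiftD; apply: tight_same => //; apply: tight_label.
Qed.

Lemma tight_unshift m u v : kappa (shift m u) = kappa (shift m v) -> kappa u = kappa v.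
Proof. by move/(tight_shift (m * j)); rewrite !shiftK. Qed.

End Tight.

Definition periodic := [exists p : 'I_j.+1, (p != ord0) &&
  [forall t : 'I_j.+1, tnth w (cyc (t + p)) == tnth w t]].

(** An identification of two points propagates along all shifts and equates their labels, so the
    difference of the two indices is a period of the word. *)
Lemma tight_index kappa u v : tight kappa -> ~~ periodic -> kappa u = kappa v -> u.2 = v.2.
Proof.
move=> tk np uv; apply/eqP; apply: contraNT np => ne.
apply/existsP; exists (cyc (v.2 + u.2 * j)); apply/andP; split.
  apply: contra ne => /eqP/(congr1 val) /= e; apply/eqP/val_inj => /=.
  have : v.2 + u.2 * j + u.2 = 0 + u.2 %[mod j.+1] by rewrite -modnDml e.
  rewrite -addnA -mulnSr -modnDmr modnMl addn0 add0n !modn_small //.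
apply/forallP => t; have := tight_shift tk (t + u.2 * j) uv => /(tight_label tk).
rewrite /label /= => e; apply/eqP.
have -> : tnth w t = tnth w (cyc (u.2 + (t + u.2 * j))).
  congr tnth; apply/esym/cyc_mod.
  by rewrite addnCA -mulnS -modnDmr modnMl addn0.
rewrite e; congr tnth; apply: cyc_eq; rewrite /= modnDmr.
by rewrite addnCA.
Qed.

Definition id_kernel : {ffun pos -> pos} := [ffun u => u].

(** Without identifications the pattern is s disjoint cycles, where every degree is exactly 2. *)
Lemma tight_id : tight id_kernel.
Proof.
have g : good id_kernel.
  apply/and3P; split.
  - by apply/eqP/ffunP => u; have := kernel_repK id_kernel u; rewrite [id_kernel u]ffunE ffunE.
  - by apply/forall_inP => u _; apply/forall_inP => v _; rewrite !ffunE; apply/implyP.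
  apply/foldedP => -[u []] [v []]; rewrite /dart_letter /dart_src /dart_tgt !ffunE /=.
  - by move=> _ ->.
  - by move=> e uv; have := label_shift v; rewrite -uv -e eqxx.
  - by move=> e uv; have := label_shift u; rewrite uv -e eqxx.
  - by move=> _ /shift_inj.
apply/andP; split => //.
have [vE _] := nverts_le_edges dart_src_rev dart_tgt_rev dart_letter_rev
  dart_src_out dart_src_in dart_letter_out_in g.
rewrite eqn_leq vE /=.
have /and3P[_ _ f] := g.
rewrite -(leq_pmul2l (isT : 0 < 2)) -(sum_card_darts dart_src_rev dart_tgt_rev dart_letter_rev f).
have -> : nverts id_kernel = \sum_(u : pos) 1.
  by rewrite sum1_card /nverts; apply: eq_card => u; rewrite !inE ffunE eqxx.
rewrite big_distrr /=; apply: leq_sum => u _.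
apply: leq_trans (_ : #|[set dart_letter (out_dart u); dart_letter (in_dart u)]%SET| <= _); last first.
  by rewrite cards2 dart_letter_out_in.
apply: subset_leq_card; apply/fintype.subsetP => c; rewrite !inE => /existsP[[v b]].
rewrite /dart_src /= ffunE => /andP[/eqP <- /eqP <-]; case: b => /=.
  by rewrite eqxx.
by rewrite /in_dart shiftj1 eqxx orbT.
Qed.

(** Identified points have equal indices by [tight_index]; shifted back to index 0 they are
    identified base points, hence equal. *)
Lemma card_tight_nonperiodic : ~~ periodic -> #|[set kappa | tight kappa]%SET| = 1.
Proof.
move=> np; rewrite (_ : [set _ | _]%SET = [set id_kernel]%SET) ?cards1 //.
apply/setP => kappa; rewrite !inE; apply/idP/eqP => [tk|->]; last exact: tight_id.
have inj u v : kappa u = kappa v -> u = v.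
  move=> uv; have i2 := tight_index tk np uv.
  case/andP: (tk) => /and3P[_ /forall_inP bk _] _.
  have := tight_shift tk (u.2 * j) uv => e.
  have z (x : pos) : x.2 = u.2 -> shift (u.2 * j) x = (x.1, ord0).
    by move=> xu; congr (_, _); apply: cyc_mod; rewrite xu -mulnS modnMl mod0n.
  rewrite !z // in e; have := bk (u.1, ord0); rewrite inE eqxx => /(_ isT)/forall_inP/(_ (v.1, ord0)).
  rewrite inE eqxx e eqxx => /(_ isT)/eqP[] uv1.
  by rewrite [u]surjective_pairing [v]surjective_pairing uv1 i2.
apply/ffunP => u; rewrite ffunE; apply: inj.
case/andP: tk => g _; exact: good_kernel_fix g.
Qed.

Definition meets kappa a b m := kappa (a, ord0) == kappa (b, cyc m).
(* When the walks a and b never meet, find returns j.+1, the size of the list. *)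
Definition first_meet kappa a b := find (meets kappa a b) (iota 1 j.+1).

Lemma first_meet_lt kappa a b m : meets kappa a b m -> first_meet kappa a b < j.+1.
Proof.
move=> h; rewrite -[X in _ < X](size_iota 1 j.+1) -has_find; apply/hasP.
have [m0|m0] := posnP (m %% j.+1).
  exists j.+1; first by rewrite mem_iota; lia.
  by move: h; rewrite /meets (@cyc_eq m j.+1) // m0 modnn.
exists (m %% j.+1); first by rewrite mem_iota; have := ltn_pmod m (ltn0Sn j); lia.
by move: h; rewrite /meets (@cyc_eq m (m %% j.+1)) // modn_mod.
Qed.

Lemma first_meetP kappa a b : first_meet kappa a b < j.+1 ->
  meets kappa a b (first_meet kappa a b).+1.
Proof.
move=> h; have := h; rewrite -[X in _ < X](size_iota 1 j.+1) -has_find => /(nth_find 0).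
by rewrite nth_iota // add1n.
Qed.

Lemma first_meet_min kappa a b m : 0 < m <= first_meet kappa a b -> ~~ meets kappa a b m.
Proof.
case: m => // m /= h; have := before_find 0 h; rewrite nth_iota ?add1n => [->//|].
by apply: leq_trans h _; rewrite -[X in _ <= X](size_iota 1 j.+1) find_size.
Qed.

Lemma meets_period kappa b x k p : tight kappa ->
  meets kappa b b p -> meets kappa b b (x + k * p) = meets kappa b b x.
Proof.
move=> tk /eqP kp; elim: k => [|k IHk]; first by rewrite addn0.
rewrite -IHk mulSn [p + _]addnC addnA; set y := x + _.
have /(tight_shift tk y) := kp; rewrite /shift /= cyc_cycD add0n => e.
by rewrite /meets e addnC.
Qed.

(** Let c be the first meeting of a with b and p the first return of b. A meeting at m makes b meet
    itself at m - c, so p divides the representative m + c j of m - c. Both c and p are shared with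
    kappa', where the argument is run backwards. *)
Lemma meets_first kappa kappa' a b m : tight kappa -> tight kappa' ->
  (forall a b, first_meet kappa a b = first_meet kappa' a b) ->
  meets kappa a b m -> meets kappa' a b m.
Proof.
move=> tk tk' ff h.
set c := (first_meet kappa a b).+1; set p := (first_meet kappa b b).+1.
have hc : meets kappa a b c by apply/first_meetP/first_meet_lt/h.
have hb : meets kappa b b j.+1 by rewrite /meets (@cyc_eq j.+1 0) ?(@cyc_mod ord0) // modnn.
have hp : meets kappa b b p by apply/first_meetP/first_meet_lt/hb.
have hc' : meets kappa' a b c by rewrite /c ff first_meetP // -ff; apply: first_meet_lt h.
have hp' : meets kappa' b b p by rewrite /p ff first_meetP // -ff; apply: first_meet_lt hb.
have hD : meets kappa b b (m + c * j).
  have : kappa (b, cyc c) = kappa (b, cyc m) by rewrite -(eqP hc) (eqP h).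
  move/(tight_shift tk (c * j)); rewrite /shift /= !cyc_cycD -mulnS => e.
  by rewrite /meets -e; apply/eqP; congr (kappa (b, _)); apply/esym/cyc_mod; rewrite modnMl mod0n.
have pD : p %| m + c * j.
  move: hD; rewrite {1}(divn_eq (m + c * j) p) addnC meets_period // => hr.
  rewrite /dvdn; apply: contraTT hr => r0; apply: first_meet_min.
  by rewrite lt0n r0 -ltnS ltn_pmod.
have hD' : meets kappa' b b (m + c * j).
  case/dvdnP: pD => k ->; rewrite -[k * p]add0n meets_period //.
  by rewrite /meets (@cyc_mod ord0) // mod0n.
have /eqP/(tight_shift tk' c) := hD'; rewrite /shift /= !cyc_cycD add0n => e.
rewrite /meets (eqP hc') e; apply/eqP; congr (kappa' (b, _)); apply: cyc_eq.
by rewrite -addnA [c * j + c]addnC -mulnS -modnDmr modnMl addn0.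
Qed.

(* A tight kernel is invariant under shifting, hence determined by the first
   meeting times of all pairs of walks. *)
Lemma card_tight_le : #|[set kappa | tight kappa]%SET| <= j.+2 ^ (s * s).
Proof.
pose code kappa : {ffun 'I_s * 'I_s -> 'I_j.+2} := [ffun p => inord (first_meet kappa p.1 p.2)].
have fle kappa a b : first_meet kappa a b < j.+2.
  by rewrite ltnS -[X in _ <= X](size_iota 1 j.+1) find_size.
rewrite -(card_in_imset (f := code)); last first.
  move=> kappa kappa'; rewrite !inE => tk tk' /ffunP e.
  have ff a b : first_meet kappa a b = first_meet kappa' a b.
    by have := e (a, b); rewrite !ffunE /= => /(congr1 val); rewrite /= !inordK.
  have mm a b m : meets kappa a b m = meets kappa' a b m.
    by apply/idP/idP; apply: meets_first.
  have meetE kap u v : tight kap -> (kap u == kap v) = meets kap u.1 v.1 (v.2 + u.2 * j).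
    move=> tkap; have z : shift (u.2 * j) u = (u.1, ord0).
      by congr (_, _); apply: cyc_mod; rewrite -mulnS modnMl mod0n.
    rewrite /meets -z; apply/eqP/eqP; first exact: tight_shift.
    exact: (@tight_unshift _ tkap (u.2 * j) u v).
  case/andP: (tk) => /and3P[/eqP <- _ _] _; case/andP: (tk') => /and3P[/eqP <- _ _] _.
  by apply: eq_kernel_rep => u v; rewrite !meetE.
apply: leq_trans (max_card _) _.
by rewrite card_ffun card_prod !card_ord.
Qed.

End CyclicWord.

(** * Counting cyclically reduced words with a nontrivial period *)

Section PeriodicWords.
Local Open Scope nat_scope.
Variables (L : finType) (inv : L -> L) (q : nat).
Hypotheses (invK : involutive inv) (cardL : #|L| = q.+1).

Lemma card_reduced_path c g : #|[set v : g.-tuple L | path (noncancel inv) c v]%SET| = q ^ g.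
Proof.
rewrite -sum1dep_card; elim: g c => [|g IHg] c.
  by rewrite (big_tuple0 (path (noncancel inv) c) (fun=> 1)).
rewrite (big_tuple_cons g (path (noncancel inv) c) (fun=> 1)) /=.
rewrite (eq_bigr (fun d => if noncancel inv c d then q ^ g else 0)); last first.
  move=> d _; case: ifP => cd; last by rewrite big_pred0.
  by rewrite -(IHg d); apply: eq_bigl.
rewrite -big_mkcond sum_nat_const expnS; congr (_ * _).
rewrite -(card_noncancel invK cardL c); apply: eq_card => d.
by rewrite !inE unfold_in noncancelC.
Qed.

Lemma card_reduced_le g : 0 < q ->
  #|[set v : g.+1.-tuple L | sorted (noncancel inv) v]%SET| <= 2 * q ^ g.+1.
Proof.
move=> q0; rewrite -sum1dep_card (big_tuple_cons g (sorted (noncancel inv)) (fun=> 1)) /=.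
rewrite (eq_bigr (fun=> q ^ g)) => [|c _]; last by rewrite sum1dep_card card_reduced_path.
rewrite sum_nat_const cardL expnS mulnA leq_mul2r; apply/orP; right; lia.
Qed.

End PeriodicWords.

Section PeriodicCyclicWords.
Local Open Scope nat_scope.
Variables (r j : nat).
Local Notation L := ('I_r * bool)%type.
Local Notation cyc := (cyc j).
Implicit Types w : j.+1.-tuple L.

Definition has_period w g := [forall t : 'I_j.+1, tnth w (cyc (t + g)) == tnth w t].

Lemma has_periodP w g m k : has_period w g -> tnth w (cyc (m + k * g)) = tnth w (cyc m).
Proof.
move/forallP => H; elim: k => [|k <-]; first by rewrite addn0.
rewrite (_ : m + k.+1 * g = m + k * g + g); last by rewrite mulSn addnCA addnC.
by have /eqP := H (cyc (m + k * g)); rewrite cyc_cycD.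
Qed.

(** The gcd of a period with the length j + 1 is again a period, and a proper divisor of j + 1 is at
    most half of it. *)
Lemma periodic_short w : periodic w -> exists2 g, 0 < g <= j.+1./2 & has_period w g.
Proof.
case/existsP => p /andP[p0 per]; have {}p0 : 0 < p by rewrite lt0n; apply: contra p0 => /eqP p0; apply/eqP/val_inj.
have g0 : 0 < gcdn p j.+1 by rewrite gcdn_gt0 p0.
exists (gcdn p j.+1); first rewrite g0 /=.
  have /dvdnP[t tE] := dvdn_gcdr p j.+1.
  have gp : gcdn p j.+1 < j.+1 by apply: leq_ltn_trans (ltn_ord p); apply: dvdn_leq (dvdn_gcdl _ _).
  have t2 : 1 < t by case: t tE => [|[|t]] // tE; lia.
  have : 2 * gcdn p j.+1 <= j.+1 by rewrite [leqRHS]tE leq_mul2r t2 orbT.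
  lia.
case: (egcdnP j.+1 p0) => km kn kE _.
apply/forallP => t; apply/eqP; rewrite -[in RHS](cyc_id t).
rewrite -(has_periodP t km per) kE; congr tnth; apply: cyc_eq.
by rewrite addnCA modnMDl.
Qed.

Hypothesis r0 : 0 < r.
Let q := (2 * r).-1.

Lemma card_letters : #|{: L}| = q.+1.
Proof. by rewrite card_prod card_ord card_bool /q; lia. Qed.

(** A word of period g is determined by its first g letters, which form a reduced word. *)
Lemma card_has_period g : 0 < g <= j.+1./2 ->
  #|[set w : j.+1.-tuple L | path.cycle (noncancel (@flip r)) w && has_period w g]%SET| <= 2 * q ^ j.+1./2.
Proof.
case/andP=> g0 gj.
pose f w : g.-tuple L := [tuple tnth w (cyc i) | i < g].
have fs w : path.cycle (noncancel (@flip r)) w -> sorted (noncancel (@flip r)) (f w).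
  move=> cw; have c0 : L by exact: thead w.
  apply/(sortedP c0) => i; rewrite size_tuple => ig.
  have nE m (mg : m < g) : nth c0 (f w) m = tnth w (cyc m).
    by rewrite -(tnth_nth c0 (f w) (Ordinal mg)) tnth_mktuple.
  rewrite !nE //; last exact: ltnW.
  exact: cycle_noncancel.
rewrite -(card_in_imset (f := f)); last first.
  move=> w w'; rewrite !inE => /andP[_ pw] /andP[_ pw'] e; apply: eq_from_tnth => i.
  have E v : has_period v g -> tnth v i = tnth (f v) (Ordinal (ltn_pmod i g0)).
    move=> pv; rewrite tnth_mktuple /= -[in LHS](cyc_id i) {1}(divn_eq i g) addnC.
    exact: has_periodP.
  by rewrite !E // e.
apply: leq_trans (_ : #|[set v : g.-tuple L | sorted (noncancel (@flip r)) v]%SET| <= _).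
  apply: subset_leq_card; apply/fintype.subsetP => _ /imsetP[w + ->].
  by rewrite !inE => /andP[/fs].
have q0 : 0 < q by rewrite /q; lia.
case: g g0 gj f fs => // g _ gj _ _.
apply: leq_trans (card_reduced_le (@flipK r) card_letters g q0) _.
by rewrite leq_mul2l /= leq_pexp2l.
Qed.

Lemma card_periodic_words :
  #|[set w : j.+1.-tuple L | path.cycle (noncancel (@flip r)) w && periodic w]%SET| <= j.+1 * (2 * q ^ j.+1./2).
Proof.
apply: leq_trans (_ : #|\bigcup_(g < j.+1 | 0 < g <= j.+1./2)
   [set w : j.+1.-tuple L | path.cycle (noncancel (@flip r)) w && has_period w g]%SET| <= _).
  apply: subset_leq_card; apply/fintype.subsetP => w; rewrite inE => /andP[cw /periodic_short[g gj pg]].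
  apply/bigcupP; have gl : g < j.+1 by lia.
  by exists (Ordinal gl) => //; rewrite inE cw.
apply: leq_trans (_ : \sum_(g < j.+1 | 0 < g <= j.+1./2) 2 * q ^ j.+1./2 <= _).
  elim/big_ind2: _ => [|m1 A1 m2 A2 I1 I2|g gj]; first by rewrite cards0.
    by apply: leq_trans (leq_card_setU _ _) _; apply: leq_add.
  exact: card_has_period.
rewrite big_mkcond -[leqRHS](_ : \sum_(g < j.+1) 2 * q ^ j.+1./2 = _).
  by apply: leq_sum => g _; case: ifP.
by rewrite sum_nat_const card_ord.
Qed.

End PeriodicCyclicWords.

(** * Fixed tuples as families of closed walks *)

Section FixedTuples.
Local Open Scope nat_scope.
Variables (r s j N : nat) (g : {ffun 'I_r -> 'S_N}) (w : j.+1.-tuple ('I_r * bool)).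

Definition word_perm (v : seq ('I_r * bool)) : 'S_N := (\prod_(c <- v) letter_perm g c)%g.

Local Notation csrc := (@dart_src s j).
Local Notation ctgt := (@dart_tgt s j).
Local Notation clet := (@dart_letter r s j w).

Lemma compat_walk (phi : {ffun pos s j -> 'I_N}) : compat csrc ctgt clet g phi ->
  forall u, letter_perm g (label w u) (phi u) = phi (shift 1 u).
Proof. by move=> /forallP H u; have /eqP := H (u, true). Qed.

Lemma walk_compat (phi : {ffun pos s j -> 'I_N}) :
  (forall u, letter_perm g (label w u) (phi u) = phi (shift 1 u)) -> compat csrc ctgt clet g phi.
Proof.
move=> H; apply/forallP => -[u []]; rewrite /dart_src /dart_tgt /dart_letter /=.
  by rewrite H.
rewrite -H /letter_perm /flip /=; case: (_.2) => /=; first by rewrite permK.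
by rewrite permKV.
Qed.

Lemma word_perm_take (m : nat) (jm : m < j.+1) x :
  word_perm (take m.+1 w) x = letter_perm g (tnth w (Ordinal jm)) (word_perm (take m w) x).
Proof.
have c0 : 'I_r * bool by exact: thead w.
by rewrite (take_nth c0) ?size_tuple // /word_perm -cats1 big_cat big_seq1 permM (tnth_nth c0).
Qed.

Lemma compat_word_perm (phi : {ffun pos s j -> 'I_N}) a : compat csrc ctgt clet g phi ->
  forall m, m <= j.+1 -> phi (a, cyc j m) = word_perm (take m w) (phi (a, ord0)).
Proof.
move=> cp; elim=> [|m IHm] jm.
  by rewrite take0 /word_perm big_nil perm1 (@cyc_mod j ord0) // mod0n.
rewrite (word_perm_take jm) -IHm ?(ltnW jm) //.
have -> : Ordinal jm = cyc j m by apply: val_inj; rewrite /= modn_small.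
by have := compat_walk cp (a, cyc j m); rewrite /label /= => ->; rewrite /shift /= cyc_cycD addn1.
Qed.

(** A fixed tuple corresponds to the s closed walks that its entries trace while the word is read;
    conversely the starting points determine the walks. *)
Lemma card_fixed_tuples :
  #|[set x in s.-dtuple([set: 'I_N]) | n_act 'P x (word_perm w) == x]%SET| =
  #|[set phi | inj_on_base (base s j) phi && compat csrc ctgt clet g phi]%SET|.
Proof.
pose f (phi : {ffun pos s j -> 'I_N}) : s.-tuple 'I_N := [tuple phi (a, ord0) | a < s].
rewrite -[RHS](card_in_imset (f := f)); last first.
  move=> phi psi; rewrite !inE => /andP[_ cp] /andP[_ cq] e.
  apply/ffunP => -[a i]; have e0 : phi (a, ord0) = psi (a, ord0).
    by have := congr1 (fun t => tnth t a) e; rewrite !tnth_mktuple.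
  rewrite -(cyc_id i) (compat_word_perm a cp (ltnW (ltn_ord i))).
  by rewrite (compat_word_perm a cq (ltnW (ltn_ord i))) e0.
apply: eq_card => x; rewrite !inE; apply/andP/imsetP => [[/andP[ux _] /eqP fx]|[phi]].
  have xfix a : word_perm w (tnth x a) = tnth x a.
    by have := congr1 (fun t => tnth t a) fx; rewrite tnth_map.
  exists [ffun u : pos s j => word_perm (take u.2 w) (tnth x u.1)].
    rewrite inE; apply/andP; split.
      apply/forall_inP => u; rewrite inE => /eqP u0; apply/forall_inP => v; rewrite inE => /eqP v0.
      apply/implyP; rewrite !ffunE u0 v0 take0 /word_perm big_nil !perm1 => /eqP e.
      have /tuple_uniqP xI := ux.
      by rewrite [u]surjective_pairing [v]surjective_pairing (xI _ _ e) u0 v0.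
    apply: walk_compat => u; rewrite !ffunE /label /=.
    have -> : tnth w u.2 = tnth w (Ordinal (ltn_ord u.2)) by congr tnth; apply: val_inj.
    (* After the last letter the walk wraps around to index 0; only there is it used that the tuple
       is fixed. *)
    rewrite -word_perm_take addn1; have [uj|uj] := eqVneq (nat_of_ord u.2) j.
      by rewrite uj modnn take0 take_oversize ?size_tuple // xfix /word_perm big_nil perm1.
    by rewrite modn_small // ltnS ltn_neqAle uj -ltnS ltn_ord.
  by apply: eq_from_tnth => a; rewrite tnth_mktuple ffunE take0 /word_perm big_nil perm1.
rewrite inE => /andP[bp cp] ->; split.
  apply/andP; split; last by apply/fintype.subsetP => y _; rewrite inE.
  apply/tuple_uniqP => a b; rewrite !tnth_mktuple => e.
  have /forall_inP/(_ (a, ord0)) := bp; rewrite inE eqxx => /(_ isT)/forall_inP/(_ (b, ord0)).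
  by rewrite inE eqxx e eqxx => /(_ isT)/eqP[].
apply/eqP/eq_from_tnth => a; rewrite tnth_map !tnth_mktuple.
have := compat_word_perm a cp (leqnn j.+1).
by rewrite take_oversize ?size_tuple // (@cyc_mod j ord0) ?modnn ?mod0n.
Qed.

End FixedTuples.

(** * Permutation matrices of the action *)

Section WordMatrices.
Variables (R : comNzRingType) (gT : finGroupType) (T : finType) (to : {action gT &-> T}).
Variables (X : {set T}).
Hypothesis stab : forall x a, x \in X -> to x a \in X.

Definition act_mx (a : gT) : 'M[R]_#|X| :=
  \matrix_(i, k) (to (enum_val i) a == enum_val k)%:R.

Lemma act_mx1 : act_mx 1%g = 1%:M.
Proof. by apply/matrixP => i k; rewrite !mxE act1 (inj_eq enum_val_inj). Qed.

Lemma act_mxM a b : act_mx (a * b)%g = act_mx a *m act_mx b.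
Proof.
apply/matrixP => i k; rewrite !mxE.
have xX := stab a (enum_valP i).
rewrite (bigD1 (enum_rank_in xX (to (enum_val i) a))) //= !mxE enum_rankK_in // eqxx mul1r.
rewrite big1 ?addr0 ?actM // => l lne; rewrite !mxE.
case: eqP => [e|_]; last by rewrite mul0r.
by case/eqP: lne; apply: enum_val_inj; rewrite enum_rankK_in.
Qed.

Lemma tr_act_mx a : \tr (act_mx a) = #|[set x in X | to x a == x]%SET|%:R.
Proof.
rewrite /mxtrace (eq_bigr (fun i => (to (enum_val i) a == enum_val i)%:R)); last by move=> i _; rewrite mxE.
rewrite -(big_enum_val (fun x => (to x a == x)%:R)) /= -sum1dep_card natr_sum big_mkcondr /=.
by apply: eq_bigr => x _; case: eqP.
Qed.

End WordMatrices.

(** * Moments of the adjacency matrix *)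

Section TupleAction.
Variables (R : realType) (r s N : nat).
Local Notation X := (s.-dtuple([set: 'I_N]))%SET.
Local Notation to := ('P * s)%act.

Lemma dtuple_stable x (a : 'S_N) : x \in X -> to x a \in X.
Proof. by apply: n_act_dtuple; apply/astabsP => y; rewrite !inE. Qed.

Lemma card_dtuple_ord : #|X| = (N ^_ s)%N.
Proof.
rewrite -[in RHS](card_ord N) -card_uniq_tuples; apply: eq_card => t; rewrite !inE andbC.
congr (_ && _); last by apply/fintype.subsetP/allP => // _ x _; rewrite inE.
Qed.

Lemma ffact_leq_expn n m : (n ^_ m <= n ^ m)%N.
Proof.
by elim: m => // m IHm; rewrite ffactnSr expnSr leq_mul // leq_subr.
Qed.

Lemma card_dtuple_le : (#|X| <= N ^ s)%N.
Proof. by rewrite card_dtuple_ord ffact_leq_expn. Qed.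

Variable g : {ffun 'I_r -> 'S_N}.
Local Notation A := (schreier_adj R to X g).
Local Notation M := (fun c => act_mx R to X (letter_perm g c)).

Lemma schreier_adj_letters : A = letter_mx M.
Proof.
apply/matrixP => i k; rewrite mxE summxE natrD.
rewrite -(pair_bigA _ (fun l b => act_mx R to X (letter_perm g (l, b)) i k)) /=.
under [RHS]eq_bigr do rewrite big_bool.
rewrite big_split /=; congr (_ + _); rewrite -sum1dep_card natr_sum big_mkcond /=.
  by apply: eq_bigr => l _; rewrite mxE /letter_perm /=; case: eqP.
apply: eq_bigr => l _; rewrite mxE /letter_perm /=.
have -> : (n_act 'P (enum_val i) (g l)^-1%g == enum_val k) = (to (enum_val k) (g l) == enum_val i).
  by apply/eqP/eqP => <-; [exact: (actKV to)|exact: (actK to)].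
by case: eqP.
Qed.

Lemma schreier_adj_sym : A^T = A.
Proof. by apply/matrixP => i k; rewrite !mxE addnC. Qed.

Lemma schreier_adj_ge0 i k : 0 <= A i k.
Proof. by rewrite mxE. Qed.

Lemma schreier_adj_regular k : \sum_i A i k = (2 * r)%:R.
Proof.
rewrite schreier_adj_letters; under eq_bigr do rewrite summxE.
rewrite exchange_big /= (eq_bigr (fun=> 1)) => [|c _].
  by rewrite sumr_const card_prod card_ord card_bool mulnC.
set a := letter_perm g c.
have kX : to (enum_val k) a^-1%g \in X by apply/dtuple_stable/enum_valP.
rewrite (bigD1 (enum_rank_in kX (to (enum_val k) a^-1%g))) //= mxE enum_rankK_in //.
rewrite (actKV to) eqxx big1 ?addr0 // => i ine; rewrite mxE.
case: eqP => // e; case/eqP: ine; apply: enum_val_inj; rewrite enum_rankK_in //.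
by rewrite -e (actK to).
Qed.

Lemma act_mx_letterK c : M c *m M (flip c) = 1%:M.
Proof.
rewrite -act_mxM; last exact: dtuple_stable.
rewrite -(act_mx1 R to X); congr act_mx.
by case: c => k []; rewrite /letter_perm /= ?mulgV ?mulVg.
Qed.

Lemma word_mx_act w : word_mx M w = act_mx R to X (word_perm g w).
Proof.
elim: w => [|c w IHw] /=; first by rewrite /word_perm big_nil act_mx1.
by rewrite IHw -act_mxM /word_perm ?big_cons //; apply: dtuple_stable.
Qed.

Definition fixed_tuples (w : seq ('I_r * bool)) :=
  #|[set x in X | n_act 'P x (word_perm g w) == x]%SET|.

Hypothesis r0 : (0 < r)%N.
Let q := (2 * r).-1.

Lemma size_eigenvalues : size (eigenvalues A) = #|X|.
Proof.
have [l [lE _]] := symmetric_spectrum schreier_adj_sym.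
by rewrite (perm_size (perm_eigenvalues lE)) size_tuple.
Qed.

Lemma eigenvalues_le x : x \in eigenvalues A -> `|x| <= (2 * r)%:R.
Proof.
have [l [lE _]] := symmetric_spectrum schreier_adj_sym.
rewrite (perm_mem (perm_eigenvalues lE)) => xl.
apply: (regular_eigenvalue_le schreier_adj_ge0 schreier_adj_regular).
by rewrite lE root_prod_XsubC.
Qed.

Lemma sum_dickson_eigenvalues j : \sum_(x <- eigenvalues A) dickson q x j.+1 =
  \sum_(w : j.+1.-tuple ('I_r * bool) | path.cycle (noncancel (@flip r)) w) (fixed_tuples w)%:R
    - (odd j)%:R * ((q%:R - 1) * #|X|%:R).
Proof.
have [l [lE lS]] := symmetric_spectrum schreier_adj_sym.
rewrite (perm_big _ (perm_eigenvalues lE)) -lS {1}schreier_adj_letters.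
rewrite (trace_dickson_mx (@flipK r) (@flip_neq r) (card_letters r0) act_mx_letterK).
congr (_ - _); apply: eq_bigr => w _; rewrite word_mx_act tr_act_mx //.
Qed.

End TupleAction.

Section Degree.
Variables (R : realType) (r : nat).
Hypothesis r0 : (0 < r)%N.
Let q := (2 * r).-1.

(** The trace identity for the trivial representation: every letter is the 1 x 1 identity, so A is
    the scalar 2r and each word has trace 1. *)
Lemma dickson_degree j : dickson q ((2 * r)%:R : R) j.+1 =
  #|[set w : j.+1.-tuple ('I_r * bool) | path.cycle (noncancel (@flip r)) w]%SET|%:R
   - (odd j)%:R * (q%:R - 1).
Proof.
pose M := fun c : 'I_r * bool => 1%:M : 'M[R]_1.
have MK c : M c *m M (flip c) = 1%:M by rewrite mulmx1.
have lE : letter_mx M = (diag_mx (const_mx (2 * r)%:R)).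
  rewrite /letter_mx sumr_const card_prod card_ord card_bool mulnC.
  by apply/matrixP => i k; rewrite mulmxnE !mxE !ord1 eqxx.
have := trace_dickson_mx (@flipK r) (@flip_neq r) (card_letters r0) MK j.
rewrite lE dickson_mx_diag mxtrace_diag big_ord1 !mxE mulr1 => ->.
rewrite -sum1dep_card natr_sum; congr (_ - _); apply: eq_bigr => w _.
suff -> : word_mx M w = 1%:M by rewrite mxtrace1.
by elim: (tval w) => //= c v ->; rewrite mulmx1.
Qed.

Lemma dickson_chebT (t y : R) j : t ^+ 2 = q%:R ->
  dickson q (2 * t * y) j = 2 * t ^+ j * chebT j y.
Proof.
move=> tq; elim/ltn_ind: j => -[|[|j]] IH.
- by rewrite /= expr0 !mulr1.
- by rewrite /= expr1.
rewrite chebTSS -[LHS]/(2 * t * y * dickson q _ j.+1 - q%:R * dickson q _ j) !IH //.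
by rewrite -tq !exprS; ring.
Qed.

End Degree.

Section TestSum.
Variables (R : realType) (r s N : nat).
Hypotheses (r0 : (0 < r)%N).
Let q := (2 * r).-1.
Let t : R := Num.sqrt q%:R.
Let rho := 2 * t.
Local Notation X := (s.-dtuple([set: 'I_N]))%SET.
Local Notation adj g := (schreier_adj R ('P * s)%act X g).
Local Notation cyclic w := (path.cycle (noncancel (@flip r)) w).

Variables (J : nat) (b : nat -> R) (F : R -> R).
Hypothesis FE : forall x, F x = \sum_(j < J.+1) b j * chebT j (x / rho).

Definition test_sum (g : {ffun 'I_r -> 'S_N}) := \sum_(x <- eigenvalues (adj g)) F x - F (2 * r)%:R.

(** The coefficient in the Dickson basis, in which the trace identity is stated; see
    [chebT_dickson]. *)
Definition wgt j := b j.+1 / (2 * t ^+ j.+1).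

(* The coefficient of #|X| - 1 in test_sum: besides the constant term b 0, it
   collects the corrections in the traces of even powers. *)
Definition trivial_part := b 0 - \sum_(j < J) wgt j * ((odd j)%:R * (q%:R - 1)).

Lemma sqrt_q_gt0 : 0 < t.
Proof. by rewrite sqrtr_gt0 ltr0n /q; lia. Qed.

Lemma sqrt_q_sqr : t ^+ 2 = q%:R.
Proof. by rewrite sqr_sqrtr. Qed.

Lemma chebT_dickson j x : b j.+1 * chebT j.+1 (x / rho) = wgt j * dickson q x j.+1.
Proof.
have t0 := sqrt_q_gt0.
have -> : x = 2 * t * (x / rho) by rewrite /rho mulrC divfK // mulf_neq0 // gt_eqF.
rewrite (dickson_chebT _ _ sqrt_q_sqr) /wgt -{1}[2 * t]/rho; set y := (_ / _ in RHS).
have -> : rho * y / rho = y by rewrite mulrAC divff ?mul1r // mulf_neq0 // gt_eqF.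
by field; rewrite expf_neq0 // gt_eqF.
Qed.

Lemma test_sumE g : test_sum g = (#|X|%:R - 1) * trivial_part +
  \sum_(j < J) wgt j * \sum_(w : j.+1.-tuple ('I_r * bool) | cyclic w) ((fixed_tuples s g w)%:R - 1).
Proof.
rewrite /test_sum (eq_bigr _ (fun x _ => FE x)) exchange_big /= FE !big_ord_recl /=.
rewrite big_const_seq count_predT iter_addr_0 (size_eigenvalues R s g).
rewrite !mulr1 /trivial_part.
have -> : \sum_(j < J) \sum_(x <- eigenvalues (adj g)) b (bump 0 j) * chebT (bump 0 j) (x / rho) =
  \sum_(j < J) wgt j * (\sum_(w : j.+1.-tuple ('I_r * bool) | cyclic w) (fixed_tuples s g w)%:R
    - (odd j)%:R * ((q%:R - 1) * #|X|%:R)).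
  apply: eq_bigr => j _; rewrite /bump add1n.
  rewrite (eq_bigr _ (fun x _ => chebT_dickson j x)) -mulr_sumr.
  by rewrite sum_dickson_eigenvalues.
have -> : \sum_(j < J) b (bump 0 j) * chebT (bump 0 j) ((2 * r)%:R / rho) =
  \sum_(j < J) wgt j * (\sum_(w : j.+1.-tuple ('I_r * bool) | cyclic w) 1
    - (odd j)%:R * (q%:R - 1)).
  apply: eq_bigr => j _; rewrite /bump add1n chebT_dickson dickson_degree //.
  by rewrite -sum1dep_card natr_sum.
have sB (a c : 'I_J -> R) : \sum_(j < J) wgt j * (a j - c j) =
    \sum_(j < J) wgt j * a j - \sum_(j < J) wgt j * c j.
  by rewrite -sumrB; apply: eq_bigr => j _; rewrite mulrBr.
under [X in _ = _ + X]eq_bigr do rewrite sumrB.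
rewrite !sB.
have -> : \sum_(j < J) wgt j * ((odd j)%:R * ((q%:R - 1) * #|X|%:R)) =
  (\sum_(j < J) wgt j * ((odd j)%:R * (q%:R - 1))) * #|X|%:R.
  by rewrite mulr_suml; apply: eq_bigr => j _; rewrite !mulrA.
rewrite -mulr_natr; ring.
Qed.

Hypothesis F01 : forall x, `|x| <= (2 * r)%:R -> 0 <= F x <= 1.

Lemma test_sum_norm g : (0 < #|X|)%N -> `|test_sum g| <= #|X|%:R.
Proof.
move=> X0; have F0 x : x \in eigenvalues (adj g) -> 0 <= F x <= 1.
  by move=> /eigenvalues_le; apply: F01.
have d01 : 0 <= F (2 * r)%:R <= 1 by apply: F01; rewrite ger0_norm.
have h0 : 0 <= \sum_(x <- eigenvalues (adj g)) F x.
  by rewrite big_seq sumr_ge0 // => x /F0/andP[].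
have h1 : \sum_(x <- eigenvalues (adj g)) F x <= #|X|%:R.
  have -> : #|X|%:R = \sum_(x <- eigenvalues (adj g)) 1 :> R.
    by rewrite big_const_seq count_predT iter_addr_0 size_eigenvalues.
  rewrite big_seq [leRHS]big_seq.
  by apply: ler_sum => x /F0/andP[].
have h2 : 1 <= #|X|%:R :> R by rewrite ler1n.
rewrite /test_sum ler_norml; move/andP: d01 => [? ?]; apply/andP; split; lra.
Qed.

Lemma test_sum_ge0 g : (1 < #|X|)%N -> 0 <= test_sum g.
Proof.
move=> X1; apply: (@le_test_of_mu _ _ (adj g) (2 * r)%:R (mu (adj g)) 0 F X1) => //.
- exact: schreier_adj_sym.
- exact: schreier_adj_ge0.
- exact: schreier_adj_regular.
- by move=> x /F01/andP[].
- by move=> x /andP[_ /F01/andP[]].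
Qed.

Lemma test_sum_mu g theta c : (1 < #|X|)%N ->
  (forall x, theta <= `|x| <= (2 * r)%:R -> c <= F x) ->
  theta <= mu_tuples R s g -> c <= test_sum g.
Proof.
move=> X1 cF; apply: le_test_of_mu => //.
- exact: schreier_adj_sym.
- exact: schreier_adj_ge0.
- exact: schreier_adj_regular.
- by move=> x /F01/andP[].
Qed.

End TestSum.

(** * The expected test sum *)

Section Moment.
Variables (R : realType) (r s : nat).
Hypotheses (r0 : (0 < r)%N).
Let q := (2 * r).-1.
Let t : R := Num.sqrt q%:R.
Let rho := 2 * t.
Local Notation X N := (s.-dtuple([set: 'I_N]))%SET.
Local Notation L := ('I_r * bool)%type.
Local Notation cyclic w := (path.cycle (noncancel (@flip r)) w).

Variables (J : nat) (b : nat -> R) (F : R -> R) (K : R).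
Hypothesis FE : forall x, F x = \sum_(j < J.+1) b j * chebT j (x / rho).
Hypothesis F01 : forall x, `|x| <= (2 * r)%:R -> 0 <= F x <= 1.
Hypothesis bK : \sum_(j < J.+1) `|b j| <= K.
Hypothesis K1 : K <= 1.

(** M bounds the number of vertices of every pattern in use. The integer m exceeds M, s and the
    degree of [moment_poly], so elementary bounds hold at every N >= m. C0 bounds the weight of the
    periodic words of any one length after normalisation. *)
Let M := (s * J)%N.
Let m := (r * M + s).+2.
Let C0 := (J * J.+1 ^ (s * s))%N.

Definition mean N (f : {ffun 'I_r -> 'S_N} -> R) := (\sum_g f g) / N`!%:R ^+ r.

Lemma fact_neq0 N : N`!%:R ^+ r != 0 :> R.
Proof. by rewrite expf_neq0 // pnatr_eq0 -lt0n fact_gt0. Qed.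

Lemma card_perm_tuples N : #|{ffun 'I_r -> 'S_N}|%:R = N`!%:R ^+ r :> R.
Proof. by rewrite card_ffun card_Sn card_ord natrX. Qed.

Lemma mean_const N (c : R) : mean (fun _ : {ffun 'I_r -> 'S_N} => c) = c.
Proof. by rewrite /mean sumr_const -[_ *+ _]mulr_natr card_perm_tuples mulfK // fact_neq0. Qed.

Lemma le_mean N (f h : {ffun 'I_r -> 'S_N} -> R) : (forall g, f g <= h g) -> mean f <= mean h.
Proof.
move=> fh; rewrite ler_wpM2r ?invr_ge0 ?exprn_ge0 //.
by apply: ler_sum => g _.
Qed.

Lemma norm_mean_le N (f : {ffun 'I_r -> 'S_N} -> R) c : (forall g, `|f g| <= c) -> `|mean f| <= c.
Proof.
move=> fc; rewrite ler_norml -{1}(mean_const N (- c)) -{2}(mean_const N c).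
by rewrite !le_mean // => g; have := fc g; rewrite ler_norml => /andP[].
Qed.

Definition word_poly j (w : j.+1.-tuple L) : {poly R} :=
  expect_poly R (@dart_src s j) (@dart_tgt s j) (@dart_letter r s j w) (base s j) M.

Lemma card_pos j : (j < J)%N -> (#|pos s j| <= M)%N.
Proof. by move=> jJ; rewrite card_prod !card_ord /M leq_mul2l jJ orbT. Qed.

Lemma word_polyE N j (w : j.+1.-tuple L) : (j < J)%N -> (M <= N)%N -> (0 < N)%N -> cyclic w ->
  mean (fun g : {ffun 'I_r -> 'S_N} => (fixed_tuples s g w)%:R) * (falling_poly R 0 M).[N%:R^-1] ^+ r
   = (word_poly w).[N%:R^-1].
Proof.
move=> jJ MN N0 cw.
rewrite /word_poly -(expect_polyE R (base s j) (@dart_src_rev s j) (@dart_tgt_rev s j)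
  (@dart_letter_rev r s j w) (@dart_src_out s j) (@dart_src_in s j) (dart_letter_out_in cw)
  (N := N) (M := M)) ?card_pos //.
by congr (_ / _ * _); rewrite natr_sum; apply: eq_bigr => g _; rewrite /fixed_tuples card_fixed_tuples.
Qed.

Definition moment_poly : {poly R} := \sum_(j < J) wgt r b j *:
  \sum_(w : j.+1.-tuple L | cyclic w) (word_poly w - falling_poly R 0 M ^+ r).

Lemma size_moment_poly : (size moment_poly <= (r * M).+1)%N.
Proof.
apply: leq_trans (size_sum _ _ _) _; apply/bigmax_leqP => j _.
apply: leq_trans (size_scale_leq _ _) _.
apply: leq_trans (size_sum _ _ _) _; apply/bigmax_leqP => w cw.
apply: leq_trans (size_polyD _ _) _; rewrite geq_max size_polyN; apply/andP; split.
  apply: (size_expect_poly R (base s j) (@dart_src_rev s j) (@dart_tgt_rev s j)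
   (@dart_letter_rev r s j w) (@dart_src_out s j) (@dart_src_in s j) (dart_letter_out_in cw)).
  exact: card_pos.
apply: leq_trans (size_poly_exp_leq _ _) _; rewrite ltnS mulnC leq_mul2l.
have h := size_falling_poly R 0 M; rewrite subn0 in h.
by rewrite -subn1 leq_subLR add1n h orbT.
Qed.

Local Notation trivial := (trivial_part r J b).

Lemma moment_polyE N : (M <= N)%N -> (0 < N)%N ->
  moment_poly.[N%:R^-1] = (falling_poly R 0 M).[N%:R^-1] ^+ r *
    (mean (@test_sum R r s N F) - (#|X N|%:R - 1) * trivial).
Proof.
move=> MN N0.
have -> : mean (@test_sum R r s N F) - (#|X N|%:R - 1) * trivial =
  \sum_(j < J) wgt r b j * \sum_(w : j.+1.-tuple L | cyclic w)
    (mean (fun g : {ffun 'I_r -> 'S_N} => (fixed_tuples s g w)%:R) - 1).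
  rewrite /mean (eq_bigr _ (fun g _ => test_sumE s r0 FE g)) big_split /= mulrDl.
  have -> : (\sum_(g : {ffun 'I_r -> 'S_N}) (#|X N|%:R - 1) * trivial) / N`!%:R ^+ r
     = (#|X N|%:R - 1) * trivial by exact: mean_const.
  rewrite addrC addKr exchange_big mulr_suml /=; apply: eq_bigr => j _.
  rewrite -[Z in Z / _]mulr_sumr -mulrA; congr (_ * _).
  rewrite exchange_big mulr_suml /=; apply: eq_bigr => w _.
  by rewrite sumrB mulrBl; congr (_ - _); apply: (mean_const N 1).
rewrite horner_sum mulr_sumr; apply: eq_bigr => j _.
rewrite hornerZ [RHS]mulrCA; congr (_ * _); rewrite horner_sum mulr_sumr; apply: eq_bigr => w cw.
by rewrite hornerD hornerN horner_exp -word_polyE // mulrBr mulr1 mulrC.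
Qed.

Lemma sqrt_q_ge1 : 1 <= t.
Proof. by rewrite -[leLHS]sqrtr1 ler_wsqrtr // ler1n /q; lia. Qed.

Lemma exp_half_le h : q%:R ^+ h./2 <= t ^+ h :> R.
Proof.
have -> : q%:R ^+ h./2 = t ^+ h./2.*2 by rewrite -mul2n exprM sqrt_q_sqr.
apply: ler_weXn2l; first exact: sqrt_q_ge1.
by rewrite -[leqRHS](odd_double_half h) leq_addl.
Qed.

(** The normalisation in [wgt] absorbs growth of order t^(j+1), leaving only the Wiener norm. *)
Lemma sum_wgt_le (c : nat -> R) C : (forall j, (j < J)%N -> `|c j| <= 2 * t ^+ j.+1 * C) -> 0 <= C ->
  `|\sum_(j < J) wgt r b j * c j| <= (\sum_(j < J) `|b j.+1|) * C.
Proof.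
move=> cC C0'; apply: le_trans (ler_norm_sum _ _ _) _; rewrite mulr_suml.
apply: ler_sum => j _; rewrite normrM /wgt normrM normfV -/t -mulrA ler_wpM2l //.
have t0 : 0 < 2 * t ^+ j.+1 by rewrite mulr_gt0 // exprn_gt0 // (lt_le_trans ltr01 sqrt_q_ge1).
by rewrite (gtr0_norm t0) mulrC ler_pdivrMr // mulrC cC.
Qed.

Lemma sum_b_split : `|b 0| + \sum_(j < J) `|b j.+1| <= K.
Proof. by apply: le_trans bK; rewrite big_ord_recl. Qed.

Lemma coef_norm_ge0 : 0 <= K.
Proof. by apply: le_trans bK; apply: sumr_ge0. Qed.

(** The correction q - 1 occurs only for even lengths j + 1 >= 2, where t^(j+1) >= q. *)
Lemma trivial_part_le : `|trivial| <= K.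
Proof.
apply: le_trans sum_b_split; apply: le_trans (ler_normB _ _) _; rewrite lerD2l.
rewrite -[leRHS]mulr1.
apply: (sum_wgt_le (c := fun j => (odd j)%:R * (q%:R - 1))) => // j jJ; rewrite mulr1.
have tj : 1 <= t ^+ j.+1 by rewrite exprn_ege1 // sqrt_q_ge1.
have q1 : 1 <= q%:R :> R by rewrite ler1n /q; lia.
case: (boolP (odd j)) => oj; last by rewrite mul0r normr0; lra.
have : q%:R <= t ^+ j.+1.
  rewrite -(@sqrt_q_sqr R r) -/q -/t; apply: ler_weXn2l; first exact: sqrt_q_ge1.
  by case: (j) oj.
by rewrite mul1r ger0_norm ?subr_ge0 // => ?; lra.
Qed.

(** Nonperiodic words contribute exactly 0. The periodic ones number O(j t^j), and each contributes
    at most the number of its tight patterns. *)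
Lemma moment_poly0 : `|moment_poly.[0]| <= K * C0%:R.
Proof.
have -> : moment_poly.[0] = \sum_(j < J) wgt r b j *
    (\sum_(w : j.+1.-tuple L | cyclic w) ((word_poly w).[0] - 1)).
  rewrite horner_sum; apply: eq_bigr => j _; rewrite hornerZ horner_sum; congr (_ * _).
  by apply: eq_bigr => w _; rewrite hornerD hornerN horner_exp falling_poly0 expr1n.
apply: le_trans (_ : (\sum_(j < J) `|b j.+1|) * C0%:R <= _); last first.
  by rewrite ler_wpM2r //; have := sum_b_split; have := normr_ge0 (b 0); lra.
apply: (sum_wgt_le (c := fun j => \sum_(w : j.+1.-tuple L | cyclic w) ((word_poly w).[0] - 1))) => // j jJ.
apply: le_trans (ler_norm_sum _ _ _) _.
apply: le_trans (_ : \sum_(w : j.+1.-tuple L | cyclic w)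
    (if periodic w then (j.+2 ^ (s * s))%:R else 0) <= _).
  apply: ler_sum => w cw.
  rewrite /word_poly (expect_poly0 R (base s j) (@dart_src_rev s j) (@dart_tgt_rev s j)
   (@dart_letter_rev r s j w) (@dart_src_out s j) (@dart_src_in s j) (dart_letter_out_in cw)).
  case: ifP => pw; last by rewrite (card_tight_nonperiodic s cw) ?pw // subrr normr0.
  have := card_tight_le s cw; rewrite -(ler_nat R) => h.
  have : 1 <= (j.+2 ^ (s * s))%:R :> R by rewrite ler1n expn_gt0.
  rewrite ler_norml => ?; apply/andP; split; last first.
    by apply: le_trans h; rewrite lerBlDr lerDl.
  have : 0 <= #|[set kappa | good_kernel (@dart_src s j) (@dart_tgt s j) (@dart_letter r s j w) (base s j) kappa
     & nverts kappa == (\sum_k #|edges (@dart_src s j) (@dart_tgt s j) (@dart_letter r s j w) kappa k|)%N]%SET|%:R :> R by [].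
  lra.
rewrite -big_mkcondr sumr_const -[_ *+ _]mulr_natr -natrM.
have -> : #|[pred w : j.+1.-tuple L | cyclic w && periodic w]| =
  #|[set w : j.+1.-tuple L | cyclic w && periodic w]%SET| by rewrite cardsE.
apply: le_trans (_ : (j.+2 ^ (s * s) * (j.+1 * (2 * q ^ j.+1./2)))%:R <= _).
  by rewrite ler_nat leq_mul2l card_periodic_words ?orbT.
have C0E : (j.+2 ^ (s * s) * j.+1 <= C0)%N.
  rewrite mulnC leq_mul //; case: (s * s)%N => // e; rewrite leq_exp2r //.
rewrite mulnA natrM mulrC natrM natrX -/q.
apply: ler_pM; rewrite ?mulr_ge0 ?exprn_ge0 //.
  by rewrite ler_wpM2l // exp_half_le.
by rewrite ler_nat.
Qed.

Lemma M_le_m : (M <= m)%N.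
Proof. by apply: leq_trans (leq_pmull M r0) _; rewrite /m -addn2 -addnA leq_addr. Qed.

Lemma falling_le1 N : (M <= N)%N -> (0 < N)%N -> (falling_poly R 0 M).[N%:R^-1] <= 1.
Proof.
move=> MN N0; rewrite horner_falling big_nat; apply: prodr_ile1 => i /= iM.
rewrite subr_ge0 ler_pdivrMr ?ltr0n // mul1r ler_nat lerBlDr lerDl.
by rewrite divr_ge0 // andbT; lia.
Qed.

(** Undoing the clearing of denominators costs at most the factor 2 seen in [moment_bound]. *)
Lemma falling_ge_half N : (m ^ 6 <= N)%N -> 2^-1 <= (falling_poly R 0 M).[N%:R^-1] ^+ r.
Proof.
move=> mN.
have mm : (2 * (r * M * M) <= m ^ 6)%N.
  apply: leq_trans (_ : m ^ 3 <= _)%N; last by rewrite leq_exp2l.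
  rewrite !expnS expn0 muln1 leq_mul // ?leq_mul //; rewrite /m; nia.
have N0 : (0 < N)%N by apply: leq_trans mN; rewrite expn_gt0.
have MN : (M <= N)%N.
  apply: leq_trans mN; apply: leq_trans M_le_m _; rewrite -{1}(expn1 m) leq_exp2l //.
have N0' : (0 : R) < N%:R by rewrite ltr0n.
have x01 : 0 <= (M%:R / N%:R : R) <= 1.
  by rewrite divr_ge0 //= ler_pdivrMr // mul1r ler_nat.
apply: le_trans (_ : (1 - M%:R / N%:R) ^+ (M * r) <= _).
  apply: le_trans (bernoulli_le (M * r) x01).
  have : (M * r)%:R * (M%:R / N%:R) <= 2^-1 :> R; last lra.
  rewrite mulrA ler_pdivrMr // ler_pdivlMl // -!natrM ler_nat (leq_trans _ mN) // (leq_trans _ mm) //.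
  by rewrite (mulnC M r).
rewrite exprM lerXn2r ?nnegrE ?exprn_ge0 ?subr_ge0 //.
- by case/andP: x01.
- by rewrite ltW // falling_gt0.
have -> : (1 - M%:R / N%:R) ^+ M = \prod_(0 <= i < M) (1 - M%:R / N%:R) :> R.
  by rewrite prodr_const_nat subn0.
rewrite horner_falling !big_nat; apply: ler_prod => i /= iM.
have /andP[_ x1] := x01; rewrite subr_ge0 x1 /= lerD2l lerN2 ler_pM2r ?invr_gt0 // ler_nat ltnW //.
Qed.

(** The only input at general n >= m is that a test sum is at most the dimension; interpolation
    converts this polynomial growth into control near 0. *)
Lemma moment_bound N : (m ^ 6 <= N)%N ->
  mean (@test_sum R r s N F) <= K * N%:R ^+ s
    + 2 * (K * C0%:R + (4 * m)%:R * (2 + C0%:R) * (m ^ 6)%:R ^+ s.+1 / N%:R).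
Proof.
have Xpos n : (m <= n)%N -> (0 < #|X n|)%N.
  by move=> mn; rewrite card_dtuple_ord ffact_gt0 (leq_trans _ mn) // /m; lia.
have Xle n : #|X n|%:R <= n%:R ^+ s :> R by rewrite -natrX ler_nat card_dtuple_le.
have Mm := M_le_m.
have D01 n : (m <= n)%N -> 0 < (falling_poly R 0 M).[n%:R^-1] ^+ r <= 1.
  move=> mn; have Mn := leq_trans Mm mn; have n0 : (0 < n)%N by apply: leq_trans mn.
  by rewrite exprn_gt0 ?falling_gt0 //= exprn_ile1 ?falling_le1 // ltW // falling_gt0.
have K0 := coef_norm_ge0.
have trivial_n n : (m <= n)%N -> `|(#|X n|%:R - 1) * trivial| <= K * n%:R ^+ s.
  move=> /Xpos X0; have X1 : 1 <= #|X n|%:R :> R by rewrite ler1n.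
  rewrite normrM ger0_norm ?subr_ge0 // mulrC; apply: ler_pM => //; first by rewrite subr_ge0.
    exact: trivial_part_le.
  by apply: le_trans (Xle n); lra.
have mean_n n : (m <= n)%N -> `|mean (@test_sum R r s n F)| <= n%:R ^+ s.
  move=> mn; apply: norm_mean_le => g; apply: le_trans (Xle n).
  by apply: test_sum_norm => //; apply: Xpos.
(* Removing the constant term and dividing by the variable is what yields the gain 1/N. *)
pose p := drop_poly 1 moment_poly.
have pE x : moment_poly.[x] = moment_poly.[0] + x * p.[x].
  have e y : moment_poly.[y] = (take_poly 1 moment_poly).[y] + p.[y] * y.
    by rewrite -{1}(poly_take_drop 1 moment_poly) hornerD hornerM hornerXn expr1.
  rewrite (e x) (e 0) mulr0 addr0 [x * _]mulrC; congr (_ + _).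
  have /size1_polyC -> : (size (take_poly 1 moment_poly) <= 1)%N by apply: size_take_poly.
  by rewrite !hornerC.
have sp : (size p <= m)%N.
  by rewrite size_drop_poly; have := size_moment_poly; rewrite /m; lia.
have G0 := moment_poly0.
have C00 : 0 <= C0%:R :> R by [].
have pN n : (m <= n)%N -> `|p.[n%:R^-1]| <= (2 + C0%:R) * n%:R ^+ s.+1.
  move=> mn; have n0 : (0 : R) < n%:R by rewrite ltr0n; apply: leq_trans mn.
  have n1 : (1 : R) <= n%:R ^+ s by rewrite exprn_ege1 // ler1n -(ltr0n R).
  have Mn := leq_trans Mm mn; have n0' : (0 < n)%N by apply: leq_trans mn.
  have -> : p.[n%:R^-1] = (moment_poly.[n%:R^-1] - moment_poly.[0]) * n%:R.
    by rewrite (pE n%:R^-1) addrAC subrr add0r mulrAC mulVf ?mul1r // gt_eqF.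
  rewrite normrM (gtr0_norm n0) exprSr mulrA ler_wpM2r //.
  apply: le_trans (ler_normB _ _) _; rewrite moment_polyE // normrM.
  have /andP[D0 D1] := D01 n mn; rewrite (gtr0_norm D0).
  have h1 := mean_n n mn; have h2 := trivial_n n mn.
  have h3 : `|mean (@test_sum R r s n F) - (#|X n|%:R - 1) * trivial| <= 2 * n%:R ^+ s.
    apply: le_trans (ler_normB _ _) _.
    have : K * n%:R ^+ s <= n%:R ^+ s by rewrite ler_piMl // (le_trans ler01).
    lra.
  have h4 : K * C0%:R <= C0%:R * n%:R ^+ s.
    apply: le_trans (_ : 1 * C0%:R <= _); first by rewrite ler_wpM2r.
    by rewrite mul1r ler_peMr.
  set u := `|_ - _ * trivial| in h3 *; have : (falling_poly R 0 M).[n%:R^-1] ^+ r * u <= 1 * u.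
    by rewrite ler_wpM2r // normr_ge0.
  lra.
move=> mN; have mN1 : (m <= N)%N by apply: leq_trans mN; rewrite -{1}(expn1 m) leq_exp2l.
have pB := interp_bound (isT : 1 < m)%N sp (addr_ge0 (ler0n R 2) C00) pN mN.
have N0 : (0 < N)%N by apply: leq_trans mN1.
have N0' : (0 : R) < N%:R by rewrite ltr0n.
have MN := leq_trans Mm mN1.
set E := (4 * m)%:R * _ * _ in pB *.
have hG : moment_poly.[N%:R^-1] <= K * C0%:R + E / N%:R.
  rewrite pE; apply: lerD; first by apply: le_trans (ler_norm _) G0.
  rewrite mulrC ler_pM2r ?invr_gt0 //; exact: le_trans (ler_norm _) pB.
have E0 : 0 <= K * C0%:R + E / N%:R.
  by rewrite addr_ge0 ?mulr_ge0 ?divr_ge0 //; rewrite (le_trans _ pB).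
have hD := falling_ge_half mN.
rewrite moment_polyE // in hG.
have hT := trivial_n N mN1; have := ler_norm ((#|X N|%:R - 1) * trivial).
move: hG hD; set D := _ ^+ r; set Y := mean _; set T := (_ - 1) * trivial in hT *.
set Z := K * C0%:R + E / N%:R in E0 *.
move=> hG hD hn.
have : Y - T <= 2 * Z.
  have [YT|YT] := leP (Y - T) 0; first by apply: le_trans YT _; rewrite mulr_ge0.
  have : 2^-1 * (Y - T) <= D * (Y - T) by rewrite ler_pM2r.
  lra.
lra.
Qed.

End Moment.

(** * Asymptotics *)

Section Asymptotics.
Variable R : realType.

(** Bernoulli bounds y by (1 - v)^(E+1), and (k + 1) (1 - v)^k stays below 1/v. Of the E + 1 copies
    of (1 - v)^k, E absorb the power of k + 1 and the spare one gives decay like 1/(k + 1). *)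
Lemma poly_geometric (y eps : R) E : 0 < y < 1 -> 0 < eps ->
  exists k0, forall k, (k0 <= k)%N -> k.+1%:R ^+ E * y ^+ k <= eps.
Proof.
case/andP=> y0 y1 eps0; pose v := (1 - y) / E.+1%:R.
have E0 : (0 : R) < E.+1%:R by rewrite ltr0n.
have v0 : 0 < v by rewrite divr_gt0 // subr_gt0.
have E1 : (1 : R) <= E.+1%:R by rewrite ler1n.
have v1 : v <= 1 by rewrite ler_pdivrMr // mul1r; lra.
have v01 : 0 <= v <= 1 by rewrite ltW.
have yz : y <= (1 - v) ^+ E.+1.
  apply: le_trans (bernoulli_le E.+1 v01); rewrite /v mulrC divfK ?gt_eqF //; lra.
have kz k : k.+1%:R * (1 - v) ^+ k <= v^-1.
  rewrite -[leRHS]mul1r ler_pdivlMr //; apply: le_trans (expr_sub1_le k v01).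
  rewrite mulrAC mulrC ler_wpM2l ?exprn_ge0 ?subr_ge0 // -natr1 mulrDl mul1r; lra.
have [k0 hk0] : exists k0 : nat, v^-1 ^+ E.+1 / eps < k0%:R.
  by exists (Num.bound (v^-1 ^+ E.+1 / eps)); apply: archi_boundP; rewrite divr_ge0 ?exprn_ge0 ?invr_ge0 // ltW.
exists k0 => k kk; have k1 : (0 : R) < k.+1%:R by rewrite ltr0n.
have z0 : 0 <= (1 - v) ^+ k by rewrite exprn_ge0 // subr_ge0.
apply: le_trans (_ : k.+1%:R ^+ E * (1 - v) ^+ k ^+ E.+1 <= _).
  rewrite ler_wpM2l ?exprn_ge0 // -exprM mulnC exprM lerXn2r ?nnegrE ?exprn_ge0 ?subr_ge0 //; exact: ltW.
rewrite exprSr mulrA -exprMn -(ler_pM2r k1) -mulrA.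
rewrite [X in _ * X <= _](_ : _ = k.+1%:R * (1 - v) ^+ k); last by rewrite mulrC.
apply: le_trans (_ : v^-1 ^+ E * v^-1 <= _).
  have w0 : 0 <= k.+1%:R * (1 - v) ^+ k by rewrite mulr_ge0.
  have vi0 : 0 <= v^-1 by rewrite invr_ge0 ltW.
  apply: ler_pM => //; first by rewrite exprn_ge0.
    by rewrite lerXn2r // nnegrE.
rewrite -exprSr mulrC -ler_pdivrMr //; apply: le_trans (ltW hk0) _.
by rewrite ler_nat (leq_trans kk).
Qed.

Lemma ffact_ge (N s : nat) : (0 < s < N)%N -> (N <= N ^_ s)%N.
Proof.
case: s => // s /= sN; rewrite ffactnS leq_pmulr // ffact_gt0; lia.
Qed.

Lemma mu_tuples_le (s r N : nat) (g : {ffun 'I_r -> 'S_N}) : mu_tuples R s g <= (2 * r)%:R.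
Proof.
have H x : x \in eigenvalues (schreier_adj R ('P * s) (s.-dtuple([set: 'I_N]))%SET g) ->
   `|x| <= (2 * r)%:R by exact: eigenvalues_le.
rewrite /mu_tuples /mu ge_max; move: (eigenvalues _) H => e H.
apply/andP; split.
  have [e1|e1] := ltnP 1 (size e); last by rewrite nth_default.
  by apply: le_trans (ler_norm _) (H _ (mem_nth _ e1)).
case: e H => [|x e] H /=; first by rewrite oppr0.
by apply: le_trans (ler_norm _) _; rewrite normrN H // mem_last.
Qed.

Lemma unif_prob_le1 (T : finType) (E : pred T) : unif_prob R E <= 1.
Proof.
rewrite /unif_prob; have [->|T0] := posnP #|T|; first by rewrite invr0 mulr0.
by rewrite ler_pdivrMr ?ltr0n // mul1r ler_nat max_card.
Qed.

Section Tail.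
Variables (s r : nat) (theta : R).
Hypotheses (s0 : (0 < s)%N) (r0 : (0 < r)%N).
Let rho : R := 2 * Num.sqrt (2 * r).-1%:R.

Lemma mean_mu N : mean (fun g : {ffun 'I_r -> 'S_N} => (mu_tuples R s g < theta)%R%:R) =
  unif_prob R (fun g : {ffun 'I_r -> 'S_N} => mu_tuples R s g < theta).
Proof.
rewrite /mean /unif_prob card_perm_tuples -sum1dep_card natr_sum [in RHS]big_mkcond /=.
by congr (_ / _); apply: eq_bigr => g _; case: ifP.
Qed.

(** Markov's inequality for the nonnegative [test_sum]. *)
Lemma mu_tail (J : nat) (b : nat -> R) (F : R -> R) (c : R) N :
  (forall x, F x = \sum_(j < J.+1) b j * chebT j (x / rho)) ->
  (forall x, `|x| <= (2 * r)%:R -> 0 <= F x <= 1) ->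
  (forall x, theta <= `|x| <= (2 * r)%:R -> c <= F x) ->
  0 < c -> (s < N)%N ->
  c * (1 - unif_prob R (fun g : {ffun 'I_r -> 'S_N} => mu_tuples R s g < theta))
    <= mean (@test_sum R r s N F).
Proof.
move=> FE F01 cF c0 sN.
have X1 : (1 < #|(s.-dtuple([set: 'I_N]))%SET|)%N.
  by rewrite card_dtuple_ord (leq_trans _ (ffact_ge _)) ?s0 //; lia.
rewrite -mean_mu.
have -> : c * (1 - mean (fun g : {ffun 'I_r -> 'S_N} => (mu_tuples R s g < theta)%R%:R)) =
   mean (fun g : {ffun 'I_r -> 'S_N} => c * (1 - (mu_tuples R s g < theta)%R%:R)).
  rewrite -[X in X - _](mean_const r N) /mean -mulrBl -sumrB mulrA mulr_sumr //.
apply: le_mean => g; case: ltP => mt.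
  by rewrite subrr mulr0; apply: test_sum_ge0.
by rewrite subr0 mulr1; apply: (test_sum_mu F01 X1 cF).
Qed.

End Tail.

Lemma aas_true (r : nat) (E : forall N, pred {ffun 'I_r -> 'S_N}) :
  (forall N g, E N g) -> aas R E.
Proof.
move=> ET; rewrite /aas (_ : (fun N => _) = (fun=> 1)); first exact: cvg_cst.
apply/funext => N; rewrite /unif_prob (_ : [set x | E N x]%SET = [set: _]%SET).
  by rewrite cardsT divff // card_perm_tuples fact_neq0.
by apply/setP => g; rewrite !inE ET.
Qed.

Lemma aas_mu_lt (s r : nat) (theta : R) : (0 < s)%N -> (0 < r)%N ->
  2 * Num.sqrt ((2 * r)%:R - 1) < theta ->
  aas R (fun N (sigma : {ffun 'I_r -> 'S_N}) => mu_tuples R s sigma < theta).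
Proof.
move=> s0 r0; have -> : (2 * r)%:R - 1 = (2 * r).-1%:R :> R.
  by rewrite -subn1 natrB //; lia.
(* Beyond the degree the claim is trivial, and [test_function] wants theta <= dd. *)
move=> th; have [dth|thd] := ltP (2 * r)%:R theta.
  by apply: aas_true => N g; apply: le_lt_trans (mu_tuples_le _ _) dth.
set rho := 2 * _ in th.
have rho0 : 0 < rho by rewrite mulr_gt0 // sqrtr_gt0 ltr0n; lia.
pose eta : R := 2^-1 ^+ s.+2.
have eta0 : 0 < eta by rewrite exprn_gt0 // invr_gt0.
have [||//|J0 [h [hb h1 h78]]] := @test_function R (theta / rho) ((2 * r)%:R / rho) eta.
- by rewrite ltr_pdivlMr // mul1r.
- by rewrite ler_pM2r // invr_gt0.
pose F k x := h (x / rho) ^+ (2 * k).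
have normrho x : `|x / rho| = `|x| / rho by rewrite normrM normfV (gtr0_norm rho0).
have F01 k x : `|x| <= (2 * r)%:R -> 0 <= F k x <= 1.
  move=> xd; rewrite /F exprM exprn_ge0 ?sqr_ge0 //= exprn_ile1 ?sqr_ge0 //.
  by rewrite -real_normK ?num_real // exprn_ile1 // h1 // normrho ler_pM2r ?invr_gt0.
have cF k x : theta <= `|x| <= (2 * r)%:R -> (7 / 8) ^+ (2 * k) <= F k x.
  move=> xd; have h0 : 7 / 8 <= h (x / rho) by apply: h78; rewrite normrho !ler_pM2r ?invr_gt0.
  have p78 : 0 <= 7 / 8 :> R by lra.
  by rewrite lerXn2r // nnegrE // (le_trans p78).
(* Chosen so that u = c1 (k + 1) dominates both m and J + 1, where J = 2 k J0 is the degree bound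
   for h^(2k). *)
pose c1 := (2 * r * s * J0 + 2 * J0 + s + 3)%N.
(* Powers of u: s * s + 1 for C0, 1 for 4 m, and 6 (s + 1) for the interpolation factor. In [A]
   below, 26 = 2 (1 + 12) collects the two error terms of [moment_bound]. *)
pose E := (s * s + 1 + 1 + 6 * s.+1)%N.
pose A : R := (2 ^+ s + 26) * c1%:R ^+ E.
have A0 : 0 < A by rewrite mulr_gt0 ?exprn_gt0 ?addr_gt0 ?exprn_gt0 // ltr0n /c1; lia.
have key k N : (2 ^ k <= N < 2 ^ k.+1)%N -> ((c1 * k.+1) ^ 6 <= N)%N ->
   1 - unif_prob R (fun g : {ffun 'I_r -> 'S_N} => mu_tuples R s g < theta) <=
     A * (k.+1%:R ^+ E * (32 / 49) ^+ k).
  case/andP=> kN Nk uN.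
  pose J := (2 * k * J0)%N; pose u := (c1 * k.+1)%N.
  have [b [bE bK]] := cheb_boundedX (2 * k) hb.
  have FE x : F k x = \sum_(j < J.+1) b j * chebT j (x / rho) by rewrite /F bE.
  have u0 : (0 < u)%N by rewrite /u /c1; lia.
  pose m := (r * (s * J) + s).+2.
  have mu_ : (m <= u)%N by rewrite /m /u /J /c1; nia.
  have Ju : (J.+1 <= u)%N by rewrite /J /u /c1; nia.
  have mN : (m ^ 6 <= N)%N by apply: leq_trans uN; rewrite leq_exp2r.
  have sN : (s < N)%N.
    apply: leq_trans mN; apply: leq_trans (_ : m ^ 1 <= _)%N; last by rewrite leq_exp2l.
    by rewrite expn1 /m; lia.
  have eta1 : eta <= 1 by rewrite exprn_ile1 ?invr_ge0 // invf_le1 // ler1n.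
  have K1 : eta ^+ (2 * k) <= 1 by rewrite exprn_ile1 // ltW.
  have c0 : 0 < (7 / 8) ^+ (2 * k) :> R by rewrite exprn_gt0; lra.
  have tail := mu_tail s0 r0 FE (F01 k) (cF k) c0 sN.
  have mb := moment_bound r0 FE (F01 k) bK K1 mN.
  set P := 1 - _ in tail *; set K := eta ^+ _ in mb K1.
  set C0 := (J * J.+1 ^ (s * s))%N in mb.
  set Y := (2^-1 : R) ^+ k.
  have N0 : (0 < N)%N by apply: leq_trans sN.
  have u1 e e' : (e <= e')%N -> (u ^ e)%:R <= u%:R ^+ e' :> R.
    by move=> ee; rewrite -natrX ler_nat leq_pexp2l.
  have C0u : C0%:R <= u%:R ^+ (s * s + 1) :> R.
    apply: le_trans (u1 (s * s + 1)%N _ (leqnn _)); rewrite ler_nat addn1 expnS leq_mul //; first exact: ltnW.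
    by case: (s * s)%N => // e; rewrite leq_exp2r.
  have Y0 : 0 < Y by rewrite exprn_gt0 // invr_gt0.
  have NY : N%:R^-1 <= Y.
    rewrite /Y exprVn lef_pV2 ?posrE ?ltr0n ?exprn_gt0 // -natrX ler_nat //.
  have KY : K <= Y.
    rewrite /K /Y /eta -exprM; apply: ler_wiXn2l; rewrite ?invr_ge0 //; last by rewrite mulnA leq_pmull.
    by rewrite invf_le1 // ler1n.
  have KN : K * N%:R ^+ s <= 2 ^+ s * Y.
    apply: le_trans (_ : K * (2 ^+ (k.+1 * s)) <= _).
      have K0 : 0 <= K by rewrite exprn_ge0 // ltW.
      have N2 : N%:R <= 2 ^+ k.+1 :> R by rewrite -natrX ler_nat ltnW.
      by rewrite ler_wpM2l // exprM lerXn2r ?nnegrE ?exprn_ge0.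
    rewrite mulSn exprD mulrCA ler_wpM2l ?exprn_ge0 //.
    rewrite /K /Y /eta -exprM (_ : (s.+2 * (2 * k)) = (k + k * s) + (k * s + 3 * k))%N; last by clear; nia.
    move: (3 * k)%N => k3; rewrite !exprD -!mulrA -[leRHS]mulr1 ler_wpM2l ?exprn_ge0 ?invr_ge0 //.
    have i1 n : (2^-1 : R) ^+ n <= 1 by rewrite exprn_ile1 ?invr_ge0 // invf_le1 // ler1n.
    have e1 : 2^-1 ^+ (k * s) * 2 ^+ (k * s) = 1 :> R by rewrite -exprMn mulVf ?expr1n.
    have -> : 2^-1 ^+ (k * s) * (2^-1 ^+ (k * s) * (2^-1 ^+ k3 * 2 ^+ (k * s))) =
      2^-1 ^+ (k * s) * 2^-1 ^+ k3 * (2^-1 ^+ (k * s) * 2 ^+ (k * s)) :> R by ring.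
    by rewrite e1 mulr1 mulr_ile1 ?exprn_ge0 ?invr_ge0.
  have hm : (4 * m)%:R * (2 + C0%:R) * (m ^ 6)%:R ^+ s.+1 <= 12 * u%:R ^+ E :> R.
    have u11 : 1 <= u%:R ^+ (s * s + 1) :> R by apply: (u1 0%N).
    have -> : 12 * u%:R ^+ E = (4 * u%:R) * (3 * u%:R ^+ (s * s + 1)) * (u%:R ^+ 6) ^+ s.+1 :> R.
      by rewrite /E !exprD !exprM expr1; ring.
    have C00 : 0 <= C0%:R :> R by [].
    have m1 : (4 * m)%:R <= 4 * u%:R :> R by rewrite natrM ler_wpM2l // ler_nat.
    have m2 : 2 + C0%:R <= 3 * u%:R ^+ (s * s + 1) :> R by lra.
    have m3 : (m ^ 6)%:R ^+ s.+1 <= (u%:R ^+ 6) ^+ s.+1 :> R.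
      have m4 : (m ^ 6)%:R <= u%:R ^+ 6 :> R by rewrite -natrX ler_nat leq_exp2r.
      by rewrite lerXn2r // nnegrE ?exprn_ge0.
    have c2 : 0 <= 2 + C0%:R :> R by rewrite addr_ge0.
    have m5 : 0 <= (m ^ 6)%:R ^+ s.+1 :> R by rewrite exprn_ge0.
    exact: ler_pM (mulr_ge0 (ler0n R _) c2) m5 (ler_pM (ler0n R _) c2 m1 m2) m3.
  have uE : 1 <= u%:R ^+ E :> R by apply: (u1 0%N).
  have CE : C0%:R <= u%:R ^+ E :> R.
    by apply: le_trans C0u _; rewrite ler_weXn2l ?ler1n // /E -addnA leq_addr.
  have tot : mean (@test_sum R r s N (F k)) <= (2 ^+ s + 26) * u%:R ^+ E * Y.
    apply: le_trans mb _.
    have t1 : K * C0%:R <= u%:R ^+ E * Y.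
      rewrite mulrC; apply: ler_pM => //; rewrite exprn_ge0 // ltW //.
    have t2 : (4 * m)%:R * (2 + C0%:R) * (m ^ 6)%:R ^+ s.+1 / N%:R <= 12 * u%:R ^+ E * Y.
      apply: ler_pM => //; rewrite ?invr_ge0 // !mulr_ge0 ?addr_ge0 ?exprn_ge0 //.
    have t3 : 2 ^+ s * Y <= 2 ^+ s * u%:R ^+ E * Y.
      have Y00 := ltW Y0.
      by rewrite ler_wpM2r // ler_peMr // exprn_ge0.
    apply: le_trans (lerD KN (ler_wpM2l (ler0n R 2) (lerD t1 t2))) _.
    have -> : (2 ^+ s + 26) * u%:R ^+ E * Y =
      2 ^+ s * u%:R ^+ E * Y + 2 * (u%:R ^+ E * Y + 12 * u%:R ^+ E * Y) by ring.
    by rewrite lerD2r.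
  have uEE : u%:R ^+ E = c1%:R ^+ E * k.+1%:R ^+ E :> R by rewrite natrM exprMn.
  have e32 : (32 / 49 : R) ^+ k = Y / (7 / 8) ^+ (2 * k).
    by rewrite /Y exprM -exprVn -exprMn; congr (_ ^+ _); field.
  have -> : A * (k.+1%:R ^+ E * (32 / 49) ^+ k) = (2 ^+ s + 26) * u%:R ^+ E * Y / (7 / 8) ^+ (2 * k).
    by rewrite e32 uEE /A; move: (_^-1) (_ ^+ E) (_ ^+ E) (2 ^+ s) => *; ring.
  by rewrite ler_pdivlMr // mulrC (le_trans tail tot).
apply/cvgrPdist_le => eps eps0.
have y01 : 0 < (32 / 49 : R) < 1 by apply/andP; split; lra.
have y02 : 0 < (2^-1 : R) < 1 by apply/andP; split; lra.
have [k1 hk1] := poly_geometric E y01 (divr_gt0 eps0 A0).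
have c1p : (0 < c1)%N by rewrite /c1 addnS.
have c10 : (0 : R) < (c1%:R ^+ 6)^-1 by rewrite invr_gt0 exprn_gt0 // ltr0n.
(* This ensures (c1 (k + 1))^6 <= 2^k <= N, the range where [moment_bound] applies. *)
have [k2 hk2] := poly_geometric 6 y02 c10.
exists (2 ^ maxn k1 k2)%N => // N /= kN.
have N0 : (0 < N)%N by apply: leq_trans kN; rewrite expn_gt0.
have kk := trunc_log_max (isT : 1 < 2)%N kN.
have /= := trunc_log_bounds (isT : 1 < 2)%N N0.
set k := trunc_log 2 N in kk * => kb.
have uN : ((c1 * k.+1) ^ 6 <= N)%N.
  apply: leq_trans (proj1 (andP kb)); have := hk2 k (leq_trans (leq_maxr _ _) kk).
  rewrite exprVn ler_pdivrMr ?exprn_gt0 // mulrC ler_pdivlMr ?exprn_gt0 ?ltr0n //.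
  by rewrite -!natrX -natrM ler_nat expnMn mulnC.
have P1 := unif_prob_le1 (fun g : {ffun 'I_r -> 'S_N} => mu_tuples R s g < theta).
rewrite ger0_norm ?subr_ge0 //; apply: le_trans (key k N kb uN) _.
rewrite mulrC -ler_pdivlMr //; exact: hk1 k (leq_trans (leq_maxl _ _) kk).
Qed.

(** From exp(-x) >= 1 - x one gets exp(x) <= 1 / (1 - x), whose remainder x^2 / (1 - x) is at most 2
    x^2 for x <= 1/2. *)
Lemma expR_taylor2 (x : R) : 0 <= x <= 2^-1 -> 0 <= expR x - 1 - x <= 2 * x ^+ 2.
Proof.
case/andP=> x0 x1; apply/andP; split; first by have := expR_ge1Dx x; lra.
have e0 := expR_gt0 x; have := expR_ge1Dx (- x); rewrite expRN => h.
have : (1 - x) * expR x <= 1 by rewrite -ler_pdivlMr // mul1r.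
have x2 : 0 <= x ^+ 2 by rewrite sqr_ge0.
by move: (expR x) e0 => y *; nra.
Qed.

End Asymptotics.

Unset Implicit Arguments.

Theorem theorem1p10 (R : realType) :
  [/\ forall s r : nat, (0 < s)%N -> (0 < r)%N ->
        aas R (fun N (sigma : {ffun 'I_r -> 'S_N}) =>
          mu_tuples R s sigma < schreier_bound R s (2 * r)),
      exists err : nat -> nat -> R,
        [/\ exists C : R, forall s : nat, (0 < s)%N ->
              exists r0 : nat, forall r : nat, (0 < r)%N -> (r0 <= r)%N ->
                `|err s (2 * r)%N|
                <= C * (s%:R ^+ 4 / ((2 * r)%:R - 1) `^ (3 / 2)),
            forall s r : nat, (0 < s)%N -> (0 < r)%N ->
              schreier_bound R s (2 * r)
              = 2 * Num.sqrt ((2 * r)%:R - 1)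
                + 4 * s%:R ^+ 2 / (expR 1 ^+ 2 * Num.sqrt ((2 * r)%:R - 1))
                + err s (2 * r)%N
          & forall s r : nat, (0 < s)%N -> (0 < r)%N ->
              aas R (fun N (sigma : {ffun 'I_r -> 'S_N}) =>
                mu_tuples R s sigma
                < 2 * Num.sqrt ((2 * r)%:R - 1)
                  + 4 * s%:R ^+ 2 / (expR 1 ^+ 2 * Num.sqrt ((2 * r)%:R - 1))
                  + err s (2 * r)%N)]
    & forall (s : nat) (eps : R), (0 < s)%N -> 0 < eps ->
        exists d0 : nat, forall r : nat, (0 < r)%N -> (d0 <= 2 * r)%N ->
          aas R (fun N (sigma : {ffun 'I_r -> 'S_N}) =>
            mu_tuples R s sigma < 2 * Num.sqrt ((2 * r)%:R - 1) + eps)].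
Proof.
have D1 r : (0 < r)%N -> 1 <= (2 * r)%:R - 1 :> R.
  by move=> r0; rewrite lerBrDr (_ : 1 + 1 = 2%:R) // ler_nat; lia.
have main s r : (0 < s)%N -> (0 < r)%N ->
  aas R (fun N (sigma : {ffun 'I_r -> 'S_N}) => mu_tuples R s sigma < schreier_bound R s (2 * r)).
  (* The exponential factor exceeds 1, so the bound is a fixed theta above rho. *)
  move=> s0 r0; apply: aas_mu_lt => //; have D := D1 r r0; have D0 := lt_le_trans ltr01 D.
  rewrite /schreier_bound ltr_pMr; last by rewrite mulr_gt0 // sqrtr_gt0.
  rewrite expR_gt1 divr_gt0 ?mulr_gt0 ?exprn_gt0 ?expR_gt0 ?ltr0n //.
pose err s d : R := schreier_bound R s d - (2 * Num.sqrt (d%:R - 1)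
  + 4 * s%:R ^+ 2 / (expR 1 ^+ 2 * Num.sqrt (d%:R - 1))).
have errE s r : 2 * Num.sqrt ((2 * r)%:R - 1)
                + 4 * s%:R ^+ 2 / (expR 1 ^+ 2 * Num.sqrt ((2 * r)%:R - 1))
                + err s (2 * r)%N = schreier_bound R s (2 * r).
  by rewrite /err addrC subrK.
split; [exact: main| |].
- exists err; split; last first.
  + by move=> s r s0 r0; rewrite errE; apply: main.
  + by move=> s r s0 r0; rewrite errE.
  (* The threshold gives 4 s^2 <= d - 1, hence an exponent x <= 1/2. Then 16 = 2 * 2 * 4 comes from
     the prefactor 2 sqrt(d - 1), the remainder 2 x^2 and x^2 <= 4 s^4 / (d - 1)^2. *)
  exists 16 => s s0; exists (2 * s ^ 2).+1 => r r0 rs.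
  have D := D1 r r0; have D0 := lt_le_trans ltr01 D.
  have sD : 4 * s%:R ^+ 2 <= (2 * r)%:R - 1 :> R.
    by rewrite lerBrDr -natrX -natrM natr1 ler_nat; lia.
  rewrite /err /schreier_bound; set D_ := (2 * r)%:R - 1 in D D0 sD *.
  have e1 : 1 <= expR 1 ^+ 2 :> R.
    by rewrite exprn_ege1 //; have := expR_ge1Dx (1 : R); lra.
  have e0 := lt_le_trans ltr01 e1.
  pose x := 2 * s%:R ^+ 2 / (expR 1 ^+ 2 * D_).
  have x0 : 0 <= x by rewrite divr_ge0 ?mulr_ge0 ?exprn_ge0 // ltW.
  have xD : x <= 2 * s%:R ^+ 2 / D_.
    rewrite /x ler_wpM2l ?mulr_ge0 ?exprn_ge0 // lef_pV2 ?posrE ?mulr_gt0 //.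
    by rewrite ler_peMl // ltW.
  have x1 : x <= 2^-1.
    by apply: le_trans xD _; rewrite ler_pdivrMr //; lra.
  have /andP[t0 t1] := @expR_taylor2 R x (introT andP (conj x0 x1)).
  have q0 : 0 < Num.sqrt D_ by rewrite sqrtr_gt0.
  have qq : Num.sqrt D_ ^+ 2 = D_ by rewrite sqr_sqrtr // ltW.
  rewrite -/x.
  have -> : 4 * s%:R ^+ 2 / (expR 1 ^+ 2 * Num.sqrt D_) = 2 * Num.sqrt D_ * x.
    rewrite /x; move: (Num.sqrt D_) q0 qq (expR_gt0 (1 : R)) => w w0 <- ee.
    by field; rewrite !gt_eqF.
  have -> : 2 * Num.sqrt D_ * expR x - (2 * Num.sqrt D_ + 2 * Num.sqrt D_ * x)
     = 2 * Num.sqrt D_ * (expR x - 1 - x) by ring.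
  have p32 : D_ `^ (3 / 2) = D_ * Num.sqrt D_.
    rewrite (_ : 3 / 2 = 1 + 2^-1); last by lra.
    by rewrite powRD ?gt_eqF ?implybT // powRr1 ?powR12_sqrt // ltW.
  rewrite ger0_norm ?mulr_ge0 // ?(ltW q0) // p32.
  have x2 : x ^+ 2 <= 4 * s%:R ^+ 4 / D_ ^+ 2.
    apply: le_trans (_ : (2 * s%:R ^+ 2 / D_) ^+ 2 <= _).
      by rewrite lerXn2r // nnegrE // (le_trans x0).
    by rewrite le_eqVlt; apply/orP; left; apply/eqP; field; rewrite gt_eqF.
  have -> : 16 * (s%:R ^+ 4 / (D_ * Num.sqrt D_)) =
     2 * Num.sqrt D_ * (2 * (4 * s%:R ^+ 4 / D_ ^+ 2)).
    move: (Num.sqrt D_) q0 qq => w w0 <-; by field; rewrite gt_eqF.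
  by rewrite ler_wpM2l ?mulr_ge0 ?(ltW q0) //; lra.
- move=> s eps s0 eps0; exists 0 => r r0 _; apply: aas_mu_lt => //.
  by rewrite ltrDl.
Qed.
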